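(* Consider the self-adjoint (unbounded, densely defined, closed) operator $-i\frac{d}{dx}:\mathcal{D}\to L^2[0,1]$, $f\mapsto-if'$, with domain $$\mathcal{D}=\{f\in L^2[0,1]: f\text{ absolutely continuous},\ f'\in L^2[0,1],\ f(0)=f(1)\},$$ and let $\Gamma=\{(f,-if'):f\in\mathcal{D}\}$ be its graph. Let $\gamma:[0,1]\to\mathcal{P}(L^2[0,1]\oplus L^2[0,1])$ be the unique minimal geodesic joining $\gamma(0)=P_{\mathrm{Gr}(0)}=P_{L^2[0,1]\oplus\{0\}}$ with $\gamma(1)=P_\Gamma$. Then: \begin{enumerate} \item For every $t\in(0,1)$, $\gamma(t)$ is the orthogonal projection onto the graph of the self-adjoint bounded operator $T(t):L^2[0,1]\to L^2[0,1]$ which is diagonal in the Fourier basis $\xi_n(x)=e^{i2\pi nx}$, $n\in\mathbb{Z}$, and is given in blocks with respect to the subspaces generated by $\{\xi_j\}_{j<0}$, $\{\xi_0\}$, $\{\xi_j\}_{j>0}$ by $$T(t)=\begin{pmatrix} \operatorname{diag}_{n<0}\{\tan(t\tan^{-1}(2\pi n))\} & 0 & 0 \\ 0 & 0 & 0 \\ 0 & 0 & \operatorname{diag}_{p>0}\{\tan(t\tan^{-1}(2\pi p))\} \end{pmatrix}.$$ \item For $0<t<1$ the operator norm of $T(t)$ is $\|T(t)\|=\tan(t\pi/2)$; hence $\lim_{t\to0}\|T(t)\|=0$ and $\lim_{t\to1}\|T(t)\|=+\infty$. \item For every $0<t<1$ the projection $\gamma(t)$ belongs to the domain $\mathcal{V}_0$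 of the principal chart of the Riemann sphere $\mathcal{R}$ of $\mathcal{A}=B(L^2[0,1])$. \item $\gamma(1)=P_\Gamma$ does not belong to $\mathcal{V}_0$; nevertheless $P_\Gamma$ lies on the boundary of $\mathcal{V}_0$. \item $\{T(t)\}_{t\in[0,1)}$ (with $T(0)=0$) is an optimal bounded deformation of $-i\frac{d}{dx}$. \end{enumerate}
   Context: Put $H=L^2[0,1]$. $\mathcal{P}(H\oplus H)$ is the manifold of orthogonal projections of $H\oplus H$; $P_V$ is the orthogonal projection onto $V$. Tangent vectors at $\tilde p$ are $X\in B(H\oplus H)$ with $X^*=X$, $X\tilde p+\tilde pX=X$; geodesics are $\gamma(t)=e^{t\tilde X}\tilde pe^{-t\tilde X}$ with $\tilde X=X\tilde p-\tilde pX$. Length is $\int\|\dot\gamma\|\,dt$ (operator norm), $\operatorname{dist}$ is the infimum of lengths of curves of projections with given endpoints, and a geodesic on $[0,1]$ is minimal if its length equals the distance between its endpoints. With $\tilde p_0=\begin{pmatrix} 1 & 0 \\ 0 & 0 \end{pmatrix}$, the Riemann sphere of $B(H)$ is $\mathcal{R}=\{\tilde u\tilde p_0\tilde u^*:\tilde u\text{ unitary in }B(H\oplus H)\}$. The domain of the principal chart is $\mathcal{V}_0=\{\mathbf{x}\mathbf{x}^*:\mathbf{x}=\begin{pmatrix} x_1 \\ x_2 \end{pmatrix}=\tilde u\begin{pmatrix} 1 \\ 0 \end{pmatrix},\ \tilde u\text{ unitary in }M_2(B(H)),\ x_1\text{ invertible in }B(H)\}\subset\mathcal{R}$. A bounded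 deformation of an unbounded closed operator $T$ is a family $\{T_t\}_{t\in[0,\alpha)}$, $\alpha>0$, of bounded operators such that $t\mapsto T_t$ is norm continuous and $\lim_{t\to\alpha^-}P_{\mathrm{Gr}(T_t)}=P_{\mathrm{Gr}(T)}$ in the Finsler metric of $\mathcal{R}$. It is optimal if, with $\tilde p_t=P_{\mathrm{Gr}(T_t)}$ and $\tilde p_\alpha=P_{\mathrm{Gr}(T)}$, $\operatorname{dist}(\tilde p_{t_0},\tilde p_\alpha)$ equals the length of $\tilde p_t$, $t\in[t_0,\alpha]$, for every $t_0\in[0,\alpha)$. *)

(* Defs.v *)
From HB Require Import structures.
From mathcomp Require Import all_boot all_order all_algebra.
From mathcomp Require Import generic_quotient.
From mathcomp Require Import all_classical all_reals all_analysis measurable_realfun.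
From mathcomp Require Import complex ring.

Set Implicit Arguments.
Unset Strict Implicit.
Unset Printing Implicit Defensive.

Import Order.TTheory GRing.Theory Num.Theory.
Import numFieldNormedType.Exports.

Local Open Scope classical_set_scope.
Local Open Scope complex_scope.
Local Open Scope ring_scope.

(* Complex inner product spaces; the product is linear in its first argument. *)
HB.mixin Record isInnerSpace (R : realType) V & GRing.Lmodule R[i] V := {
  ip : V -> V -> R[i] ;
  ip_linearl : forall (a : R[i]) (u v w : V),
    ip (a *: u + v) w = a * ip u w + ip v w ;
  ipC : forall u v : V, ip v u = (ip u v)^*%C ;
  ip_ge0 : forall u : V, 0 <= ip u u ;
  ip_eq0 : forall u : V, ip u u = 0 -> u = 0
}.

#[short(type="innerSpaceType")]
HB.structure Definition InnerSpace (R : realType) :=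
  {V of isInnerSpace R V & GRing.Lmodule R[i] V}.

(* Not the `|_| of MathComp: on V * W the latter would be the sup norm. *)
Definition hnorm (R : realType) (V : innerSpaceType R) (v : V) : R :=
  Num.sqrt (complex.Re (ip v v)).

Section InnerSpaceTheory.
Context {R : realType} {V : innerSpaceType R}.
Implicit Types u v w : V.

Lemma ipDl u v w : ip (u + v) w = ip u w + ip v w.
Proof. by have := ip_linearl 1 u v w; rewrite scale1r mul1r. Qed.

Lemma ip0l w : ip 0 w = 0.
Proof. by apply: (addrI (ip 0 w)); rewrite -ipDl !addr0. Qed.

Lemma ipZl a u w : ip (a *: u) w = a * ip u w.
Proof. by have := ip_linearl a u 0 w; rewrite ip0l !addr0. Qed.

Lemma ipDr u v w : ip w (u + v) = ip w u + ip w v.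
Proof. by rewrite ipC ipDl rmorphD/= -!ipC. Qed.

Lemma ipZr a u w : ip w (a *: u) = a^*%C * ip w u.
Proof. by rewrite ipC ipZl rmorphM/= -ipC. Qed.

Lemma ipE u : ip u u = (hnorm u ^+ 2)%:C.
Proof.
have u0 := ip_ge0 u.
rewrite /hnorm sqr_sqrtr; last by rewrite -ler0c (RRe_real (ger0_real u0)).
by rewrite (RRe_real (ger0_real u0)).
Qed.

Lemma hnorm_ge0 u : 0 <= hnorm u. Proof. exact: sqrtr_ge0. Qed.

Lemma hnorm0 : hnorm (0 : V) = 0.
Proof. by rewrite /hnorm ip0l sqrtr0. Qed.

Lemma hnorm_eq0 u : hnorm u = 0 -> u = 0.
Proof. by move=> u0; apply: ip_eq0; rewrite ipE u0 expr0n. Qed.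

Lemma hnormZ (a : R[i]) u : hnorm (a *: u) = complex.Re `|a| * hnorm u.
Proof.
have na : `|a| = (complex.Re `|a|)%:C by rewrite normc_def.
have na0 : 0 <= complex.Re `|a| by rewrite -ler0c -na.
apply/eqP; rewrite -(@eqrXn2 _ 2)// ?mulr_ge0 ?hnorm_ge0//.
set r := complex.Re _ in na *.
rewrite exprMn; apply/eqP/complexI; rewrite -ipE ipZl ipZr ipE.
by rewrite mulrA -sqr_normc na -/r !expr2 !rmorphM.
Qed.

Lemma hnormZR (a : R) u : hnorm (a%:C *: u) = `|a| * hnorm u.
Proof. by rewrite hnormZ normc_def/= expr0n addr0 sqrtr_sqr. Qed.

Lemma hnormN u : hnorm (- u) = hnorm u.
Proof. by rewrite -scaleN1r hnormZ normrN1 mul1r. Qed.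

Lemma Re_ip_le u v : complex.Re (ip u v) <= hnorm u * hnorm v.
Proof.
set b := complex.Re (ip u v).
have key (x y : R) : 0 <= x ^+ 2 * hnorm u ^+ 2 - x * y * b *+ 2
    + y ^+ 2 * hnorm v ^+ 2.
  have := ip_ge0 (x%:C *: u + (- y)%:C *: v).
  rewrite ipDl !ipDr !ipZl !ipZr !ipE !conjc_real (ipC u v).
  rewrite lecE => /andP[_].
  rewrite /b; case: (ip u v) => p q/=.
  rewrite !(mul0r, mulr0, subr0, addr0, oppr0) => /le_trans; apply.
  by rewrite le_eqVlt; apply/orP; left; apply/eqP; ring.
have [u0|u0] := eqVneq (hnorm u) 0.
  by rewrite /b (hnorm_eq0 u0) ip0l hnorm0 mul0r.
have [v0|v0] := eqVneq (hnorm v) 0.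
  by rewrite /b (hnorm_eq0 v0) ipC ip0l conjc0 hnorm0 mulr0.
have up : 0 < hnorm u by rewrite lt_def u0 hnorm_ge0.
have vp : 0 < hnorm v by rewrite lt_def v0 hnorm_ge0.
have := key (hnorm v) (hnorm u).
set x := hnorm u in up *; set y := hnorm v in vp *.
move=> h.
have h2 : 0 <= (y * x * (x * y - b)) *+ 2.
  by rewrite (le_trans h)// le_eqVlt; apply/orP; left; apply/eqP; ring.
by move: h2; rewrite pmulrn_lge0// pmulr_rge0 ?mulr_gt0// subr_ge0.
Qed.

Lemma ler_hnormD u v : hnorm (u + v) <= hnorm u + hnorm v.
Proof.
rewrite -(@ler_pXn2r _ 2)// ?nnegrE ?addr_ge0 ?hnorm_ge0//.
rewrite -lecR -ipE ipDl !ipDr !ipE (ipC u v).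
have := Re_ip_le u v; case: (ip u v) => p q/= pq.
rewrite lecE/=; apply/andP; split; first by apply/eqP; ring.
rewrite sqrrD -subr_ge0.
rewrite (_ : _ - _ = (hnorm u * hnorm v - p) *+ 2); last by rewrite mulr2n; ring.
by rewrite mulrn_wge0// subr_ge0.
Qed.

End InnerSpaceTheory.

Section ProdInnerSpace.
Context {R : realType} {V W : innerSpaceType R}.
Implicit Types x y z : V * W.

Definition prod_ip x y : R[i] := ip x.1 y.1 + ip x.2 y.2.

Lemma prod_ip_linearl (a : R[i]) x y z :
  prod_ip (a *: x + y) z = a * prod_ip x z + prod_ip y z.
Proof. by rewrite /prod_ip/= !ip_linearl; ring. Qed.

Lemma prod_ipC x y : prod_ip y x = (prod_ip x y)^*%C.
Proof. by rewrite /prod_ip rmorphD/= -!ipC. Qed.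

Lemma prod_ip_ge0 x : 0 <= prod_ip x x.
Proof. by rewrite addr_ge0// ip_ge0. Qed.

Lemma prod_ip_eq0 x : prod_ip x x = 0 -> x = 0.
Proof.
case: x => x1 x2 /eqP; rewrite /prod_ip/= paddr_eq0 ?ip_ge0//.
by move=> /andP[/eqP/ip_eq0 -> /eqP/ip_eq0 ->].
Qed.

HB.instance Definition _ := isInnerSpace.Build R (V * W)%type
  prod_ip_linearl prod_ipC prod_ip_ge0 prod_ip_eq0.

Lemma hnorm_fst x : hnorm x.1 <= hnorm x.
Proof.
rewrite -(@ler_pXn2r _ 2)// ?nnegrE ?hnorm_ge0// -lecR -!ipE.
by rewrite [leRHS]/(prod_ip x x) lerDl ip_ge0.
Qed.

Lemma hnorm_snd x : hnorm x.2 <= hnorm x.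
Proof.
rewrite -(@ler_pXn2r _ 2)// ?nnegrE ?hnorm_ge0// -lecR -!ipE.
by rewrite [leRHS]/(prod_ip x x) lerDr ip_ge0.
Qed.

End ProdInnerSpace.

(* Bounded operators.  They are made a normed module over R, rather than over  *)
(* R[i], so that the library's calculus of one real variable applies.          *)
Record bop (R : realType) (V W : innerSpaceType R) := Bop {
  bfun :> V -> W ;
  bop_linear : linear bfun ;
  bop_bounded : exists M : R, forall v, hnorm (bfun v) <= M * hnorm v
}.

Section BoundedOperators.
Context {R : realType}.
Implicit Types V W Z : innerSpaceType R.

HB.instance Definition _ V W := gen_eqMixin (bop V W).
HB.instance Definition _ V W := gen_choiceMixin (bop V W).

HB.instance Definition _ V W (A : bop V W) :=
  GRing.isLinear.Build R[i] V W _ (bfun A) (bop_linear A).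

Lemma bopP V W (A B : bop V W) : (forall v, A v = B v) -> A = B.
Proof.
case: A B => [f lf bf] [g lg bg]/= /funext fg; rewrite fg in lf bf *.
by rewrite (Prop_irrelevance lf lg) (Prop_irrelevance bf bg).
Qed.

Section Structure.
Context {V W : innerSpaceType R}.
Implicit Types A B C : bop V W.

Program Definition bop0 : bop V W := Bop (bfun := fun=> 0) _ _.
Next Obligation. by move=> a u v; rewrite scaler0 addr0. Qed.
Next Obligation. by exists 0 => v; rewrite hnorm0 mul0r. Qed.

Program Definition bopN A : bop V W := Bop (bfun := fun v => - A v) _ _.
Next Obligation. by move=> A a u v; rewrite linearP opprD scalerN. Qed.
Next Obligation.
by move=> A; have [M AM] := bop_bounded A; exists M => v; rewrite hnormN.
Qed.

Program Definition bopD A B : bop V W := Bop (bfun := fun v => A v + B v) _ _.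
Next Obligation. by move=> A B a u v; rewrite !linearP addrACA scalerDr. Qed.
Next Obligation.
move=> A B; have [M AM] := bop_bounded A; have [N BN] := bop_bounded B.
exists (M + N) => v; rewrite mulrDl (le_trans (ler_hnormD _ _))//.
exact: lerD (AM v) (BN v).
Qed.

Program Definition bopZ (r : R) A : bop V W :=
  Bop (bfun := fun v => r%:C *: A v) _ _.
Next Obligation.
by move=> r A a u v; rewrite linearP scalerDr !scalerA mulrC.
Qed.
Next Obligation.
move=> r A; have [M AM] := bop_bounded A; exists (`|r| * M) => v.
by rewrite hnormZR -mulrA ler_wpM2l// AM.
Qed.

Lemma bopDA : associative bopD.
Proof. by move=> A B C; apply: bopP => v /=; rewrite addrA. Qed.
Lemma bopDC : commutative bopD.
Proof. by move=> A B; apply: bopP => v /=; rewrite addrC. Qed.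
Lemma bop0D : left_id bop0 bopD.
Proof. by move=> A; apply: bopP => v /=; rewrite add0r. Qed.
Lemma bopND : left_inverse bop0 bopN bopD.
Proof. by move=> A; apply: bopP => v /=; rewrite addNr. Qed.

HB.instance Definition _ :=
  GRing.isZmodule.Build (bop V W) bopDA bopDC bop0D bopND.

Lemma bopZA (a b : R) A : bopZ a (bopZ b A) = bopZ (a * b) A.
Proof. by apply: bopP => v /=; rewrite scalerA -rmorphM. Qed.
Lemma bop1Z : left_id 1 bopZ.
Proof. by move=> A; apply: bopP => v /=; rewrite scale1r. Qed.
Lemma bopZDr : right_distributive bopZ +%R.
Proof. by move=> a A B; apply: bopP => v /=; rewrite scalerDr. Qed.
Lemma bopZDl A (a b : R) : bopZ (a + b) A = bopZ a A + bopZ b A.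
Proof. by apply: bopP => v /=; rewrite rmorphD scalerDl. Qed.

HB.instance Definition _ := GRing.Zmodule_isLmodule.Build R (bop V W)
  bopZA bop1Z bopZDr bopZDl.

Definition opnorm A : R := sup [set hnorm (A v) | v in [set v | hnorm v <= 1]].

Lemma opnorm_has_sup A :
  has_sup [set hnorm (A v) | v in [set v | hnorm v <= 1]].
Proof.
split; first by exists (hnorm (A 0)), 0 => //=; rewrite hnorm0.
have [M AM] := bop_bounded A; exists `|M| => _ [v/= v1 <-].
rewrite (le_trans (AM v))// (le_trans (ler_norm _))// normrM.
by rewrite (ger0_norm (hnorm_ge0 v)) ler_piMr.
Qed.

Lemma opnorm_ge0 A : 0 <= opnorm A.
Proof.
rewrite -(@hnorm0 R W) -(linear0 A).
by apply: ub_le_sup; [exact: (opnorm_has_sup A).2|exists 0; rewrite /= ?hnorm0].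
Qed.

Lemma hnorm_bop A v : hnorm (A v) <= opnorm A * hnorm v.
Proof.
have [v0|v0] := eqVneq (hnorm v) 0.
  by rewrite (hnorm_eq0 v0) linear0 !hnorm0 mulr0.
have vp : 0 < hnorm v by rewrite lt_def v0 hnorm_ge0.
rewrite -ler_pdivrMr// mulrC -[X in X * _]ger0_norm ?invr_ge0 ?hnorm_ge0//.
rewrite -hnormZR -linearZ; apply: ub_le_sup; first exact: (opnorm_has_sup A).2.
exists ((hnorm v)^-1%:C *: v) => //=.
by rewrite hnormZR ger0_norm ?invr_ge0 ?hnorm_ge0// mulVf.
Qed.

Lemma opnorm_le A (M : R) : 0 <= M ->
  (forall v, hnorm (A v) <= M * hnorm v) -> opnorm A <= M.
Proof.
move=> M0 AM; apply: ge_sup; first exact: (opnorm_has_sup A).1.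
by move=> _ [v/= v1 <-]; rewrite (le_trans (AM v))// ler_piMr.
Qed.

Lemma ler_opnormD A B : opnorm (A + B) <= opnorm A + opnorm B.
Proof.
apply: opnorm_le => [|v]; first by rewrite addr_ge0 ?opnorm_ge0.
by rewrite (le_trans (ler_hnormD _ _))// mulrDl lerD ?hnorm_bop.
Qed.

Lemma opnormZ (a : R) A : opnorm (a *: A) = `|a| * opnorm A.
Proof.
have le b B : opnorm (b *: B) <= `|b| * opnorm B.
  apply: opnorm_le => [|v]; first by rewrite mulr_ge0 ?opnorm_ge0.
  by rewrite hnormZR -mulrA ler_wpM2l ?hnorm_bop.
apply/eqP; rewrite eq_le le/=.
have [->|a0] := eqVneq a 0; first by rewrite normr0 mul0r opnorm_ge0.
rewrite -ler_pdivlMl ?normr_gt0// -normfV.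
by rewrite -[leLHS](_ : opnorm (a^-1 *: (a *: A)) = _) ?le// scalerA mulVf// scale1r.
Qed.

Lemma opnorm0_eq0 A : opnorm A = 0 -> A = 0.
Proof.
move=> A0; apply: bopP => v; apply: hnorm_eq0; apply/eqP.
by rewrite eq_le hnorm_ge0 andbT (le_trans (hnorm_bop A v))// A0 mul0r.
Qed.

HB.instance Definition _ := Lmodule_isNormed.Build R (bop V W)
  ler_opnormD opnormZ opnorm0_eq0.

End Structure.

Program Definition bop1 V : bop V V := Bop (bfun := id) _ _.
Next Obligation. by []. Qed.
Next Obligation. by exists 1 => v; rewrite mul1r. Qed.

Program Definition bcomp V W Z (A : bop W Z) (B : bop V W) : bop V Z :=
  Bop (bfun := A \o B) _ _.
Next Obligation. by move=> V W Z A B a u v /=; rewrite !linearP. Qed.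
Next Obligation.
move=> V W Z A B; exists (opnorm A * opnorm B) => v.
by rewrite /= (le_trans (hnorm_bop A _))// -mulrA ler_wpM2l ?opnorm_ge0 ?hnorm_bop.
Qed.

Section Ring.
Context {V : innerSpaceType R}.

Lemma bcompA : associative (@bcomp V V V).
Proof. by move=> A B C; apply: bopP. Qed.
Lemma bcomp1l : left_id (bop1 V) (@bcomp V V V).
Proof. by move=> A; apply: bopP. Qed.
Lemma bcomp1r : right_id (bop1 V) (@bcomp V V V).
Proof. by move=> A; apply: bopP. Qed.
Lemma bcompDl : left_distributive (@bcomp V V V) +%R.
Proof. by move=> A B C; apply: bopP. Qed.
Lemma bcompDr : right_distributive (@bcomp V V V) +%R.
Proof. by move=> A B C; apply: bopP => v /=; rewrite raddfD. Qed.

HB.instance Definition _ := GRing.Zmodule_isPzRing.Build (bop V V)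
  bcompA bcomp1l bcomp1r bcompDl bcompDr.

End Ring.

Program Definition bfst V W : bop (V * W)%type V := Bop (bfun := fst) _ _.
Next Obligation. by []. Qed.
Next Obligation. by move=> V W; exists 1 => x; rewrite mul1r hnorm_fst. Qed.

Program Definition binl V W : bop V (V * W)%type := Bop (bfun := fun v => (v, 0)) _ _.
Next Obligation.
by move=> V W a u v; congr pair => /=; rewrite scaler0 addr0.
Qed.
Next Obligation.
move=> V W; exists 1 => v; rewrite mul1r le_eqVlt; apply/orP; left.
by rewrite /hnorm {1}/ip/= /prod_ip/= ip0l addr0.
Qed.

End BoundedOperators.

Section OperatorTheory.
Context {R : realType}.
Implicit Types V W : innerSpaceType R.

Definition is_adjoint V W (A : bop V W) (B : bop W V) :=
  forall v w, ip (A v) w = ip v (B w).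

(* The adjoint is unique, and exists on Hilbert spaces by the Riesz theorem;    *)
(* 0 is a default value.                                                       *)
Definition adj V W (A : bop V W) : bop W V := xget 0 [set B | is_adjoint A B].

Definition selfadjoint V (A : bop V V) := is_adjoint A A.

Definition unitary V (U : bop V V) := adj U * U = 1 /\ U * adj U = 1.

Definition invertible V (A : bop V V) := exists B, B * A = 1 /\ A * B = 1.

Definition expop V (A : bop V V) : bop V V :=
  limn (series (fun n => (n`!%:R : R)^-1 *: A ^+ n)).

Definition is_proj V (p : bop V V) := selfadjoint p /\ p * p = p.

(* Meaningful when S is a closed subspace of a Hilbert space.                  *)
Definition proj_onto V (S : set V) : bop V V :=
  xget 0 [set p | is_proj p /\ range p = S].

Definition graph V W (A : bop V W) : set (V * W) := [set (v, A v) | v in setT].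

End OperatorTheory.

(* Lebesgue measure on [0, 1], as a measure on R carried by [0, 1]. *)
Definition mu01 (R : realType) : {measure set (measurableTypeR R) -> \bar R} :=
  mrestr lebesgue_measure (measurable_itv `[(0 : R), 1]).

Definition sqint (R : realType) : {pred R -> R[i]} := fun f =>
  (@complex.Re R \o f \in Lfun (mu01 R) 2%:E) &&
  (@complex.Im R \o f \in Lfun (mu01 R) 2%:E).

Section SquareIntegrable.
Context {R : realType}.
Implicit Types f g : R -> R[i].
Let mu := mu01 R.

Lemma sqint_submod_closed : submod_closed (@sqint R).
Proof.
have cl := Lfun_submod_closed mu (lee1n 2).
have Z (a : R) (h : R -> R) : h \in Lfun mu 2%:E -> (a *: h) \in Lfun mu 2%:E.
  by move=> hL; rewrite -[_ *: _]addr0; apply: (cl.2 a h 0) => //; exact: cl.1.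
split; first by apply/andP; split; exact: cl.1.
move=> a f g /andP[f1 f2] /andP[g1 g2]; apply/andP; split.
  rewrite (_ : _ \o _ = complex.Re a *: (@complex.Re R \o f) +
     ((- complex.Im a) *: (@complex.Im R \o f) + (@complex.Re R \o g))).
    by apply: cl.2 => //; apply: cl.2.
  apply/funext => x /=; rewrite !fctE.
  by case: a (f x) (g x) => [a b] [p q] [r s]/=; rewrite /GRing.scale/=; ring.
rewrite (_ : _ \o _ = complex.Re a *: (@complex.Im R \o f) +
     (complex.Im a *: (@complex.Re R \o f) + (@complex.Im R \o g))).
  by apply: cl.2 => //; apply: cl.2.
apply/funext => x /=; rewrite !fctE.
by case: a (f x) (g x) => [a b] [p q] [r s]/=; rewrite /GRing.scale/=; ring.
Qed.

HB.instance Definition _ := GRing.isSubmodClosed.Build R[i] (R -> R[i])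
  (@sqint R) sqint_submod_closed.

End SquareIntegrable.

Record sqfun (R : realType) := SqFun {
  sqfun_val :> R -> R[i] ; sqfunP : sqfun_val \in @sqint R }.

HB.instance Definition _ (R : realType) := [isSub for @sqfun_val R].
HB.instance Definition _ (R : realType) := gen_eqMixin (sqfun R).
HB.instance Definition _ (R : realType) := gen_choiceMixin (sqfun R).
HB.instance Definition _ (R : realType) :=
  [SubChoice_isSubLmodule of sqfun R by <:].


#[global] Instance ae_mu01_filter (R : realType) :
  Filter (nbhs (almost_everywhere (mu01 R))).
Proof. exact: ae_filter_ringOfSetsType. Qed.

Section SqfunTheory.
Context {R : realType}.
Implicit Types f g : sqfun R.

Lemma sqfunD f g x : (f + g) x = f x + g x. Proof. by []. Qed.
Lemma sqfunN f x : (- f) x = - f x. Proof. by []. Qed.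
Lemma sqfunZ (a : R[i]) f x : (a *: f) x = a * f x. Proof. by []. Qed.
Lemma sqfun0 x : (0 : sqfun R) x = 0. Proof. by []. Qed.

End SqfunTheory.

Section L2.
Context {R : realType}.
Let mu := mu01 R.
Implicit Types f g h : sqfun R.

Definition ae_eqc (f g : R -> R[i]) := {ae mu, forall x, f x = g x}.

Definition ae_eqb : rel (sqfun R) := fun f g => `[< ae_eqc f g >].

Lemma ae_eqb_refl : reflexive ae_eqb.
Proof. by move=> f; apply/asboolP; apply: aeW. Qed.

Lemma ae_eqb_sym : symmetric ae_eqb.
Proof.
have sym f g : ae_eqb f g -> ae_eqb g f.
  move=> /asboolP fg; apply/asboolP.
  by near=> x; apply/esym; near: x; exact: fg.
by move=> f g; apply/idP/idP; exact: sym.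
Unshelve. all: by end_near. Qed.

Lemma ae_eqb_trans : transitive ae_eqb.
Proof.
move=> g f h /asboolP fg /asboolP gh; apply/asboolP; near=> x.
by transitivity (g x); near: x.
Unshelve. all: by end_near. Qed.

Canonical ae_eqb_equiv :=
  EquivRel ae_eqb ae_eqb_refl ae_eqb_sym ae_eqb_trans.

End L2.

(* L^2[0, 1]: complex-valued square integrable functions up to equality almost *)
(* everywhere on [0, 1].                                                       *)
Definition L2 (R : realType) : Type := {eq_quot @ae_eqb R}%qT.
HB.instance Definition _ (R : realType) := Choice.on (L2 R).
HB.instance Definition _ (R : realType) := EqQuotient.on (L2 R).

Section L2Space.
Context {R : realType}.
Local Open Scope quotient_scope.
Let mu := mu01 R.
Implicit Types (f g h : sqfun R) (u v w : L2 R) (a b : R[i]).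

Definition class_of f : L2 R := \pi f.

(* The values of f outside [0, 1] play no role. *)
Definition represents u (f : R -> R[i]) := ae_eqc (repr u) f.

Lemma class_ofP f g : class_of f = class_of g <-> ae_eqc f g.
Proof.
by split=> [/eqquotP/asboolP//|fg]; apply/eqquotP/asboolP.
Qed.

Lemma repr_class f : ae_eqc (repr (class_of f)) f.
Proof. by apply/class_ofP; rewrite /class_of reprK. Qed.

Lemma class_repr u : class_of (repr u) = u. Proof. exact: reprK. Qed.

Definition L2add u v := class_of (repr u + repr v).
Definition L2opp u := class_of (- repr u).
Definition L2scale a u := class_of (a *: repr u).

Lemma L2addE f g : L2add (class_of f) (class_of g) = class_of (f + g).
Proof.
apply/class_ofP; have ff := repr_class f; have gg := repr_class g.
near=> x; rewrite !sqfunD; congr (_ + _); near: x => //.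
Unshelve. all: by end_near. Qed.

Lemma L2oppE f : L2opp (class_of f) = class_of (- f).
Proof.
apply/class_ofP; have ff := repr_class f.
near=> x; rewrite !sqfunN; congr (- _); near: x => //.
Unshelve. all: by end_near. Qed.

Lemma L2scaleE a f : L2scale a (class_of f) = class_of (a *: f).
Proof.
apply/class_ofP; have ff := repr_class f.
near=> x; rewrite !sqfunZ; congr (_ * _); near: x => //.
Unshelve. all: by end_near. Qed.

Lemma L2addA : associative L2add.
Proof.
move=> u v w; rewrite -(class_repr u) -(class_repr v) -(class_repr w).
by rewrite !L2addE addrA.
Qed.
Lemma L2addC : commutative L2add.
Proof.
by move=> u v; rewrite -(class_repr u) -(class_repr v) !L2addE addrC.
Qed.
Lemma L2add0 : left_id (class_of 0) L2add.
Proof. by move=> u; rewrite -(class_repr u) !L2addE add0r. Qed.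
Lemma L2addN : left_inverse (class_of 0) L2opp L2add.
Proof. by move=> u; rewrite -(class_repr u) L2oppE L2addE addNr. Qed.

HB.instance Definition _ := GRing.isZmodule.Build (L2 R)
  L2addA L2addC L2add0 L2addN.

Lemma class_ofD f g : class_of (f + g) = class_of f + class_of g.
Proof. by rewrite -L2addE. Qed.

Lemma L2scaleA a b u : L2scale a (L2scale b u) = L2scale (a * b) u.
Proof. by rewrite -(class_repr u) !L2scaleE scalerA. Qed.
Lemma L2scale1 : left_id 1 L2scale.
Proof. by move=> u; rewrite -(class_repr u) L2scaleE scale1r. Qed.
Lemma L2scaleDr : right_distributive L2scale +%R.
Proof.
move=> a u v; rewrite -(class_repr u) -(class_repr v) -class_ofD.
by rewrite !L2scaleE scalerDr class_ofD.
Qed.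
Lemma L2scaleDl u a b : L2scale (a + b) u = L2scale a u + L2scale b u.
Proof. by rewrite -(class_repr u) !L2scaleE scalerDl class_ofD. Qed.

HB.instance Definition _ := GRing.Zmodule_isLmodule.Build R[i] (L2 R)
  L2scaleA L2scale1 L2scaleDr L2scaleDl.

Lemma class_ofZ a f : class_of (a *: f) = a *: class_of f.
Proof. by rewrite -L2scaleE. Qed.

Definition integralC (F : R -> R[i]) : R[i] :=
  (\int[mu]_x complex.Re (F x)) +i* (\int[mu]_x complex.Im (F x)).

Definition L2ip u v : R[i] :=
  integralC (fun x => repr u x * (repr v x)^*%C).

Definition integrableC (F : R -> R[i]) :=
  mu.-integrable setT (EFin \o (@complex.Re R \o F)) /\
  mu.-integrable setT (EFin \o (@complex.Im R \o F)).

Lemma integrableC_mul f g : integrableC (fun x => f x * (g x)^*%C).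
Proof.
have /andP[f1 f2] := sqfunP f; have /andP[g1 g2] := sqfunP g.
have m (p q : R -> R) : p \in Lfun mu 2%:E -> q \in Lfun mu 2%:E ->
    mu.-integrable setT (EFin \o (p \* q)).
  by move=> pL qL; apply/Lfun1_integrable; exact: Lfun2_mul_Lfun1.
split.
  rewrite (_ : _ \o _ = (EFin \o ((@complex.Re R \o f) \* (@complex.Re R \o g))%R)
    \+ (EFin \o ((@complex.Im R \o f) \* (@complex.Im R \o g))%R))%E.
    by apply: integrableD => //; exact: m.
  by apply/funext => x /=; case: (f x) (g x) => [p q] [r s]/=;
    rewrite mulrN opprK EFinD.
rewrite (_ : _ \o _ = (EFin \o ((@complex.Im R \o f) \* (@complex.Re R \o g))%R)
  \- (EFin \o ((@complex.Re R \o f) \* (@complex.Im R \o g))%R))%E.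
  by apply: integrableB => //; exact: m.
by apply/funext => x /=; case: (f x) (g x) => [p q] [r s]/=;
  rewrite mulrN addrC EFinB.
Qed.

Lemma integralC_linear a F G : integrableC F -> integrableC G ->
  integralC (fun x => a * F x + G x) = a * integralC F + integralC G.
Proof.
move=> [F1 F2] [G1 G2]; case: a => a b.
have Z (c : R) (p : R -> R) : mu.-integrable setT (EFin \o p) ->
    mu.-integrable setT (EFin \o (fun x => c * p x)).
  by move=> ip; rewrite (_ : _ \o _ = fun x => c%:E * (EFin \o p) x)%E//;
    exact: integrableZl.
have D (p q : R -> R) : mu.-integrable setT (EFin \o p) ->
    mu.-integrable setT (EFin \o q) ->
    mu.-integrable setT (EFin \o (fun x => p x + q x)).
  by move=> ip iq; rewrite (_ : _ \o _ = (EFin \o p) \+ (EFin \o q))%E//;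
    exact: integrableD.
rewrite /integralC; apply/eqP; rewrite eq_complex/=; apply/andP; split; apply/eqP.
  transitivity (\int[mu]_x ((a * (@complex.Re R \o F) x +
      (- b) * (@complex.Im R \o F) x) + (@complex.Re R \o G) x)).
    by apply: eq_Rintegral => x _ /=; case: (F x) (G x) => [p q] [r s]/=; ring.
  rewrite !RintegralD ?RintegralZl//; [|exact: Z..|exact: D (Z _ _ _) (Z _ _ _)].
  by rewrite /=; ring.
transitivity (\int[mu]_x ((a * (@complex.Im R \o F) x +
    b * (@complex.Re R \o F) x) + (@complex.Im R \o G) x)).
  by apply: eq_Rintegral => x _ /=; case: (F x) (G x) => [p q] [r s]/=; ring.
by rewrite !RintegralD ?RintegralZl//; [exact: Z..|exact: D (Z _ _ _) (Z _ _ _)].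
Qed.

Lemma integralC_ae F G : integrableC F -> integrableC G -> ae_eqc F G ->
  integralC F = integralC G.
Proof.
move=> [F1 F2] [G1 G2] FG; rewrite /integralC /Rintegral.
congr (fine _ +i* fine _); apply: ae_eq_integral => //;
  try exact: (measurable_int mu).
- by near=> x => _; congr ((complex.Re _)%:E); near: x.
- by near=> x => _; congr ((complex.Im _)%:E); near: x.
Unshelve. all: by end_near. Qed.

Lemma L2ipE f g :
  L2ip (class_of f) (class_of g) = integralC (fun x => f x * (g x)^*%C).
Proof.
apply: integralC_ae; [exact: integrableC_mul..|].
have ff := repr_class f; have gg := repr_class g.
by near=> x; congr (_ * _^*%C); near: x.
Unshelve. all: by end_near. Qed.

Lemma L2ip_linearl a u v w : L2ip (a *: u + v) w = a * L2ip u w + L2ip v w.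
Proof.
rewrite -(class_repr u) -(class_repr v) -(class_repr w) -class_ofZ -class_ofD.
rewrite !L2ipE -integralC_linear; [|exact: integrableC_mul..].
congr integralC; apply/funext => x.
by rewrite sqfunD sqfunZ mulrDl -mulrA.
Qed.

Lemma L2ipC u v : L2ip v u = (L2ip u v)^*%C.
Proof.
have [i1 i2] := integrableC_mul (repr u) (repr v).
rewrite /L2ip /integralC/=; congr (_ +i* _).
  apply: eq_Rintegral => x _.
  by case: (repr u x) (repr v x) => [p q] [r s]/=; ring.
rewrite -[RHS]mulN1r -RintegralZl//; apply: eq_Rintegral => x _.
by case: (repr u x) (repr v x) => [p q] [r s]/=; ring.
Qed.

Let sqE (z : R[i]) :
  z * z^*%C = (complex.Re z ^+ 2 + complex.Im z ^+ 2)%:C.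
Proof. by case: z => p q/=; apply/eqP; rewrite eq_complex/= !expr2; apply/andP;
  split; apply/eqP; ring. Qed.

Lemma L2ip_ge0 u : 0 <= L2ip u u.
Proof.
rewrite lecE /L2ip /integralC/=; apply/andP; split.
  apply/eqP; rewrite (@eq_Rintegral _ _ _ _ _ (cst 0)).
    by rewrite /Rintegral integral0.
  by move=> x _; rewrite sqE.
by apply: Rintegral_ge0 => x _; rewrite sqE/= addr_ge0 ?sqr_ge0.
Qed.

Lemma L2ip_eq0 u : L2ip u u = 0 -> u = 0.
Proof.
have [i1 i2] := integrableC_mul (repr u) (repr u).
move=> /(congr1 (@complex.Re R)); rewrite /L2ip/= /Rintegral => /eqP.
rewrite fine_eq0; last exact: (integrable_fin_num measurableT i1).
move=> /eqP i0.
have : (\int[mu]_x `|(complex.Re (repr u x * (repr u x)^*%C))%:E| = 0)%E.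
  rewrite -[RHS]i0; apply: eq_integral => x _.
  by rewrite gee0_abs// sqE lee_fin addr_ge0 ?sqr_ge0.
move/(ae_eq_integral_abs mu measurableT (measurable_int mu i1)) => h.
rewrite -(class_repr u); apply/class_ofP.
apply: filterS h => x /(_ I) /=; rewrite sqE/= => -[] /eqP.
rewrite paddr_eq0 ?sqr_ge0// !sqrf_eq0 => /andP[/eqP r0 /eqP c0].
by change (repr u x = 0); case: (repr u x) r0 c0 => p q /= -> ->.
Qed.

HB.instance Definition _ := isInnerSpace.Build R (L2 R)
  L2ip_linearl L2ipC L2ip_ge0 L2ip_eq0.

End L2Space.

Section Fourier.
Context {R : realType}.

(* exp (2 i pi n x) *)
Definition fourier_fun (n : int) (x : R) : R[i] :=
  cos (2 * pi * n%:~R * x) +i* sin (2 * pi * n%:~R * x).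

Lemma bounded_Lfun2 (f : R -> R) : measurable_fun setT f ->
  (forall x, `|f x| <= 1) -> f \in Lfun (mu01 R) 2%:E.
Proof.
move=> mf f1; rewrite inE; apply/andP; split; rewrite inE//=.
rewrite /finite_norm unlock; apply: poweR_lty.
have m1 : (mu01 R setT < +oo)%E.
  rewrite [ltLHS](_ : _ = lebesgue_measure `[(0 : R), 1]%classic); last first.
    by rewrite /mu01/= /mrestr setTI.
  by rewrite lebesgue_measure_itv/= lte_fin ltr01 -EFinB ltry.
apply: le_lt_trans m1; rewrite -[leRHS]mul1e -integral_cst//.
apply: ge0_le_integral => //.
- by move=> x _; exact: poweR_ge0.
- rewrite (_ : (fun x => _) = EFin \o (fun x : R => `|f x| ^+ 2)).
    by apply/measurable_EFinP/measurable_funX/measurableT_comp.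
  by apply/funext => x /=; rewrite powR_mulrn.
- by move=> x _; rewrite /= lee_fin powR_mulrn// exprn_ile1.
Qed.

Lemma fourier_sqint (n : int) : fourier_fun n \in @sqint R.
Proof.
have lin : measurable_fun setT (fun x : R => 2 * pi * n%:~R * x).
  by apply: measurable_funM => //; exact: measurable_cst.
apply/andP; split; apply: bounded_Lfun2.
- apply: (measurableT_comp _ lin); apply: continuous_measurable_fun.
  exact: continuous_cos.
- by move=> x /=; rewrite ler_norml cos_geN1 cos_le1.
- apply: (measurableT_comp _ lin); apply: continuous_measurable_fun.
  exact: continuous_sin.
- by move=> x /=; rewrite ler_norml sin_geN1 sin_le1.
Qed.

Definition fourier (n : int) : L2 R := class_of (SqFun (fourier_sqint n)).

End Fourier.

Section Curves.
Context {R : realType} {W : normedModType R}.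

(* g is C^1 on ]a, b[, and g and its derivative extend continuously to [a, b]. *)
Definition C1_on (a b : R) (g : R -> W) :=
  {within `[a, b], continuous g} /\
  exists2 D : R -> W, {within `[a, b], continuous D} &
    forall t, t \in `]a, b[ -> is_derive t 1 g (D t).

Definition piecewise_C1 (a b : R) (g : R -> W) :=
  exists2 s : seq R, itv_partition a b s &
    forall i, (i < size s)%N -> C1_on (nth b (a :: s) i) (nth b s i) g.

Definition curve_length (a b : R) (g : R -> W) : \bar R :=
  (\int[lebesgue_measure]_(t in `[a, b]) `|derive1 g t|%:E)%E.

End Curves.

(* The boundary of A in the subspace S. *)
Definition boundary_in (T : topologicalType) (S A : set T) : set T :=
  S `&` closure A `&` closure (S `\` A).

Section ProjectionManifold.
Context {R : realType} {V : innerSpaceType R}.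
Implicit Types (p q X : bop V V) (g : R -> bop V V).

Definition dist p q : \bar R :=
  ereal_inf [set curve_length 0 1 g | g in [set g |
    [/\ piecewise_C1 0 1 g, g 0 = p, g 1 = q &
        forall t, t \in `[0, 1] -> is_proj (g t)]]].

Definition tangent p X := selfadjoint X /\ X * p + p * X = X.

Definition geodesic p g := is_proj p /\
  exists2 X, tangent p X & forall t, t \in `[0, 1] ->
    g t = expop (t *: (X * p - p * X)) * p * expop (- t *: (X * p - p * X)).

Definition minimal_geodesic p q g :=
  [/\ geodesic p g, g 0 = p, g 1 = q & curve_length 0 1 g = dist p q].

End ProjectionManifold.

Section RiemannSphere.
Context {R : realType} (V : innerSpaceType R).

Definition std_proj : bop (V * V)%type (V * V)%type :=
  bcomp (binl V V) (bfst V V).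

Definition riemann_sphere : set (bop (V * V)%type (V * V)%type) :=
  [set U * std_proj * adj U | U in [set U | unitary U]].

(* The column x = U (1, 0)^T is the operator V -> V * V, v |-> U (v, 0), and   *)
(* its entry x_1 is v |-> (x v).1.                                             *)
Definition principal_domain : set (bop (V * V)%type (V * V)%type) :=
  [set bcomp x (adj x) | x in [set x : bop V (V * V)%type |
    exists U, [/\ unitary U, x = bcomp U (binl V V) &
                  invertible (bcomp (bfst V V) x)]]].

End RiemannSphere.

Arguments std_proj {R} V.
Arguments riemann_sphere {R} V.
Arguments principal_domain {R} V.

(* Possibly unbounded operators on V are represented by their graphs.          *)
Section UnboundedOperators.
Context {R : realType} {V : innerSpaceType R}.
Implicit Types (G : set (V * V)) (T : R -> bop V V).

Definition hclosure (W : innerSpaceType R) (S : set W) : set W :=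
  [set w | forall e : R, 0 < e -> exists2 s, S s & hnorm (w - s) < e].

Definition operator_graph G :=
  [/\ G 0, forall (a : R[i]) x y, G x -> G y -> G (a *: x + y) &
      forall v, G (0, v) -> v = 0].

Definition densely_defined G := hclosure [set x.1 | x in G] = setT.

Definition closed_operator G := operator_graph G /\ hclosure G `<=` G.

Definition unbounded G :=
  ~ exists M : R, forall x, G x -> hnorm x.2 <= M * hnorm x.1.

Definition adjoint_graph G : set (V * V) :=
  [set y | forall x, G x -> ip x.2 y.1 = ip x.1 y.2].

Definition selfadjoint_operator G :=
  [/\ operator_graph G, densely_defined G & adjoint_graph G = G].

Definition bounded_deformation G (alpha : R) T :=
  [/\ closed_operator G, unbounded G, 0 < alpha,
      {within `[0, alpha[, continuous T} &
      dist (proj_onto (graph (T t))) (proj_onto G) @[t --> alpha^'-] --> 0%E].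

Definition deformation_curve G (alpha : R) T (t : R) :=
  if t < alpha then proj_onto (graph (T t)) else proj_onto G.

Definition optimal_bounded_deformation G (alpha : R) T :=
  bounded_deformation G alpha T /\
  forall t0, 0 <= t0 < alpha ->
    let c := deformation_curve G alpha T in
    piecewise_C1 t0 alpha c /\ dist (c t0) (c alpha) = curve_length t0 alpha c.

Definition orthonormal_basis (e : int -> V) :=
  (forall m n, ip (e m) (e n) = (m == n)%:R) /\
  hclosure [set \sum_(n <- s) c n *: e n |
            s in [set: seq int] & c in [set: int -> R[i]]] = setT.

Definition diagonal_in (e : int -> V) (d : int -> R) (A : bop V V) :=
  orthonormal_basis e /\ forall n, A (e n) = (d n)%:C *: e n.

End UnboundedOperators.

Section Derivation.
Context {R : realType}.

Definition abs_continuous (a b : R) (f : R -> R) :=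
  forall e : R, 0 < e -> exists2 d : R, 0 < d &
    forall n (l r : 'I_n -> R), (forall i, a <= l i <= r i /\ r i <= b) ->
      trivIset setT (fun i => `]l i, r i[%classic) ->
      \sum_i (r i - l i) < d -> \sum_i `|f (r i) - f (l i)| < e.

Definition abs_continuousC (a b : R) (f : R -> R[i]) :=
  abs_continuous a b (fun x => complex.Re (f x)) /\
  abs_continuous a b (fun x => complex.Im (f x)).

Definition is_deriveC (x : R) (f : R -> R[i]) (l : R[i]) :=
  is_derive x 1 (fun x => complex.Re (f x)) (complex.Re l) /\
  is_derive x 1 (fun x => complex.Im (f x)) (complex.Im l).

(* The graph of -i d/dx; f' is in L^2 because -i f' represents an element of   *)
(* L2 R.                                                                       *)
Definition derivation_graph : set (L2 R * L2 R) :=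
  [set y | exists f f' : R -> R[i],
    [/\ abs_continuousC 0 1 f, f 0 = f 1,
        {ae mu01 R, forall x, is_deriveC x f (f' x)},
        represents y.1 f & represents y.2 (fun x => - 'i%C * f' x)]].

End Derivation.

(* Main.v *)
(* The Fourier basis diagonalises -i d/dx: its graph is the set of pairs (u, v)
   whose coefficients satisfy v_n = tan(theta_n) u_n, theta_n = atan(2 pi n).
   With Theta = diag(theta_n), the rotations with cosine cos(t Theta) and sine
   sin(t Theta) form the one-parameter group exp(t K), and carry the horizontal
   subspace to the graph of tan(t Theta) for t < 1, and to the graph of
   -i d/dx at t = 1.  The geodesic so obtained has constant speed pi/2.

   Minimality: for a unit vector v with p v = v, the angle between v and its
   image under the projection moves at most at the speed of the curve, so
   dist p q is at least the angle between v and the range of q; for v = e_n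
   this angle is theta_n, whose supremum is pi/2.

   Uniqueness: exp(2 A) is the product of the reflections in the two end
   subspaces for every geodesic with velocity operator A, hence is determined
   by the endpoints; |A| <= pi/2 and |theta_n| < pi/2 then force A and K to
   agree on the eigenvectors (e_n, +-i e_n) of K.

   An absolutely continuous function with derivative zero almost everywhere is
   constant, which gives integration by parts and thus the description of the
   graph.  Completeness of the Fourier basis is Chernoff's argument: if all
   coefficients of u vanish, its primitive F is differentiable at almost every
   x0, and the coefficients of (F - F x0) / (e_1 - e_1 x0) have constant modulus
   on each side of 0, so they vanish by Bessel's inequality and F is constant. *)

Require Import Defs.
From mathcomp Require Import all_boot all_order all_algebra.
From mathcomp Require Import all_classical all_reals all_analysis.
From mathcomp Require Import measurable_realfun.
From mathcomp Require Import complex ring lra.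

Set Implicit Arguments.
Unset Strict Implicit.
Unset Printing Implicit Defensive.

Import Order.TTheory GRing.Theory Num.Theory.
Import numFieldNormedType.Exports.

Local Open Scope classical_set_scope.
Local Open Scope ring_scope.

(** * Hilbert spaces and diagonal operators *)

(** The critical number is pi/2: it is the supremum of the angles theta_n and is not attained. For t
    < 1 the cosines of t theta_n stay above cos (t pi/2), so cos (t Theta) has a bounded inverse. At
    t = 1 it is still injective, but its inverse is unbounded, so the range of the projection is a
    graph whose first column entry cannot be invertible. Uniqueness is also critical: A and K have
    norm up to pi/2, and exp(2 A) fixes eigenvalues of 2 A only modulo 2 pi i, so +-i pi/2 would be
    confused. Non-attainment removes the ambiguity: on an eigenvector of K with eigenvalue i b, |b|
    < pi/2, the operator A - i b has norm below pi, and exp(2 (A - i b)) fixes the vector. A skew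
    operator that small can fix a vector in this way only by annihilating it. The geometry uses only
    an orthonormal basis and angles in ]-pi/2, pi/2[ with supremum pi/2; what is special to -i d/dx
    is the description of its graph by Fourier coefficients. Limits are taken on real parts of inner
    products, so that real calculus suffices. *)

Definition sqmod (R : realType) (z : R[i]) : R :=
  complex.Re z ^+ 2 + complex.Im z ^+ 2.

(** An [innerSpaceType] carries no topology and completeness is not part of the structure, so both
    notions are spelled out with [hnorm]. *)
Definition hcvg (R : realType) (V : innerSpaceType R) (u : nat -> V) (l : V) :=
  hnorm (u n - l) @[n --> \oo] --> (0 : R).

Definition hcomplete (R : realType) (V : innerSpaceType R) :=
  forall u : nat -> V,
    (forall e : R, 0 < e -> exists N, forall m n, (N <= m)%N -> (N <= n)%N ->
      hnorm (u m - u n) < e) ->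
    exists l, hcvg u l.

Section InnerSpaces.
Context {R : realType}.
Implicit Types V : innerSpaceType R.

Lemma le_eps (x y : R) : (forall e, 0 < e -> x <= y + e) -> x <= y.
Proof. by move=> h; apply/ler_addgt0Pr. Qed.

Lemma sqmod_ge0 (z : R[i]) : 0 <= sqmod z.
Proof. by rewrite addr_ge0 ?sqr_ge0. Qed.

Lemma mul_conjc (z : R[i]) : z * z^*%C = (sqmod z)%:C%C.
Proof. by case: z => a b; rewrite /sqmod; apply/eqP; rewrite eq_complex/=; apply/andP;
  split; apply/eqP; ring. Qed.

Lemma sqmod_eq0 (z : R[i]) : sqmod z = 0 -> z = 0.
Proof.
case: z => a b; rewrite /sqmod/= => /eqP; rewrite paddr_eq0 ?sqr_ge0//.
by rewrite !sqrf_eq0 => /andP[/eqP-> /eqP->].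
Qed.

Lemma sqmodZ (r : R) (z : R[i]) : sqmod (r%:C%C * z) = r ^+ 2 * sqmod z.
Proof. by case: z => a b; rewrite /sqmod/=; ring. Qed.

Lemma sqmodM (y z : R[i]) : sqmod (y * z) = sqmod y * sqmod z.
Proof. by case: y z => a b [c d]; rewrite /sqmod/=; ring. Qed.

Lemma ReD (x y : R[i]) : complex.Re (x + y) = complex.Re x + complex.Re y.
Proof. by case: x y => a b [c d]. Qed.

Lemma ReN (x : R[i]) : complex.Re (- x) = - complex.Re x.
Proof. by case: x. Qed.

Lemma ReB (x y : R[i]) : complex.Re (x - y) = complex.Re x - complex.Re y.
Proof. by rewrite ReD ReN. Qed.

Lemma Re_conj (x : R[i]) : complex.Re x^*%C = complex.Re x.
Proof. by case: x. Qed.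

Lemma ReZ (r : R) (x : R[i]) : complex.Re (r%:C%C * x) = r * complex.Re x.
Proof. by case: x => a b /=; rewrite mul0r subr0. Qed.

Section Basics.
Context {V : innerSpaceType R}.
Implicit Types u v w : V.

Lemma ipNl u w : ip (- u) w = - ip u w.
Proof. by rewrite -scaleN1r ipZl mulN1r. Qed.

Lemma ipBl u v w : ip (u - v) w = ip u w - ip v w.
Proof. by rewrite ipDl ipNl. Qed.

Lemma ipNr u w : ip u (- w) = - ip u w.
Proof. by rewrite ipC ipNl rmorphN/= -ipC. Qed.

Lemma ipBr u v w : ip w (u - v) = ip w u - ip w v.
Proof. by rewrite ipDr ipNr. Qed.

Lemma ip0r u : ip u 0 = 0.
Proof. by rewrite ipC ip0l conjc0. Qed.

Lemma ip_suml (I : Type) (s : seq I) (P : pred I) (F : I -> V) w :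
  ip (\sum_(i <- s | P i) F i) w = \sum_(i <- s | P i) ip (F i) w.
Proof.
elim/big_rec2 : _ => [|i x y _ <-]; first by rewrite ip0l.
by rewrite ipDl.
Qed.

Lemma ip_sumr (I : Type) (s : seq I) (P : pred I) (F : I -> V) w :
  ip w (\sum_(i <- s | P i) F i) = \sum_(i <- s | P i) ip w (F i).
Proof.
elim/big_rec2 : _ => [|i x y _ <-]; first by rewrite ip0r.
by rewrite ipDr.
Qed.

Lemma hnorm_sqr u : hnorm u ^+ 2 = complex.Re (ip u u).
Proof. by rewrite ipE. Qed.

Lemma hnormBC u v : hnorm (u - v) = hnorm (v - u).
Proof. by rewrite -Defs.hnormN opprB. Qed.

Lemma hnorm_gt0 u : u != 0 -> 0 < hnorm u.
Proof.
move=> u0; rewrite lt_def hnorm_ge0 andbT.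
by apply: contra u0 => /eqP/hnorm_eq0->.
Qed.

Lemma Re_ipC u v : complex.Re (ip u v) = complex.Re (ip v u).
Proof. by rewrite ipC Re_conj. Qed.

Lemma Re_ip_inj u v : (forall w, complex.Re (ip u w) = complex.Re (ip v w)) -> u = v.
Proof.
move=> h; apply/eqP; rewrite -subr_eq0; apply/eqP/hnorm_eq0/eqP.
by rewrite -sqrf_eq0 hnorm_sqr ipBl ReB h subrr.
Qed.

Lemma normr_Re_ip u v : `|complex.Re (ip u v)| <= hnorm u * hnorm v.
Proof.
rewrite ler_norml Re_ip_le andbT lerNl -ReN -ipNl.
by rewrite (le_trans (Re_ip_le _ _))// Defs.hnormN.
Qed.

(** The bound on real parts, tested against [z *: v] with [z = ip u v], gives |z|^2 <= |u| |z| |v|,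
    because the phase of [z] cancels. Squaring and dividing by |z|^2 finishes. *)
Lemma sqmod_ip_le u v : sqmod (ip u v) <= hnorm u ^+ 2 * hnorm v ^+ 2.
Proof.
have [->|z0] := eqVneq (ip u v) 0.
  by rewrite /sqmod/= expr0n addr0 mulr_ge0 ?sqr_ge0.
have s0 : 0 < sqmod (ip u v).
  by rewrite lt_def sqmod_ge0 andbT; apply: contra z0 => /eqP/sqmod_eq0->.
have := Re_ip_le u (ip u v *: v).
rewrite ipZr mulrC mul_conjc/= hnormZ normc_def/= -/(sqmod _) => h.
have : sqmod (ip u v) ^+ 2 <= (hnorm u * (Num.sqrt (sqmod (ip u v)) * hnorm v)) ^+ 2.
  by apply: lerXn2r h; rewrite nnegrE ?(ltW s0)// !mulr_ge0 ?hnorm_ge0 ?sqrtr_ge0.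
rewrite !exprMn (@sqr_sqrtr _ (sqmod _)); last exact: ltW.
by rewrite [_ ^+ 2 * (_ * _)]mulrCA expr2 ler_pM2l.
Qed.

Lemma hcvg_ip (u : nat -> V) l v :
  hcvg u l -> (complex.Re (ip (u n) v) @[n --> \oo] --> complex.Re (ip l v)).
Proof.
move=> ul; apply/cvgrPdistC_lt => e e0.
have e1 : 0 < e / (hnorm v + 1) by rewrite divr_gt0// ltr_pwDr// hnorm_ge0.
move/cvgr0_norm_lt : ul => /(_ _ e1); apply: filterS => n.
rewrite ger0_norm ?hnorm_ge0// -ReB -ipBl => h.
rewrite (le_lt_trans (normr_Re_ip _ _))//.
rewrite (@le_lt_trans _ _ (hnorm (u n - l) * (hnorm v + 1)))//.
  by rewrite ler_wpM2l ?hnorm_ge0// lerDl.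
by rewrite -ltr_pdivlMr// ltr_pwDr// hnorm_ge0.
Qed.

Lemma hcvg_unique (u : nat -> V) l1 l2 : hcvg u l1 -> hcvg u l2 -> l1 = l2.
Proof.
move=> h1 h2; apply: Re_ip_inj => w.
have <- : limn (fun n => complex.Re (ip (u n) w)) = complex.Re (ip l2 w).
  exact/cvg_lim/hcvg_ip.
by apply/esym/cvg_lim => //; exact: hcvg_ip.
Qed.

Lemma hcvg_hnorm (u : nat -> V) l : hcvg u l ->
  hnorm (u n) @[n --> \oo] --> hnorm l.
Proof.
move=> ul; apply/cvgrPdistC_lt => e e0.
move/cvgr0_norm_lt : ul => /(_ _ e0); apply: filterS => n.
rewrite ger0_norm ?hnorm_ge0//; apply: le_lt_trans.
rewrite ler_norml; apply/andP; split.
  rewrite lerNl opprB lerBlDr hnormBC -[X in hnorm X <= _](subrK (u n)).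
  exact: ler_hnormD.
by rewrite lerBlDr -[X in hnorm X <= _](subrK l) ler_hnormD.
Qed.

Lemma hcvgD (u v : nat -> V) a b : hcvg u a -> hcvg v b ->
  hcvg (fun n => u n + v n) (a + b).
Proof.
move=> ua vb.
have ab : (hnorm (u n - a) + hnorm (v n - b)) @[n --> \oo] --> (0 : R).
  by rewrite -[X in _ --> X]addr0; exact: cvgD.
apply: (squeeze_cvgr _ (cvg_cst 0) ab); near=> n.
rewrite hnorm_ge0/= (_ : _ - _ = (u n - a) + (v n - b)) ?ler_hnormD//.
by rewrite opprD addrACA.
Unshelve. all: by end_near. Qed.

Lemma hcvgZ (c : R[i]) (u : nat -> V) a : hcvg u a -> hcvg (fun n => c *: u n) (c *: a).
Proof.
move=> ua.
have h : (complex.Re `|c| * hnorm (u n - a)) @[n --> \oo] --> (0 : R).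
  by rewrite -[X in _ --> X](mulr0 (complex.Re `|c|)); apply: cvgZr; exact: ua.
apply: cvg_trans h; apply: near_eq_cvg; near=> n.
by rewrite -scalerBr hnormZ.
Unshelve. all: by end_near. Qed.

End Basics.

(** * Orthonormal systems: Bessel, Riesz-Fischer, totality *)

Section Orthonormal.
Context {V : innerSpaceType R} (e : int -> V).
Context (eP : forall m n, ip (e m) (e n) = (m == n)%:R).

Definition coef (v : V) n := ip v (e n).

Lemma hnorm_onb n : hnorm (e n) = 1.
Proof. by rewrite /hnorm eP eqxx sqrtr1. Qed.

Lemma coef_sum (s : seq int) (c : int -> R[i]) n : uniq s ->
  coef (\sum_(i <- s) c i *: e i) n = if n \in s then c n else 0.
Proof.
move=> us; rewrite /coef ip_suml.
under eq_bigr do rewrite ipZl eP.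
case: ifPn => ns.
  rewrite (bigD1_seq n)//= eqxx mulr1 big1 ?addr0// => i /negbTE->.
  by rewrite mulr0.
rewrite big_seq big1// => i si; case: eqVneq => [in_|]; last by rewrite mulr0.
by rewrite -in_ si in ns.
Qed.

Lemma sqr_hnorm_sum (s : seq int) (c : int -> R[i]) : uniq s ->
  hnorm (\sum_(i <- s) c i *: e i) ^+ 2 = \sum_(i <- s) sqmod (c i).
Proof.
move=> us; rewrite hnorm_sqr ip_sumr (_ : \sum_(i <- s) _ =
  (\sum_(i <- s) sqmod (c i))%:C%C)//.
rewrite rmorph_sum/=; apply: eq_big_seq => i si.
by rewrite ipZr -/(coef _ _) coef_sum// si -mul_conjc mulrC.
Qed.

(** Completing the square: the coefficients of [v] are the best choice of [c], and that choice
    yields Bessel's inequality. *)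
Lemma sqr_hnorm_sub_sum (s : seq int) (c : int -> R[i]) v : uniq s ->
  hnorm (v - \sum_(i <- s) c i *: e i) ^+ 2 =
  hnorm v ^+ 2 - \sum_(i <- s) sqmod (coef v i) +
  \sum_(i <- s) sqmod (coef v i - c i).
Proof.
move=> us; rewrite hnorm_sqr ipBl !ipBr !ReB -!hnorm_sqr sqr_hnorm_sum//.
rewrite (Re_ipC _ v) ip_sumr.
have E (F : int -> R[i]) : complex.Re (\sum_(i <- s) F i) = \sum_(i <- s) complex.Re (F i).
  by elim/big_rec2 : _ => // i x y _ <-; rewrite ReD.
rewrite E.
have -> : \sum_(i <- s) sqmod (coef v i - c i) =
    \sum_(i <- s) sqmod (coef v i) - (\sum_(i <- s) complex.Re (ip v (c i *: e i))) *+ 2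
    + \sum_(i <- s) sqmod (c i).
  rewrite -sumrMnl -sumrB -big_split/=; apply: eq_bigr => i _.
  rewrite ipZr /coef; case: (ip v (e i)) (c i) => [p q] [r t]; rewrite /sqmod/=.
  by ring.
by ring.
Qed.

Lemma bessel (s : seq int) v : uniq s -> \sum_(i <- s) sqmod (coef v i) <= hnorm v ^+ 2.
Proof.
move=> us; rewrite -subr_ge0.
have := sqr_hnorm_sub_sum (coef v) v us.
rewrite [X in _ - _ + X]big1 => [|i _]; last by rewrite subrr /sqmod/= expr0n addr0.
by rewrite addr0 => <-; exact: sqr_ge0.
Qed.

(* [pickle_inv] enumerates int, possibly with gaps. *)
Definition int_upto (N : nat) : seq int := pmap (@pickle_inv int) (iota 0 N).

Lemma int_upto_uniq N : uniq (int_upto N).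
Proof. exact: (pmap_uniq (@pickle_invK int) (iota_uniq _ _)). Qed.

Lemma int_upto_cat M N : int_upto (M + N) =
  int_upto M ++ pmap (@pickle_inv int) (iota M N).
Proof. by rewrite /int_upto iotaD pmap_cat. Qed.

Lemma mem_int_upto n : exists N, forall M, (N <= M)%N -> n \in int_upto M.
Proof.
exists (pickle n).+1 => M h; rewrite mem_pmap; apply/mapP.
by exists (pickle n); rewrite ?mem_iota// pickleK_inv.
Qed.

Definition fsum (c : int -> R[i]) N := \sum_(i <- int_upto N) c i *: e i.

Lemma Riesz_Fischer (c : int -> R[i]) (M : R) : hcomplete V ->
  (forall s, uniq s -> \sum_(i <- s) sqmod (c i) <= M) ->
  exists2 w, (forall n, coef w n = c n) & hcvg (fsum c) w.
Proof.
move=> cV cM; pose S N := \sum_(i <- int_upto N) sqmod (c i).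
have Smon : nondecreasing_seq S.
  apply/nondecreasing_seqP => N; rewrite /S -addn1 int_upto_cat big_cat/= lerDl.
  by apply: sumr_ge0 => i _; exact: sqmod_ge0.
have Scvg : cvgn S.
  apply: (@nondecreasing_is_cvgn _ _ Smon); exists M => _ [N _ <-].
  exact: cM (int_upto_uniq N).
have [|w wc] := cV (fsum c).
  move=> d d0.
  have d2 : 0 < d ^+ 2 by rewrite exprn_gt0.
  have /cauchy_cvgP/cauchy_ballP/(_ _ d2) := Scvg.
  rewrite near_map2 => -[[A B]/= [[N1 _ AN] [N2 _ BN]] AB].
  have key m n : (maxn N1 N2 <= m)%N -> (m <= n)%N -> hnorm (fsum c m - fsum c n) < d.
    move=> Nm /subnKC; move: (n - m)%N => k <-.
    rewrite -(@ltr_pXn2r _ 2)// ?nnegrE ?hnorm_ge0 ?ltW//.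
    rewrite hnormBC /fsum int_upto_cat big_cat/= addrAC subrr add0r.
    rewrite sqr_hnorm_sum; last first.
      by have := int_upto_uniq (m + k); rewrite int_upto_cat cat_uniq => /and3P[].
    have := AB (m + k, m)%N.
    rewrite /ball/= => h.
    apply: le_lt_trans (h _).
      rewrite /S int_upto_cat big_cat/= addrAC subrr add0r.
      exact: ler_norm.
    split; [apply: AN|apply: BN] => /=.
      by rewrite (leq_trans _ (leq_addr _ _))// (leq_trans _ Nm)// leq_maxl.
    by rewrite (leq_trans _ Nm)// leq_maxr.
  exists (maxn N1 N2) => m n Nm Nn.
  by case/orP: (leq_total m n) => mn; [exact: key|rewrite hnormBC; exact: key].
exists w => // n.
have [N Nn] := mem_int_upto n.
apply/eqP; rewrite -subr_eq0; apply/eqP/sqmod_eq0/eqP.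
rewrite eq_le sqmod_ge0 andbT; apply: le_eps => d d0; rewrite add0r.
have sd : 0 < Num.sqrt d by rewrite sqrtr_gt0.
have /cvgr0_norm_lt/(_ _ sd)[N' _ h] := wc.
have {}h := h (maxn N N') (leq_maxr _ _).
rewrite /= ger0_norm ?hnorm_ge0// in h.
have := Nn _ (leq_maxl N N') => nN.
have E := @coef_sum (int_upto (maxn N N')) c n (int_upto_uniq _).
rewrite nN in E.
rewrite -E /coef -ipBl (le_trans (sqmod_ip_le _ _))//.
rewrite hnorm_onb expr1n mulr1 hnormBC -(@sqr_sqrtr _ d) ?ltW//.
by rewrite ltr_pXn2r// ?nnegrE ?hnorm_ge0 ?sqrtr_ge0.
Qed.

Lemma fsum_coef_cvg : hcomplete V ->
  (forall v, (forall n, coef v n = 0) -> v = 0) -> forall v, hcvg (fsum (coef v)) v.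
Proof.
move=> cV tot v.
have [w wc wv] := @Riesz_Fischer (coef v) (hnorm v ^+ 2) cV (fun s us => bessel v us).
suff wE : w = v by rewrite -{2}wE.
apply/eqP; rewrite -subr_eq0; apply/eqP/tot => n.
by rewrite /coef ipBl -/(coef _ _) -/(coef _ _) wc subrr.
Qed.

Lemma total_orthonormal_basis : hcomplete V ->
  (forall v, (forall n, coef v n = 0) -> v = 0) -> orthonormal_basis e.
Proof.
move=> cV tot; split=> //; apply/seteqP; split=> // v _ d d0.
have /cvgr0_norm_lt/(_ _ d0)[N _ /(_ N)] := fsum_coef_cvg cV tot v.
rewrite /= leqnn ger0_norm ?hnorm_ge0// => /(_ isT) h.
exists (fsum (coef v) N); last by rewrite hnormBC.
by exists (int_upto N) => //; exists (coef v).
Qed.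

End Orthonormal.

Lemma bopDE V W (A B : bop V W) v : (A + B) v = A v + B v. Proof. by []. Qed.
Lemma bopNE V W (A : bop V W) v : (- A) v = - A v. Proof. by []. Qed.
Lemma bopBE V W (A B : bop V W) v : (A - B) v = A v - B v. Proof. by []. Qed.
Lemma bopZE V W (r : R) (A : bop V W) v : (r *: A) v = r%:C%C *: A v. Proof. by []. Qed.
Lemma bopME V (A B : bop V V) v : (A * B) v = A (B v). Proof. by []. Qed.
Lemma bop_scale V W (A : bop V W) a v : A (a *: v) = a *: A v.
Proof. exact: linearZ_LR. Qed.
Lemma bop_addv V W (A : bop V W) u v : A (u + v) = A u + A v.
Proof. exact: linearD. Qed.
Lemma bop_subv V W (A : bop V W) u v : A (u - v) = A u - A v.
Proof. exact: linearB. Qed.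
Lemma bop_0v V W (A : bop V W) : A 0 = 0.
Proof. exact: linear0. Qed.
Lemma bop_sum V W (A : bop V W) (I : Type) (s : seq I) (F : I -> V) :
  A (\sum_(i <- s) F i) = \sum_(i <- s) A (F i).
Proof. exact: linear_sum. Qed.

Lemma hcvg_bop (V W : innerSpaceType R) (A : bop V W) (u : nat -> V) l :
  hcvg u l -> hcvg (fun n => A (u n)) (A l).
Proof.
move=> ul.
have h : (opnorm A * hnorm (u n - l)) @[n --> \oo] --> (0 : R).
  by rewrite -[X in _ --> X](mulr0 (opnorm A)); apply: cvgZr; exact: ul.
apply: (squeeze_cvgr _ (cvg_cst 0) h); near=> n.
by rewrite hnorm_ge0/= -linearB hnorm_bop.
Unshelve. all: by end_near. Qed.

Lemma Re_ip_i V (u v : V) : complex.Re (ip (- 'i%C *: u) v) = complex.Im (ip u v).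
Proof. by rewrite ipZl; case: (ip u v) => a b /=; rewrite oppr0 mul0r mulN1r sub0r opprK. Qed.

(** Replacing [v] by [- 'i *: v] turns imaginary parts into real ones, so later limits need only be
    taken in [R]. *)
Lemma is_adjoint_Re V W (A : bop V W) (B : bop W V) :
  (forall v w, complex.Re (ip (A v) w) = complex.Re (ip v (B w))) -> is_adjoint A B.
Proof.
move=> h v w; apply/eqP; rewrite eq_complex h eqxx/= -!Re_ip_i.
by rewrite -h linearZ.
Qed.

End InnerSpaces.

Arguments coef {R V} e v n.
Arguments fsum {R V} e c N.

(** * Bounded operators diagonal in an orthonormal basis *)

Section Diagonal.
Context {R : realType} {V : innerSpaceType R} (e : int -> V).
Context (cV : hcomplete V).
Context (eB : orthonormal_basis e).
Let eP := eB.1.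
Implicit Types (v w : V) (d : int -> R).

Lemma bop_basis_eq (W : innerSpaceType R) (A B : bop V W) :
  (forall n, A (e n) = B (e n)) -> A = B.
Proof.
move=> AB; apply: bopP => v; apply/eqP; rewrite -subr_eq0; apply/eqP/hnorm_eq0/eqP.
rewrite eq_le hnorm_ge0 andbT; apply: le_eps => d d0; rewrite add0r.
have d1 : 0 < d / (opnorm (A - B) + 1) by rewrite divr_gt0// ltr_pwDr// opnorm_ge0.
have : [set: V] v by []; rewrite -eB.2 => /(_ _ d1)[_ [s _ [c _ <-]]] h.
set w := \sum_(n <- s) _ in h.
have ABw : (A - B) w = 0.
  by rewrite bop_sum big1// => i _; rewrite bop_scale bopBE AB subrr scaler0.
rewrite (_ : A v - B v = (A - B) (v - w)); last by rewrite bop_subv ABw subr0.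
rewrite (le_trans (hnorm_bop _ _))//.
rewrite (@le_trans _ _ ((opnorm (A - B) + 1) * hnorm (v - w)))//.
  by rewrite ler_wpM2r ?hnorm_ge0// lerDl.
by rewrite mulrC -ler_pdivlMr ?(ltW h)// ltr_pwDr// opnorm_ge0.
Qed.

(** [v] is orthogonal to every finite combination [w] of the basis, so |v| <= |v - w| by Pythagoras,
    and density makes the right-hand side small. *)
Lemma coef_total v : (forall n, coef e v n = 0) -> v = 0.
Proof.
move=> v0; apply: hnorm_eq0; apply/eqP.
rewrite eq_le hnorm_ge0 andbT; apply: le_eps => d d0; rewrite add0r.
have : [set: V] v by []; rewrite -eB.2 => /(_ _ d0)[_ [s _ [c _ <-]]].
set w := \sum_(n <- s) _ => h; apply: le_trans (ltW h).
rewrite -(@ler_pXn2r _ 2)// ?nnegrE ?hnorm_ge0// !hnorm_sqr.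
rewrite ipBl !ipBr !ReB (Re_ipC w v).
rewrite [ip v w]ip_sumr big1 ?subr0/= => [|i _]; last first.
  by rewrite ipZr -/(coef e v i) v0 mulr0.
by rewrite sub0r opprK lerDl -hnorm_sqr sqr_ge0.
Qed.

Lemma coef_inj v w : (forall n, coef e v n = coef e w n) -> v = w.
Proof.
move=> vw; apply/eqP; rewrite -subr_eq0; apply/eqP/coef_total => n.
by rewrite /coef ipBl -/(coef _ _ _) vw subrr.
Qed.

Lemma coefD v w n : coef e (v + w) n = coef e v n + coef e w n.
Proof. exact: ipDl. Qed.

Lemma coefZ a v n : coef e (a *: v) n = a * coef e v n.
Proof. exact: ipZl. Qed.

Lemma coef_basis m n : coef e (e m) n = (m == n)%:R.
Proof. exact: eP. Qed.

Lemma hcvg_coef v : hcvg (fsum e (coef e v)) v.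
Proof. by apply: fsum_coef_cvg => //; exact: coef_total. Qed.

Lemma sqr_hnorm_le v (M : R) :
  (forall s, uniq s -> \sum_(i <- s) sqmod (coef e v i) <= M) -> hnorm v ^+ 2 <= M.
Proof.
move=> vM; have h := hcvg_hnorm (hcvg_coef v).
have {}h : hnorm (fsum e (coef e v) n) ^+ 2 @[n --> \oo] --> hnorm v ^+ 2.
  by rewrite expr2; under eq_fun do rewrite expr2; exact: cvgM.
apply: (cvgr_to_le h); near=> n; rewrite /= sqr_hnorm_sum ?int_upto_uniq// vM ?int_upto_uniq.
Unshelve. all: by end_near. Qed.

(** The bound on [d] is kept out of the arguments; the default 0 is reached when no bounded operator
    has these eigenvalues, that is, when [d] is unbounded. *)
Definition diag d : bop V V := xget 0 [set A : bop V V | forall n, A (e n) = (d n)%:C%C *: e n].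

Definition bounded_by d (M : R) := forall n, `|d n| <= M.

(** Riesz-Fischer supplies an image for each vector separately; since coefficients determine a
    vector, the resulting choice is automatically linear. *)
Lemma diag_exists d M : bounded_by d M ->
  exists2 A : bop V V, (forall v n, coef e (A v) n = (d n)%:C%C * coef e v n) &
    forall v, hnorm (A v) <= M * hnorm v.
Proof.
move=> dM; have M0 : 0 <= M by rewrite (le_trans _ (dM 0)).
have bnd v s : uniq s ->
    \sum_(i <- s) sqmod ((d i)%:C%C * coef e v i) <= M ^+ 2 * hnorm v ^+ 2.
  move=> us; apply: (@le_trans _ _ (\sum_(i <- s) M ^+ 2 * sqmod (coef e v i))).
    apply: ler_sum => i _; rewrite sqmodZ ler_wpM2r ?sqmod_ge0//.
    by rewrite -(ger0_norm (sqr_ge0 _)) normrX ler_pXn2r// nnegrE.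
  by rewrite -mulr_sumr ler_wpM2l ?sqr_ge0// bessel.
have /choice[f fP] : forall v, exists w, forall n, coef e w n = (d n)%:C%C * coef e v n.
  move=> v.
  by have [w wP _] := @Riesz_Fischer _ _ e eP _ _ cV (bnd v); exists w.
have flin : linear f.
  move=> a u v; apply: coef_inj => n.
  by rewrite coefD coefZ !fP coefD coefZ mulrDr mulrCA.
have fM v : hnorm (f v) <= M * hnorm v.
  rewrite -(@ler_pXn2r _ 2)// ?nnegrE ?mulr_ge0 ?hnorm_ge0// exprMn.
  apply: sqr_hnorm_le => s us; under eq_bigr do rewrite fP.
  exact: bnd.
by exists (Bop flin (ex_intro _ M fM)).
Qed.

Lemma diag_coef d M : bounded_by d M ->
  forall v n, coef e (diag d v) n = (d n)%:C%C * coef e v n.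
Proof.
move=> dM; have [A AP _] := diag_exists dM.
suff -> : diag d = A by [].
have Ae n : A (e n) = (d n)%:C%C *: e n.
  by apply: coef_inj => m; rewrite AP coefZ !coef_basis; case: eqVneq => [->//|]; rewrite !mulr0.
rewrite /diag; apply: bop_basis_eq => n.
by have := @xgetPex _ (0 : bop V V) [set A : bop V V | forall n, A (e n) = (d n)%:C%C *: e n]
  (ex_intro _ A Ae) => ->.
Qed.

Lemma diag_basis d M : bounded_by d M -> forall n, diag d (e n) = (d n)%:C%C *: e n.
Proof.
move=> dM n; apply: coef_inj => m; rewrite (diag_coef dM) coefZ !coef_basis.
by case: eqVneq => [->//|]; rewrite !mulr0.
Qed.

Lemma hnorm_diag d M : bounded_by d M -> forall v, hnorm (diag d v) <= M * hnorm v.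
Proof.
move=> dM; have [A AP AM] := diag_exists dM.
suff -> : diag d = A by [].
by apply: bopP => v; apply: coef_inj => n; rewrite AP (diag_coef dM).
Qed.

Lemma norm_diag d M : bounded_by d M -> `|diag d| <= M.
Proof.
move=> dM; apply: opnorm_le (hnorm_diag dM).
exact: le_trans (dM 0).
Qed.

Lemma norm_diag_ge d M n : bounded_by d M -> `|d n| <= `|diag d|.
Proof.
move=> dM; have := hnorm_bop (diag d) (e n).
by rewrite (diag_basis dM) hnormZR hnorm_onb// !mulr1.
Qed.

Lemma diagM d d' M M' : bounded_by d M -> bounded_by d' M' ->
  diag d * diag d' = diag (fun n => d n * d' n).
Proof.
move=> dM dM'; apply: bop_basis_eq => n.
have dd' : bounded_by (fun n => d n * d' n) (M * M').
  by move=> k; rewrite normrM ler_pM.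
rewrite (diag_basis dd').
by rewrite bopME (diag_basis dM') bop_scale (diag_basis dM) scalerA mulrC rmorphM.
Qed.

Lemma diagD d d' M M' : bounded_by d M -> bounded_by d' M' ->
  diag d + diag d' = diag (fun n => d n + d' n).
Proof.
move=> dM dM'; apply: bop_basis_eq => n.
have dd' : bounded_by (fun n => d n + d' n) (M + M').
  by move=> k; rewrite (le_trans (ler_normD _ _))// lerD.
rewrite (diag_basis dd') bopDE.
by rewrite (diag_basis dM') (diag_basis dM) -scalerDl rmorphD.
Qed.

Lemma diagZ d M (r : R) : bounded_by d M -> r *: diag d = diag (fun n => r * d n).
Proof.
move=> dM; apply: bop_basis_eq => n.
have dd' : bounded_by (fun n => r * d n) (`|r| * M).
  by move=> k; rewrite normrM ler_wpM2l.
rewrite (diag_basis dd') bopZE.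
by rewrite (diag_basis dM) scalerA -rmorphM.
Qed.

Lemma diag1 : diag (fun=> 1) = 1.
Proof.
have b : bounded_by (fun=> 1) 1 by move=> n; rewrite normr1.
by apply: bop_basis_eq => n; rewrite (diag_basis b) scale1r.
Qed.

Lemma diag0 : diag (fun=> 0) = 0.
Proof.
have b : bounded_by (fun=> 0) 0 by move=> n; rewrite normr0.
by apply: bop_basis_eq => n; rewrite (diag_basis b) scale0r.
Qed.

(** Both sides are limits of their values on the partial sums of [w], where the identity is a finite
    computation with real eigenvalues. *)
Lemma selfadjoint_diag d M : bounded_by d M -> selfadjoint (diag d).
Proof.
move=> dM; apply: is_adjoint_Re => v w; rewrite ![complex.Re (ip _ w)]Re_ipC.
have h1 := @hcvg_ip _ _ _ _ (diag d v) (hcvg_coef w).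
have h2 := @hcvg_ip _ _ _ _ v (hcvg_bop (diag d) (hcvg_coef w)).
rewrite (Re_ipC v).
have <- : limn (fun n => complex.Re (ip (fsum e (coef e w) n) (diag d v))) =
    complex.Re (ip w (diag d v)) by exact/cvg_lim.
have <- : limn (fun n => complex.Re (ip (diag d (fsum e (coef e w) n)) v)) =
    complex.Re (ip (diag d w) v) by exact/cvg_lim.
congr (limn _); apply/funext => N.
rewrite /fsum bop_sum !ip_suml; congr complex.Re; apply: eq_bigr => i _.
rewrite bop_scale (diag_basis dM) !ipZl; congr (_ * _).
rewrite ipC -/(coef e _ i) (diag_coef dM) rmorphM/= oppr0.
by congr (_ * _); rewrite /coef -ipC.
Qed.

End Diagonal.
(** * The exponential of an operator *)

Section OperatorLimits.
Context {R : realType}.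
Implicit Types V W : innerSpaceType R.

Lemma is_deriveP (W : normedModType R) (g : R -> W) (t : R) (D : W) :
  is_derive t 1 g D <-> h^-1 *: (g (h + t) - g t) @[h --> 0^'] --> D.
Proof.
have E : (fun h : R => h^-1 *: (g (h *: 1 + t) - g t)) =
    (fun h => h^-1 *: (g (h + t) - g t)).
  by apply/funext => h; rewrite /GRing.scale/= mulr1.
split=> [[dg <-]|h].
  by move: dg; rewrite /derivable /derive E.
have dg : derivable g t 1 by apply/cvg_ex; exists D; rewrite E.
apply: (DeriveDef dg); rewrite /derive E.
exact/cvg_lim.
Qed.

Lemma hnorm_le_norm V W (A : bop V W) v : hnorm (A v) <= `|A| * hnorm v.
Proof. exact: hnorm_bop. Qed.

Lemma norm_bop_le V W (A : bop V W) (M : R) : 0 <= M ->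
  (forall v, hnorm (A v) <= M * hnorm v) -> `|A| <= M.
Proof. exact: opnorm_le. Qed.

Lemma bop_normM V (A B : bop V V) : `|A * B| <= `|A| * `|B|.
Proof.
apply: norm_bop_le => [|v]; first by rewrite mulr_ge0.
by rewrite bopME (le_trans (hnorm_le_norm _ _))// -mulrA ler_wpM2l ?hnorm_le_norm.
Qed.

Lemma bop_norm1 V : `|1 : bop V V| <= 1.
Proof. by apply: norm_bop_le => // v; rewrite mul1r. Qed.

Lemma bop_normX V (A : bop V V) n : `|A ^+ n| <= `|A| ^+ n.
Proof.
elim: n => [|n IH]; first by rewrite !expr0 bop_norm1.
by rewrite !exprS (le_trans (bop_normM _ _))// ler_wpM2l.
Qed.

Lemma bop_scalerAl V (a : R) (A B : bop V V) : (a *: A) * B = a *: (A * B).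
Proof. exact: bopP. Qed.

Lemma bop_scalerAr V (a : R) (A B : bop V V) : A * (a *: B) = a *: (A * B).
Proof. by apply: bopP => v; rewrite bopME !bopZE bop_scale. Qed.

Lemma bop_scaleX V (a : R) (A : bop V V) n : (a *: A) ^+ n = a ^+ n *: A ^+ n.
Proof.
elim: n => [|n IH]; first by rewrite !expr0 scale1r.
by rewrite !exprS IH bop_scalerAl bop_scalerAr scalerA.
Qed.

Lemma cvg_bopM V (T : Type) (F : set_system T) {FF : Filter F} (f g : T -> bop V V) (A B : bop V V) :
  f @ F --> A -> g @ F --> B -> (fun x => f x * g x) @ F --> A * B.
Proof.
move=> fA gB; apply/subr_cvg0.
have h : `|f x - A| * `|g x| + `|A| * `|g x - B| @[x --> F] --> (0 : R).
  rewrite -[X in _ --> X]addr0; apply: cvgD.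
    rewrite -[X in _ --> X](mul0r `|B|); apply: cvgM; last exact: cvg_norm.
    by apply/norm_cvg0P/subr_cvg0.
  rewrite -[X in _ --> X](mulr0 `|A|); apply: cvgM; first exact: cvg_cst.
  by apply/norm_cvg0P/subr_cvg0.
apply/norm_cvg0P; apply: (squeeze_cvgr _ (cvg_cst 0) h); near=> x.
rewrite normr_ge0/=.
rewrite (_ : f x * g x - A * B = (f x - A) * g x + A * (g x - B)).
  by rewrite (le_trans (ler_normD _ _))// lerD// bop_normM.
by rewrite mulrBl mulrBr addrA subrK.
Unshelve. all: by end_near. Qed.

Lemma cvg_Re_ip V W (T : Type) (F : set_system T) {FF : Filter F} (f : T -> bop V W) (A : bop V W) v w :
  f @ F --> A -> complex.Re (ip (f x v) w) @[x --> F] --> complex.Re (ip (A v) w).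
Proof.
move=> fA; apply/subr_cvg0/norm_cvg0P.
have h : `|f x - A| * (hnorm v * hnorm w) @[x --> F] --> (0 : R).
  rewrite -[X in _ --> X](mul0r (hnorm v * hnorm w)); apply: cvgM; last exact: cvg_cst.
  by apply/norm_cvg0P/subr_cvg0.
apply: (squeeze_cvgr _ (cvg_cst 0) h); near=> x.
rewrite normr_ge0/= -ReB -ipBl -bopBE (le_trans (normr_Re_ip _ _))// mulrA.
by rewrite ler_wpM2r ?hnorm_ge0// hnorm_le_norm.
Unshelve. all: by end_near. Qed.

Lemma is_derive_bopM V (F G : R -> bop V V) (t : R) (DF DG : bop V V) :
  is_derive t 1 F DF -> is_derive t 1 G DG ->
  is_derive t 1 (fun s => F s * G s) (DF * G t + F t * DG).
Proof.
move=> dF dG.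
have Gc : G (h + t) @[h --> 0^'] --> G t.
  have := @differentiable_continuous _ _ _ _ _ ((@derivable1_diffP _ _ G t).1 (@ex_derive _ _ _ _ _ _ _ dG)).
  have ht : h + t @[h --> 0^'] --> t.
    rewrite -[X in _ --> X]add0r.
    by apply: cvgD; [exact: nbhs_dnbhs|exact: cvg_cst].
  by move=> c; exact: (cvg_comp _ _ ht c).
move: dF dG => /is_deriveP dF /is_deriveP dG; apply/is_deriveP.
apply: cvg_trans (cvgD (cvg_bopM dF Gc) (cvg_bopM (cvg_cst (F t)) dG)); apply: near_eq_cvg; near=> h.
rewrite !fctE bop_scalerAl bop_scalerAr -scalerDr mulrBl mulrBr; congr (_ *: _).
by rewrite addrA subrK.
Unshelve. all: by end_near. Qed.

Lemma is_derive_Re_ip V W (F : R -> bop V W) (t : R) (DF : bop V W) v w :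
  is_derive t 1 F DF ->
  is_derive t 1 (fun s => complex.Re (ip (F s v) w)) (complex.Re (ip (DF v) w)).
Proof.
move=> /is_deriveP dF; apply/is_deriveP.
apply: cvg_trans (cvg_Re_ip dF); apply: near_eq_cvg; near=> h.
by rewrite bopZE ipZl ReZ bopBE ipBl ReB.
Unshelve. all: by end_near. Qed.

(** The real functions [Re (ip (F s v) w)] have zero derivative and together determine [F]. *)
Lemma is_derive0_bop V W (F : R -> bop V W) :
  (forall t : R, is_derive t 1 F 0) -> forall s t, F s = F t.
Proof.
move=> dF s t; apply: bopP => v; apply: Re_ip_inj => w.
apply: (@is_derive_0_is_cst _ (fun s => complex.Re (ip (F s v) w))) => x.
by have := is_derive_Re_ip v w (dF x); rewrite (_ : (0 : bop V W) v = 0)// ip0l.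
Qed.

(** Pointwise limits define the operator. Letting one index tend to infinity in the Cauchy estimate
    at a fixed vector gives a bound proportional to its norm, hence convergence in norm. *)
Lemma bop_complete V W (u : nat -> bop V W) : hcomplete W ->
  (forall e : R, 0 < e -> exists N, forall m n, (N <= m)%N -> (N <= n)%N ->
    `|u m - u n| <= e) -> cvgn u.
Proof.
move=> cW uC.
have /choice[f fP] : forall v, exists l, hcvg (fun n => u n v) l.
  move=> v; apply: cW => e e0.
  have d0 : 0 < e / (hnorm v + 1) by rewrite divr_gt0// ltr_pwDr// hnorm_ge0.
  have [N NP] := uC _ d0; exists N => m n Nm Nn.
  rewrite -bopBE (le_lt_trans (hnorm_le_norm _ _))//.
  rewrite (@le_lt_trans _ _ (e / (hnorm v + 1) * hnorm v))//.
    by rewrite ler_wpM2r ?hnorm_ge0// NP.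
  rewrite -mulrA gtr_pMr// mulrC ltr_pdivrMr ?mul1r ?ltrDl//.
  by rewrite ltr_pwDr// hnorm_ge0.
have flin : linear f.
  move=> a x y; apply: hcvg_unique (fP _) _.
  under [X in hcvg X]funext do rewrite bop_addv bop_scale.
  exact: hcvgD (hcvgZ _ (fP x)) (fP y).
have key (e : R) N : (forall m n, (N <= m)%N -> (N <= n)%N -> `|u m - u n| <= e) ->
    forall n v, (N <= n)%N -> hnorm (u n v - f v) <= e * hnorm v.
  move=> h n v Nn.
  have c : hcvg (fun m => u n v - u m v) (u n v - f v).
    apply: hcvgD; first by rewrite /hcvg; under eq_fun do rewrite subrr hnorm0; exact: cvg_cst.
    have := hcvgZ (-1) (fP v); rewrite scaleN1r.
    by under [X in hcvg X]funext do rewrite scaleN1r.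
  apply: (cvgr_to_le (hcvg_hnorm c)); near=> m.
  rewrite -bopBE (le_trans (hnorm_le_norm _ _))// ler_wpM2r ?hnorm_ge0// h//.
  by near: m; exact: nbhs_infty_ge.
have [N1 N1P] := uC 1 ltr01.
have fb : exists M : R, forall v, hnorm (f v) <= M * hnorm v.
  exists (1 + `|u N1|) => v; rewrite -[f v](subrK (u N1 v)) mulrDl.
  rewrite (le_trans (ler_hnormD _ _))// lerD ?hnorm_le_norm//.
  by rewrite hnormBC (key _ N1).
pose A := Bop flin fb.
apply/cvg_ex; exists A; apply/subr_cvg0/norm_cvg0P/cvgr0Pnorm_lt => e e0.
have [N NP] := uC _ (divr_gt0 e0 (ltr0n R 2)).
near=> n; rewrite normr_id (@le_lt_trans _ _ (e / 2))//; last first.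
  by rewrite ltr_pdivrMr// ltr_pMr// ltr1n.
apply: norm_bop_le => [|v]; first by rewrite divr_ge0 ?ltW.
by apply: key NP _ _ _; near: n; exact: nbhs_infty_ge.
Unshelve. all: by end_near. Qed.

Lemma is_adjoint_cvg V W (f : nat -> bop V W) (g : nat -> bop W V) (A : bop V W) (B : bop W V) :
  f @ \oo --> A -> g @ \oo --> B -> (forall n, is_adjoint (f n) (g n)) -> is_adjoint A B.
Proof.
move=> fA gB fg; apply: is_adjoint_Re => v w.
rewrite (Re_ipC v).
have <- : limn (fun n => complex.Re (ip (f n v) w)) = complex.Re (ip (A v) w).
  by apply: cvg_lim => //; exact: cvg_Re_ip.
have <- : limn (fun n => complex.Re (ip (g n w) v)) = complex.Re (ip (B w) v).
  by apply: cvg_lim => //; exact: cvg_Re_ip.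
by congr (limn _); apply/funext => n; rewrite fg Re_ipC.
Qed.

End OperatorLimits.

Section Exponential.
Context {R : realType} {V : innerSpaceType R}.
Context (cV : hcomplete V).
Implicit Types (A B C : bop V V) (s t : R).

Definition expsum A N : bop V V := \sum_(n < N) (n`!%:R : R)^-1 *: A ^+ n.

Lemma expsumE A : expsum A = series (fun n => (n`!%:R : R)^-1 *: A ^+ n).
Proof. by apply/funext => N; rewrite /expsum /series/= big_mkord. Qed.

Lemma expsumS A N : expsum A N.+1 = expsum A N + (N`!%:R : R)^-1 *: A ^+ N.
Proof. by rewrite /expsum big_ord_recr. Qed.

Lemma norm_expterm A n : `|(n`!%:R : R)^-1 *: A ^+ n| <= exp_coeff `|A| n.
Proof.
rewrite normrZ /exp_coeff/= mulrC ger0_norm ?invr_ge0 ?ler0n//.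
by rewrite ler_wpM2r ?invr_ge0 ?ler0n ?bop_normX.
Qed.

Lemma cvg_expsum A : expsum A @ \oo --> expop A.
Proof.
rewrite expsumE; suff : cvgn (series (fun n => (n`!%:R : R)^-1 *: A ^+ n)) by [].
apply: bop_complete => // e e0.
have /cauchy_cvgP/cauchy_ballP/(_ _ e0) := is_cvg_series_exp_coeff `|A|.
rewrite near_map2 => -[[P Q]/= [[N1 _ PN] [N2 _ QN]] PQ].
have key m n : (maxn N1 N2 <= m)%N -> (m <= n)%N ->
    `|series (fun n => (n`!%:R : R)^-1 *: A ^+ n) n - series (fun n => (n`!%:R : R)^-1 *: A ^+ n) m| <= e.
  move=> Nm mn.
  have h := PQ (n, m) (conj (PN n _) (QN m _)).
  rewrite /ball/= in h; rewrite sub_series_geq//.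
  apply: (le_trans (ler_norm_sum _ _ _)).
  apply: (@le_trans _ _ (\sum_(m <= k < n) exp_coeff `|A| k)).
    by apply: ler_sum => k _; exact: norm_expterm.
  rewrite -sub_series_geq// (le_trans (ler_norm _))// ltW// h//=.
    by rewrite (leq_trans _ mn)// (leq_trans _ Nm)// leq_maxl.
  by rewrite (leq_trans _ Nm)// leq_maxr.
exists (maxn N1 N2) => m n Nm Nn.
by case/orP: (leq_total m n) => mn; [rewrite distrC|]; exact: key.
Qed.

(** Second-order Taylor remainder of t^n, with a constant crude enough for induction: the remainder
    of order n+1 is t times that of order n plus n s^(n-1) (t - s)^2, and the factor 4 absorbs n.
    Divided by n!, these constants still have a finite sum. *)
Lemma expterm_bound (M s t : R) n : 1 <= M -> `|s| <= M -> `|t| <= M ->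
  `|t ^+ n - s ^+ n - (t - s) * (n%:R * s ^+ n.-1)| <= (4 * M) ^+ n * (t - s) ^+ 2.
Proof.
move=> M1 sM tM; have M0 : 0 <= M by rewrite (le_trans _ M1).
elim: n => [|n IH]; first by rewrite !expr0 mul0r mulr0 subrr subr0 normr0 mul1r sqr_ge0.
have -> : t ^+ n.+1 - s ^+ n.+1 - (t - s) * (n.+1%:R * s ^+ n.+1.-1) =
   t * (t ^+ n - s ^+ n - (t - s) * (n%:R * s ^+ n.-1)) + n%:R * s ^+ n.-1 * (t - s) ^+ 2.
  by case: n {IH} => [|n]; rewrite /= ?expr0 ?exprS -?natr1; ring.
apply: (le_trans (ler_normD _ _)); rewrite normrM [X in _ + X]normrM.
rewrite [X in _ + X * _]normrM (ger0_norm (sqr_ge0 (t - s))).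
apply: (@le_trans _ _ (M * ((4 * M) ^+ n * (t - s) ^+ 2) + n%:R * M ^+ n * (t - s) ^+ 2)).
  apply: lerD; first by rewrite ler_pM.
  rewrite ler_wpM2r ?sqr_ge0// normr_nat ler_wpM2l ?ler0n// normrX.
  apply: (@le_trans _ _ (M ^+ n.-1)); first by rewrite lerXn2r// nnegrE.
  by rewrite ler_weXn2l// leq_pred.
rewrite mulrA -mulrDl ler_wpM2r ?sqr_ge0// exprS -mulrA mulrCA.
rewrite [leRHS](_ : _ = M * (4 * M) ^+ n + 3 * (M * (4 * M) ^+ n)); last by ring.
rewrite lerD2l mulrA exprMn mulrCA mulrC mulrA.
have n4 : n%:R <= (3 * M * 4 ^+ n : R).
  apply: (@le_trans _ _ (4 ^+ n : R)); last by rewrite ler_peMl ?exprn_ge0//; lra.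
  by rewrite -natrX ler_nat ltnW// ltn_expl.
by rewrite mulrC [4 ^+ n * _]mulrC ler_wpM2r ?exprn_ge0.
Qed.

(** The derivative of a truncation with [N.+1] terms is [A] times the truncation with [N] terms,
    hence the shift. The bound is independent of [N], so it survives the limit and gives the
    derivative of the exponential. *)
Lemma expsum_bound A (M s t : R) N : 1 <= M -> `|s| <= M -> `|t| <= M ->
  `|expsum (t *: A) N.+1 - expsum (s *: A) N.+1 - (t - s) *: (A * expsum (s *: A) N)| <=
  expR (4 * M * `|A|) * (t - s) ^+ 2.
Proof.
move=> M1 sM tM; have M0 : 0 <= M by rewrite (le_trans _ M1).
have -> : expsum (t *: A) N.+1 - expsum (s *: A) N.+1 - (t - s) *: (A * expsum (s *: A) N) =
  \sum_(n < N.+1) ((n`!%:R : R)^-1 * (t ^+ n - s ^+ n - (t - s) * (n%:R * s ^+ n.-1))) *: A ^+ n.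
  have zD (U : zmodType) (x a y b p q : U) :
      x + a - (y + b) - (p + q) = (x - y - p) + (a - b - q).
    by rewrite !opprD (addrACA x a) (addrACA (x - y)).
  elim: N => [|N IH].
    rewrite big_ord1 !expsumS /expsum !big_ord0 !expr0 mulr0 scaler0 subrr subr0.
    by rewrite [X in X *: _](_ : _ = 0) ?scale0r// mul0r mulr0 subrr subr0 mulr0.
  rewrite big_ord_recr/= -IH (expsumS (t *: A) N.+1) (expsumS (s *: A) N.+1).
  rewrite {2}(expsumS (s *: A) N) mulrDr scalerDr zD; congr (_ + _).
  rewrite !bop_scaleX !bop_scalerAr -exprS !scalerA -!scalerBl; congr (_ *: _).
  rewrite factS natrM invfM.
  have : N.+1%:R != 0 :> R by rewrite pnatr_eq0.
  by move: (N.+1%:R : R) (N`!%:R^-1 : R) => a b a0 /=; field.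
apply: (le_trans (ler_norm_sum _ _ _)).
apply: (@le_trans _ _ (\sum_(n < N.+1) exp_coeff (4 * M * `|A|) n * (t - s) ^+ 2)).
  apply: ler_sum => n _; rewrite normrZ normrM ger0_norm ?invr_ge0 ?ler0n//.
  have h := expterm_bound n M1 sM tM.
  apply: (@le_trans _ _ ((n`!%:R)^-1 * ((4 * M) ^+ n * (t - s) ^+ 2) * `|A| ^+ n)).
    by rewrite ler_pM ?mulr_ge0 ?invr_ge0 ?ler0n ?bop_normX// ler_wpM2l ?invr_ge0 ?ler0n.
  rewrite /exp_coeff/= [(4 * M * _) ^+ n]exprMn le_eqVlt; apply/orP; left; apply/eqP.
  by move: ((4 * M) ^+ n) (n`!%:R^-1 : R) => a b; ring.
rewrite -mulr_suml ler_wpM2r ?sqr_ge0//.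
have x0 : 0 <= 4 * M * `|A| by rewrite !mulr_ge0.
have -> : \sum_(i < N.+1) exp_coeff (4 * M * `|A|) i = series (exp_coeff (4 * M * `|A|)) N.+1.
  by rewrite /series/= big_mkord.
apply: nondecreasing_cvgn_le; last exact: is_cvg_series_exp_coeff.
by apply: nondecreasing_series => n _ _; exact: exp_coeff_ge0.
Qed.

Lemma expop_bound A (M s t : R) : 1 <= M -> `|s| <= M -> `|t| <= M ->
  `|expop (t *: A) - expop (s *: A) - (t - s) *: (A * expop (s *: A))| <=
  expR (4 * M * `|A|) * (t - s) ^+ 2.
Proof.
move=> M1 sM tM.
have ht : expsum (t *: A) n.+1 @[n --> \oo] --> expop (t *: A).
  by rewrite (cvg_shiftS (expsum _)); exact: cvg_expsum.
have hs : expsum (s *: A) n.+1 @[n --> \oo] --> expop (s *: A).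
  by rewrite (cvg_shiftS (expsum _)); exact: cvg_expsum.
have h : `|expsum (t *: A) n.+1 - expsum (s *: A) n.+1 - (t - s) *: (A * expsum (s *: A) n)|
   @[n --> \oo] --> `|expop (t *: A) - expop (s *: A) - (t - s) *: (A * expop (s *: A))|.
  apply: cvg_norm; apply: cvgB; first exact: cvgB.
  by apply: cvgZr; apply: cvg_bopM (cvg_cst _) (@cvg_expsum _).
apply: (cvgr_to_le h); near=> n.
exact: expsum_bound.
Unshelve. all: by end_near. Qed.

Lemma is_derive_expop A t : is_derive t 1 (fun s => expop (s *: A)) (A * expop (t *: A)).
Proof.
apply/is_deriveP/subr_cvg0/norm_cvg0P.
pose M := `|t| + 1; pose K := expR (4 * M * `|A|).
have h : `|h| * K @[h --> (0:R)^'] --> (0 : R).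
  rewrite -[X in _ --> X](mul0r K); apply: cvgM; last exact: cvg_cst.
  by apply/norm_cvg0P; exact: nbhs_dnbhs.
apply: (squeeze_cvgr _ (cvg_cst 0) h); near=> x.
have x0 : x != 0 by near: x; exact: nbhs_dnbhs_neq.
rewrite normr_ge0/=.
have -> : x^-1 *: (expop ((x + t) *: A) - expop (t *: A)) - A * expop (t *: A) =
  x^-1 *: (expop ((x + t) *: A) - expop (t *: A) - (x + t - t) *: (A * expop (t *: A))).
  by rewrite (_ : x + t - t = x) ?addrK// [RHS]scalerBr scalerA mulVf// scale1r.
rewrite normrZ normfV ler_pdivrMl ?normr_gt0// mulrA -expr2 mulrC.
rewrite real_normK ?num_real//.
have -> : x ^+ 2 = (x + t - t) ^+ 2 by rewrite addrK.
apply: expop_bound; rewrite /M ?lerDr// ?lerDl//.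
rewrite addrC (le_trans (ler_normD _ _))// lerD2l.
by near: x; exact: dnbhs0_le.
Unshelve. all: by end_near. Qed.

Lemma expop0 : expop (0 : bop V V) = 1.
Proof.
have h := @cvg_expsum 0; apply: (@cvg_unique _ (@norm_hausdorff _ _) _ _ _ _ h).
apply: cvg_near_cst; exists 1%N => // -[//|N] _ /=; rewrite /expsum big_ord_recl big1 ?addr0 => [|i _].
  by rewrite expr0 fact0 invr1 scale1r.
by rewrite /= expr0n/= scaler0.
Qed.

Lemma expop_intertwine A B C : A * C = C * B -> expop A * C = C * expop B.
Proof.
move=> AC.
have h1 : (expsum A N * C) @[N --> \oo] --> expop A * C.
  exact: cvg_bopM (@cvg_expsum A) (cvg_cst C).
have h2 : (C * expsum B N) @[N --> \oo] --> C * expop B.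
  exact: cvg_bopM (cvg_cst C) (@cvg_expsum B).
apply: (@cvg_unique _ (@norm_hausdorff _ _) _ _ _ _ h1).
apply: cvg_trans h2; apply: near_eq_cvg; near=> N.
rewrite /expsum mulr_suml mulr_sumr; apply: eq_bigr => i _.
rewrite bop_scalerAl bop_scalerAr; congr (_ *: _).
elim: (i : nat) => [|k IH]; first by rewrite !expr0 mulr1 mul1r.
by rewrite (exprS B) (mulrA C B) -AC -(mulrA A C) IH (mulrA A) -(exprS A).
Unshelve. all: by end_near. Qed.

Lemma expop_comm A B : A * B = B * A -> expop A * B = B * expop A.
Proof. exact: expop_intertwine. Qed.

Lemma is_derive_expopN A t :
  is_derive t 1 (fun s => expop (- s *: A)) (- A * expop (- t *: A)).
Proof.
have := is_derive_expop (- A) t; rewrite scalerN -scaleNr.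
by under [X in is_derive _ _ X _]funext do rewrite scalerN -scaleNr.
Qed.

(** exp(-tA) G(t) has zero derivative. This uniqueness for G' = A G yields the group laws below, and
    later Euler's formula for rotations. *)
Lemma expop_ode A (G : R -> bop V V) :
  (forall t, is_derive t 1 G (A * G t)) -> forall t, expop (- t *: A) * G t = G 0.
Proof.
move=> dG t.
rewrite (@is_derive0_bop _ _ _ (fun t => expop (- t *: A) * G t) _ t 0); last first.
  move=> u; have := is_derive_bopM (is_derive_expopN A u) (dG u).
  have -> : - A * expop (- u *: A) * G u + expop (- u *: A) * (A * G u) = 0 => //.
  rewrite [expop _ * (A * _)]mulrA (@expop_comm (- u *: A) A).
    by rewrite !mulNr addNr.
  by rewrite bop_scalerAl bop_scalerAr.
by rewrite oppr0 scale0r expop0 mul1r.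
Qed.

Lemma expopNK A t : expop (- t *: A) * expop (t *: A) = 1.
Proof. by rewrite (expop_ode (is_derive_expop A)) scale0r expop0. Qed.

Lemma expopKN A t : expop (t *: A) * expop (- t *: A) = 1.
Proof. by have := expopNK A (- t); rewrite opprK. Qed.

Lemma expop_unique A (G : R -> bop V V) :
  (forall t, is_derive t 1 G (A * G t)) -> forall t, G t = expop (t *: A) * G 0.
Proof. by move=> dG t; rewrite -(expop_ode dG t) mulrA expopKN mul1r. Qed.

Lemma expopD A s t : expop ((s + t) *: A) = expop (s *: A) * expop (t *: A).
Proof.
have d (u : R) : is_derive u 1 (fun s => expop ((s + t) *: A)) (A * expop ((u + t) *: A)).
  have := is_derive_expop A (u + t).
  by move/is_deriveP => h; apply/is_deriveP; under eq_fun do rewrite -addrA.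
by rewrite (expop_unique d) add0r.
Qed.

Lemma expop_add A B t : A * B = B * A ->
  expop (t *: (A + B)) = expop (t *: A) * expop (t *: B).
Proof.
move=> AB.
have d (u : R) : is_derive u 1 (fun t => expop (t *: A) * expop (t *: B))
    ((A + B) * (expop (u *: A) * expop (u *: B))).
  have := is_derive_bopM (is_derive_expop A u) (is_derive_expop B u).
  rewrite mulrA (@expop_comm _ B); first by rewrite -!mulrA -mulrDl.
  by rewrite bop_scalerAl bop_scalerAr AB.
by rewrite [RHS](expop_unique d) !scale0r expop0 !mulr1.
Qed.

(** Commutation lets [A] slide past the powers of [B], so A^n v = B^n v for every n. It serves to
    trade an operator for a simpler one at a single vector. *)
Lemma expop_apply A B v t : A * B = B * A -> A v = B v ->
  expop (t *: A) v = expop (t *: B) v.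
Proof.
move=> AB Av; apply: Re_ip_inj => w.
have <- : limn (fun n => complex.Re (ip (expsum (t *: A) n v) w)) =
    complex.Re (ip (expop (t *: A) v) w).
  by apply: cvg_lim => //; apply: cvg_Re_ip; exact: cvg_expsum.
have <- : limn (fun n => complex.Re (ip (expsum (t *: B) n v) w)) =
    complex.Re (ip (expop (t *: B) v) w).
  by apply: cvg_lim => //; apply: cvg_Re_ip; exact: cvg_expsum.
congr (limn _); apply/funext => N; congr (complex.Re (ip _ _)).
have E n : (A ^+ n) v = (B ^+ n) v.
  elim: n => [//|n IH]; rewrite exprS bopME IH.
  have -> : A ((B ^+ n) v) = (B ^+ n) (A v).
    rewrite -!bopME; congr (bfun _ v).
    by elim: n {IH} => [|k IH]; rewrite ?expr0 ?mulr1 ?mul1r// exprS mulrA AB -mulrA IH mulrA.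
  by rewrite Av -bopME -exprSr.
elim: N => [|N IH]; first by rewrite /expsum !big_ord0.
by rewrite !expsumS !bopDE !bopZE !bop_scaleX !bopZE E IH.
Qed.

Lemma is_adjoint_expop A B : is_adjoint A B -> is_adjoint (expop A) (expop B).
Proof.
move=> AB; apply: (is_adjoint_cvg (@cvg_expsum A) (@cvg_expsum B)) => N v w.
have E n : is_adjoint (A ^+ n) (B ^+ n).
  elim: n => [//|n IH] x y.
  by rewrite exprS exprSr !bopME AB IH.
elim: N => [|N IH]; first by rewrite /expsum !big_ord0 ip0l ip0r.
rewrite !expsumS !bopDE !bopZE ipDl ipDr IH; congr (_ + _).
by rewrite ipZl ipZr conjc_real E.
Qed.

Definition skew A := is_adjoint A (- A).

Lemma expop_skew_adj A t : skew A -> is_adjoint (expop (t *: A)) (expop (- t *: A)).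
Proof.
move=> As; apply: is_adjoint_expop => v w.
by rewrite scaleNr -scalerN !bopZE ipZl ipZr conjc_real As.
Qed.

Lemma hnorm_expop A t v : skew A -> hnorm (expop (t *: A) v) = hnorm v.
Proof.
move=> As; apply/eqP; rewrite -(@eqrXn2 _ 2)// ?hnorm_ge0// !hnorm_sqr.
by rewrite (expop_skew_adj t As) -bopME expopNK.
Qed.

End Exponential.
(** * Curves of projections *)

Section Orbits.
Context {R : realType} {V : innerSpaceType R}.
Context (cV : hcomplete V).
Implicit Types (A X p : bop V V) (s t : R).

(** Conjugation flow of [A]; for [X] a projection it is the curve in the definition of a geodesic,
    and its derivative is the flow of the bracket of [A] and [X]. *)
Definition orbit A X t := expop (t *: A) * X * expop (- t *: A).

Lemma is_derive_orbit A X t :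
  is_derive t 1 (orbit A X) (orbit A (A * X - X * A) t).
Proof.
have d1 := is_derive_bopM (is_derive_expop cV A t) (is_derive_cst X t 1).
have d2 := is_derive_bopM d1 (is_derive_expopN cV A t).
rewrite /orbit; have -> // : expop (t *: A) * (A * X - X * A) * expop (- t *: A) =
  (A * expop (t *: A) * cst X t + expop (t *: A) * 0) * expop (- t *: A) +
  expop (t *: A) * cst X t * (- A * expop (- t *: A)).
have -> : A * expop (t *: A) = expop (t *: A) * A.
  by rewrite (@expop_comm _ _ cV (t *: A) A)// bop_scalerAl bop_scalerAr.
by rewrite mulr0 addr0 mulrBr mulrBl mulNr mulrN !mulrA.
Qed.

Lemma orbit0 A X : orbit A X 0 = X.
Proof. by rewrite /orbit oppr0 !scale0r expop0// mul1r mulr1. Qed.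

Lemma orbit_orbit A X s t : orbit A (orbit A X s) t = orbit A X (t + s).
Proof.
rewrite /orbit (expopD cV) opprD addrC (expopD cV) !mulrA.
by congr (_ * _ * _ * _ * _).
Qed.

(** One inequality comes from unitarity; the converse is the same inequality run backwards from
    [orbit A X t]. *)
Lemma norm_orbit A X t : skew A -> `|orbit A X t| = `|X|.
Proof.
move=> As; have le Y u : `|orbit A Y u| <= `|Y|.
  apply: norm_bop_le => // v; rewrite /orbit !bopME hnorm_expop//.
  by rewrite (le_trans (hnorm_le_norm _ _))// hnorm_expop.
apply/eqP; rewrite eq_le le/=.
by have := le (orbit A X t) (- t); rewrite orbit_orbit addNr orbit0.
Qed.

Lemma is_proj_orbit A p t : skew A -> is_proj p -> is_proj (orbit A p t).
Proof.
move=> As [ps pp]; split.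
  move=> v w; rewrite /orbit !bopME (expop_skew_adj cV t As) ps.
  by have := expop_skew_adj cV (- t) As; rewrite opprK => ->.
rewrite /orbit !mulrA -[X in X * _ * _]mulrA (expopNK cV) mulr1.
by rewrite -[X in X * _]mulrA pp.
Qed.

Lemma continuous_orbit A X : continuous (orbit A X).
Proof.
move=> t; apply: differentiable_continuous; apply/derivable1_diffP.
exact: (@ex_derive _ _ _ _ _ _ _ (is_derive_orbit A X t)).
Qed.

Lemma C1_on_orbit A X a b : C1_on a b (orbit A X).
Proof.
split; first by apply: continuous_subspaceT => t; exact: continuous_orbit.
exists (orbit A (A * X - X * A)); last by move=> t _; exact: is_derive_orbit.
by apply: continuous_subspaceT => t; exact: continuous_orbit.
Qed.

End Orbits.

Lemma continuous_withinP (T : topologicalType) (R : realType) (A : set R) (f : R -> T) :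
  {within A, continuous f} <->
  forall t, A t -> f s @[s --> within A (nbhs t)] --> f t.
Proof. exact: subspace_continuousP. Qed.

Section CurveLength.
Context {R : realType} {W : normedModType R}.
Implicit Types (f g : R -> W).

Lemma curve_length_cst (a b M : R) g : a <= b ->
  (forall t, t \in `]a, b[ -> `|derive1 g t| = M) ->
  curve_length a b g = ((b - a) * M)%:E.
Proof.
move=> ab gM; rewrite /curve_length.
have mg : measurable_fun `]a, b[ (fun t => `|derive1 g t|%:E).
  apply: (eq_measurable_fun (cst M%:E)); last exact: measurable_cst.
  by move=> t; rewrite inE => /gM ->.
rewrite integral_itv_bndoo//.
rewrite (eq_integral (cst M%:E)); last by move=> t; rewrite inE => /gM ->.
rewrite integral_cst//= lebesgue_measure_itv/= lte_fin.
case: ltgtP ab => // [ab|->] _; first by rewrite -EFinB -EFinM mulrC.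
by rewrite mule0 subrr mul0r.
Qed.

Lemma derive_val1 g (t : R) D : is_derive t 1 g D -> derive1 g t = D.
Proof. by move=> dg; rewrite derive1E derive_val. Qed.

Lemma is_derive_eq_itv (a b : R) f g D (t : R) : (forall s, s \in `[a, b] -> f s = g s) ->
  t \in `]a, b[ -> is_derive t 1 g D -> is_derive t 1 f D.
Proof.
move=> fg tab; apply: near_eq_is_derive.
have := near_in_itvoo tab; apply: filterS => s sab.
by rewrite fg//; exact: subset_itv_oo_cc.
Qed.

Lemma C1_on_eq (a b : R) f g : (forall s, s \in `[a, b] -> f s = g s) ->
  C1_on a b g -> C1_on a b f.
Proof.
move=> fg [cg [D cD dg]]; split.
  apply/continuous_withinP => t tab; have /continuous_withinP/(_ t tab) := cg.
  rewrite fg//; apply: cvg_trans; apply: near_eq_cvg.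
  by rewrite near_withinE; near=> s => /fg.
by exists D => // t tab; apply: (is_derive_eq_itv fg tab); exact: dg.
Unshelve. all: by end_near. Qed.

Lemma piecewise_C1_on (a b : R) g : a < b -> C1_on a b g -> piecewise_C1 a b g.
Proof.
move=> ab gC; exists [:: b]; last by case.
by split; rewrite /= ?ab ?eqxx.
Qed.

End CurveLength.

(** * Angles along curves and the lower bound for the distance *)

Section ArccosIncrement.
Context {R : realType}.

(** The derivative of acos (k c) is -k c' / sqrt (1 - k^2 c^2); since k <= 1 gives 1 - c^2 <= 1 -
    k^2 c^2, its modulus is at most [m]. The strict k < 1 keeps the argument inside ]-1, 1[, where
    acos is differentiable. *)
Lemma acos_increment (a b k : R) (c dc m : R -> R) : a < b -> 0 < k < 1 ->
  {within `[a, b], continuous c} -> {within `[a, b], continuous dc} ->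
  {within `[a, b], continuous m} -> (forall t, 0 <= m t) ->
  (forall t, t \in `[a, b] -> `|c t| <= 1) ->
  (forall t, t \in `]a, b[ -> is_derive t 1 c (dc t)) ->
  (forall t, t \in `]a, b[ -> `|dc t| <= m t * Num.sqrt (1 - c t ^+ 2)) ->
  ((acos (k * c b) - acos (k * c a))%:E <=
    \int[lebesgue_measure]_(t in `[a, b]) (m t)%:E)%E.
Proof.
move=> ab /andP[k0 k1] cc cdc cm m0 c1 dcP dcm.
pose F t := acos (k * c t).
pose f t := - (Num.sqrt (1 - (k * c t) ^+ 2))^-1 * (k * dc t).
have kc t : t \in `[a, b] -> -1 < k * c t < 1.
  move=> /c1 ct; rewrite -ltr_norml normrM gtr0_norm//.
  by rewrite (le_lt_trans _ k1)// ler_piMr// ltW.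
have kc2 t : t \in `[a, b] -> 0 < 1 - (k * c t) ^+ 2.
  move=> /kc; rewrite -ltr_norml => h; rewrite subr_gt0 -real_normK ?num_real//.
  by rewrite expr_lt1// normr_ge0.
have F' t : t \in `]a, b[ -> is_derive t 1 F (f t).
  move=> tab; have d1 := dcP _ tab.
  have d2 := is_derive1_acos (kc _ (subset_itv_oo_cc tab)).
  have d3 : is_derive t 1 (fun t => k * c t) (k * dc t) by exact: is_deriveZ.
  rewrite /f /F.
  exact: (@is_derive1_comp _ (@acos R) (fun t => k * c t)).
have cont (g : R -> R) : {within `[a, b], continuous g} ->
    forall t, t \in `[a, b] -> g s @[s --> within `[a, b]%classic (nbhs t)] --> g t.
  by move=> /continuous_withinP.
have cF : {within `[a, b], continuous F}.
  apply/continuous_withinP => t tab; rewrite /F.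
  have h : k * c s @[s --> within `[a, b]%classic (nbhs t)] --> k * c t.
    by apply: cvgM; [exact: cvg_cst|exact: cont].
  exact: (cvg_comp _ _ h (continuous_acos (kc _ tab))).
have cf : {within `[a, b], continuous f}.
  apply/continuous_withinP => t tab; rewrite /f.
  apply: cvgM; last by apply: cvgM; [exact: cvg_cst|exact: cont].
  apply: cvgN; apply: cvgV; first by rewrite gt_eqF// sqrtr_gt0 kc2.
  have h : 1 - (k * c s) ^+ 2 @[s --> within `[a, b]%classic (nbhs t)] --> 1 - (k * c t) ^+ 2.
    apply: cvgB; first exact: cvg_cst.
    rewrite expr2; under eq_fun do rewrite expr2.
    by apply: cvgM; apply: cvgM; [exact: cvg_cst|exact: cont|exact: cvg_cst|exact: cont].
  exact: (cvg_comp _ _ h (@sqrt_continuous _ _)).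
have FTC : (\int[lebesgue_measure]_(t in `[a, b]) (f t)%:E = (F b)%:E - (F a)%:E)%E.
  apply: continuous_FTC2 => //.
    have [h1 h2 h3] := (continuous_within_itvP F ab).1 cF.
    by split => // t tab; exact: (@ex_derive _ _ _ _ _ _ _ (F' _ tab)).
  by move=> t tab; exact: derive_val1 (F' _ tab).
rewrite EFinB -FTC.
have I (g : R -> R) : {within `[a, b], continuous g} ->
    lebesgue_measure.-integrable `]a, b[ (EFin \o g).
  move=> cg.
  have : lebesgue_measure.-integrable `[a, b] (EFin \o g).
    by apply: continuous_compact_integrable => //; exact: segment_compact.
  by apply: integrableS => //; exact: subset_itv_oo_cc.
have M (g : R -> R) : {within `[a, b], continuous g} ->
  measurable_fun `]a, b[ (EFin \o g).
  by move=> /I/measurable_int.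
rewrite (integral_itv_bndoo (f := EFin \o f)); last exact: M.
rewrite (integral_itv_bndoo (f := EFin \o m)); last exact: M.
apply: le_integral => //; [exact: I|exact: I|].
move=> t /set_mem tab; rewrite lee_fin (le_trans (ler_norm _))// /f.
have tab' := subset_itv_oo_cc tab.
rewrite mulNr normrN normrM normfV (ger0_norm (sqrtr_ge0 _)) [`|k * _|]normrM (gtr0_norm k0).
rewrite ler_pdivrMl ?sqrtr_gt0 ?kc2//.
have {}dcm := dcm _ tab.
apply: (@le_trans _ _ (1 * (m t * Num.sqrt (1 - c t ^+ 2)))).
  by rewrite ler_pM// ltW.
rewrite mul1r mulrC ler_wpM2r// ler_sqrt ?kc2//.
  by rewrite lerD2l lerN2 exprMn ler_piMl ?sqr_ge0// expr_le1// ltW.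
by rewrite ltW ?kc2.
Qed.

End ArccosIncrement.

Section AngleBound.
Context {R : realType} {V : innerSpaceType R}.
Implicit Types (p q D : bop V V) (u v w : V).

Lemma proj_idem p v : is_proj p -> p (p v) = p v.
Proof. by move=> [_ pp]; rewrite -bopME pp. Qed.

Lemma sqr_hnorm_proj p v : is_proj p -> hnorm (p v) ^+ 2 = complex.Re (ip (p v) v).
Proof. by move=> pP; rewrite hnorm_sqr pP.1 proj_idem// -pP.1. Qed.

Lemma sqr_hnorm_subproj p v : is_proj p ->
  hnorm (v - p v) ^+ 2 = hnorm v ^+ 2 - complex.Re (ip (p v) v).
Proof.
move=> pP; rewrite hnorm_sqr ipBl !ipBr !ReB -!hnorm_sqr sqr_hnorm_proj//.
by rewrite -pP.1; ring.
Qed.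

(** Compressing the relation by [p] gives p D p = 0: to first order a projection moves only between
    its range and its kernel. Only the cross term of [D (p v)] with [v - p v] survives, counted
    twice. *)
Lemma proj_velocity p D v : is_proj p -> selfadjoint D -> D * p + p * D = D ->
  `|complex.Re (ip (D v) v)| <= 2 * (`|D| * (hnorm (p v) * hnorm (v - p v))).
Proof.
move=> pP Ds Dp.
have pDp u : p (D (p u)) = 0.
  have := congr1 (fun A : bop V V => p (A (p u))) Dp.
  rewrite bopDE !bopME bop_addv !(proj_idem _ pP) => /eqP.
  by rewrite -subr_eq0 addrK => /eqP.
have -> : complex.Re (ip (D v) v) = 2 * complex.Re (ip (D (p v)) (v - p v)).
  have E : complex.Re (ip (D (p v)) (v - p v)) = complex.Re (ip (D (p v)) v).
    by rewrite ipBr ReB -[X in _ - X](_ : 0 = _) ?subr0// -pP.1 pDp ip0l.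
  rewrite E -[in LHS]Dp bopDE !bopME ipDl ReD (pP.1 (D v) v) (Ds v).
  by rewrite (Re_ipC v); ring.
rewrite normrM ger0_norm// ler_wpM2l// mulrA (le_trans (normr_Re_ip _ _))//.
by rewrite ler_wpM2r ?hnorm_ge0// hnorm_le_norm.
Qed.

(** Differentiation of the two identities defining a projection, valid in a neighbourhood of [t]. *)
Lemma derive_proj (g : R -> bop V V) (a b t : R) D : t \in `]a, b[ ->
  (forall s, s \in `[a, b] -> is_proj (g s)) -> is_derive t 1 g D ->
  selfadjoint D /\ D * g t + g t * D = D.
Proof.
move=> tab gP dg; have gP' s : s \in `]a, b[ -> is_proj (g s).
  by move=> /subset_itv_oo_cc; exact: gP.
split.
  apply: is_adjoint_Re => v w; rewrite (Re_ipC v).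
  have d1 := is_derive_Re_ip v w dg; have d2 := is_derive_Re_ip w v dg.
  rewrite -(derive_val1 d1) -(derive_val1 d2) !derive1E.
  apply: near_eq_derive; have := near_in_itvoo tab; apply: filterS => s /gP'[gs _].
  by rewrite gs Re_ipC.
have d := is_derive_bopM dg dg.
rewrite -(derive_val1 d) -(derive_val1 dg) !derive1E.
by apply: near_eq_derive; have := near_in_itvoo tab; apply: filterS => s /gP'[].
Qed.

(* c t = 2 <g t v, v> - 1 is the cosine of twice the angle between v and the
   range of g t; the factor k < 1 keeps arccos away from its singularities. *)
Lemma C1_angle (g : R -> bop V V) (a b k : R) v : a < b -> 0 < k < 1 ->
  hnorm v = 1 -> (forall t, t \in `[a, b] -> is_proj (g t)) -> C1_on a b g ->
  let c t := 2 * complex.Re (ip (g t v) v) - 1 in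
  ((acos (k * c b) - acos (k * c a))%:E <= 2%:E * curve_length a b g)%E /\
  measurable_fun `[a, b] (fun t => `|derive1 g t|%:E).
Proof.
move=> ab k01 v1 gP [cg [D cD dg]] c.
have cm : {within `[a, b], continuous (fun t => `|D t|)}.
  apply/continuous_withinP => t tab; apply: cvg_norm.
  by move/continuous_withinP : cD => /(_ t tab).
have mD : measurable_fun `[a, b] (fun t => `|D t|%:E).
  by apply/measurable_EFinP; exact: subspace_continuous_measurable_fun.
have mDo : measurable_fun `]a, b[ (fun t => `|D t|%:E).
  by apply: measurable_funS mD => //; exact: subset_itv_oo_cc.
have mg : measurable_fun `]a, b[ (fun t => `|derive1 g t|%:E).
  apply: eq_measurable_fun mDo => t; rewrite inE => tab.
  by rewrite (derive_val1 (dg _ tab)).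
split; last by apply/emeasurable_fun_itv_bndo_bndcP/emeasurable_fun_itv_obnd_cbndP.
have ci (G : R -> bop V V) : {within `[a, b], continuous G} ->
    {within `[a, b], continuous (fun t => complex.Re (ip (G t v) v))}.
  move=> cG; apply/continuous_withinP => t tab; apply: cvg_Re_ip.
  by move/continuous_withinP : cG => /(_ t tab).
have cp t : t \in `[a, b] -> 0 <= complex.Re (ip (g t v) v) <= 1.
  move=> /gP gt; rewrite -sqr_hnorm_proj// sqr_ge0/= -subr_ge0.
  by have := sqr_hnorm_subproj v gt; rewrite v1 expr1n -sqr_hnorm_proj// => <-; exact: sqr_ge0.
have -> : (2%:E * curve_length a b g = \int[lebesgue_measure]_(t in `[a, b]) (2 * `|D t|)%:E)%E.
  rewrite /curve_length integral_itv_bndoo// [RHS]integral_itv_bndoo; last first.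
    by apply/measurable_EFinP/measurable_funM => //; exact/measurable_EFinP.
  under [RHS]eq_integral do rewrite EFinM.
  rewrite ge0_integralZl//; congr (_ * _)%E; apply: eq_integral => t; rewrite inE => tab.
  by rewrite (derive_val1 (dg _ tab)).
apply: (@acos_increment _ a b k c (fun t => 2 * complex.Re (ip (D t v) v))) => //.
- apply/continuous_withinP => t tab; apply: cvgB; last exact: cvg_cst.
  by apply: cvgM; [exact: cvg_cst|move/continuous_withinP : (ci _ cg) => /(_ t tab)].
- apply/continuous_withinP => t tab.
  by apply: cvgM; [exact: cvg_cst|move/continuous_withinP : (ci _ cD) => /(_ t tab)].
- apply/continuous_withinP => t tab.
  by apply: cvgM; [exact: cvg_cst|move/continuous_withinP : cm => /(_ t tab)].
- by move=> t /cp /andP[h1 h2]; rewrite /c ler_norml; apply/andP; split; lra.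
- move=> t tab; have d := is_derive_Re_ip v v (dg _ tab).
  have dc := is_deriveB (is_deriveZ 2 d) (is_derive_cst (1 : R) t 1).
  by rewrite subr0 in dc.
move=> t tab; have tab' := subset_itv_oo_cc tab; have gt := gP _ tab'.
have [Ds Dp] := derive_proj tab gP (dg _ tab).
have := proj_velocity v gt Ds Dp.
(* For unit [v] the two norms are the cosine and the sine of its angle to the range of [g t], so
   this is the sine of the double angle. *)
have -> : Num.sqrt (1 - c t ^+ 2) = 2 * (hnorm (g t v) * hnorm (v - g t v)).
  have -> : 1 - c t ^+ 2 = (2 * (hnorm (g t v) * hnorm (v - g t v))) ^+ 2.
    by rewrite !exprMn sqr_hnorm_proj// sqr_hnorm_subproj// v1 /c; ring.
  by rewrite sqrtr_sqr ger0_norm// !mulr_ge0 ?hnorm_ge0.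
rewrite normrM ger0_norm// => h; rewrite -mulrA ler_wpM2l//.
by rewrite (le_trans h)// le_eqVlt; apply/orP; left; apply/eqP; ring.
Qed.

(** The estimates for the pieces telescope. Measurability of the speed is carried through the
    induction because adding the lengths of two pieces requires it. *)
Lemma piecewise_angle (g : R -> bop V V) (a b k : R) v : 0 < k < 1 ->
  hnorm v = 1 -> (forall t, t \in `[a, b] -> is_proj (g t)) -> piecewise_C1 a b g ->
  let c t := 2 * complex.Re (ip (g t v) v) - 1 in
  ((acos (k * c b) - acos (k * c a))%:E <= 2%:E * curve_length a b g)%E /\
  measurable_fun `[a, b] (fun t => `|derive1 g t|%:E).
Proof.
move=> k01 v1 gP [s sP sC] c; elim: s a gP sP sC => [|x s IH] a gP sP sC.
  have <- := itv_partition_nil sP; rewrite subrr set_itv1; split.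
    by rewrite mule_ge0//; apply: integral_ge0 => t _; rewrite lee_fin.
  exact: measurable_fun_set1.
have ax : a < x by case: sP => /= /andP[].
have xs := itv_partition_cons sP.
have xb : x <= b by exact: itv_partition_le xs.
have [h1 m1] : ((acos (k * c x) - acos (k * c a))%:E <= 2%:E * curve_length a x g)%E /\
  measurable_fun `[a, x] (fun t => `|derive1 g t|%:E).
  apply: C1_angle => //; last exact: (sC 0).
  by move=> t tax; apply: gP; apply: subset_itvl tax; rewrite bnd_simp.
have [h2 m2] : ((acos (k * c b) - acos (k * c x))%:E <= 2%:E * curve_length x b g)%E /\
  measurable_fun `[x, b] (fun t => `|derive1 g t|%:E).
  apply: IH => //.
    by move=> t tax; apply: gP; apply: subset_itvr tax; rewrite bnd_simp ltW.
  move=> i si; have := sC i.+1 si.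
  done.
have U : `[a, x]%classic `|` `]x, b]%classic = `[a, b]%classic :> set R.
  by rewrite -itv_bndbnd_setU// bnd_simp// ltW.
have m3 : measurable_fun `]x, b] (fun t => `|derive1 g t|%:E).
  exact/emeasurable_fun_itv_obnd_cbndP.
have m : measurable_fun `[a, b] (fun t => `|derive1 g t|%:E).
  by rewrite -U; apply/measurable_funU.
split => //.
have -> : curve_length a b g = (curve_length a x g + curve_length x b g)%E.
  rewrite /curve_length -U ge0_integral_setU//=.
  - by congr (_ + _)%E; exact: integral_itv_obnd_cbnd.
  - by rewrite U.
  - apply/disj_setPS => t /=; rewrite !in_itv/= => -[/andP[_ h] /andP[h' _]].
    by move: (lt_le_trans h' h); rewrite ltxx.
rewrite muleDr//; last first.
  rewrite ge0_adde_def// inE; apply: integral_ge0 => t _; rewrite lee_fin//.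
apply: le_trans (leeD h1 h2).
by rewrite -EFinD lee_fin le_eqVlt; apply/orP; left; apply/eqP; ring.
Qed.

(** [v] lies in the range of [p] and makes the angle [alpha] with the range of [q]; along any
    competing curve its double angle goes from 0 to 2 alpha, at no more than twice the speed. *)
Lemma dist_ge_angle p q v (alpha : R) : 0 < alpha < pi / 2 -> hnorm v = 1 ->
  p v = v -> complex.Re (ip (q v) v) = cos alpha ^+ 2 -> (alpha%:E <= dist p q)%E.
Proof.
move=> /andP[a0 a1] v1 pv qv; apply: le_ereal_inf_tmp => _ [g [gC g0 g1 gP] <-].
have key (k : R) : 0 < k < 1 ->
   ((acos (k * cos (2 * alpha)) - acos k)%:E <= 2%:E * curve_length 0 1 g)%E.
  move=> k01; have [+ _] := piecewise_angle k01 v1 gP gC.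
  rewrite g0 g1 pv -hnorm_sqr v1 qv expr1n.
  have -> : 2 * cos alpha ^+ 2 - 1 = cos (2 * alpha).
    by rewrite [2 * alpha]mulr_natl mulr2n cosD -!expr2 sin2cos2; ring.
  by rewrite (_ : k * (2 * 1 - 1) = k)//; ring.
have := @ltry R.
case: (curve_length 0 1 g) key => [l| |] key _; last 2 first.
- by rewrite leey.
- have : 0 < (1/2 : R) < 1 by apply/andP; split; lra.
  by move/key; rewrite gt0_muleNy// lte_fin.
rewrite lee_fin.
(* With k = cos eta the term acos k is [eta]; letting it tend to 0 from the right recovers 2 alpha
   <= 2 l. *)
have key2 (eta : R) : 0 < eta < pi / 2 -> acos (cos eta * cos (2 * alpha)) - eta <= 2 * l.
  move=> /andP[e0 e1].
  have := key (cos eta); rewrite -EFinM lee_fin cosK; last first.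
    by rewrite in_itv/= ltW//= (le_trans (ltW e1))// ler_pdivrMr// ler_peMr ?pi_ge0// ler1n.
  apply; rewrite cos_gt0_pihalf/=; last by rewrite (lt_trans _ e0)// oppr_lt0 divr_gt0 ?pi_gt0.
  by rewrite -cos0 ltr_cos// in_itv/= ?lexx ?pi_ge0//= ltW//= (le_trans (ltW e1))// ler_pdivrMr// ler_peMr ?pi_ge0// ler1n.
have lim : acos (cos eta * cos (2 * alpha)) - eta @[eta --> (0:R)^'+] --> 2 * alpha.
  have i2 : (-1 : R) < cos 0 * cos (2 * alpha) < 1.
    rewrite cos0 mul1r; have pi0 := pi_gt0 R.
    have : cos pi < cos (2 * alpha).
      by rewrite ltr_cos ?in_itv/= ?pi_ge0 ?lexx//; [lra|apply/andP; split; lra].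
    have : cos (2 * alpha) < cos 0.
      by rewrite ltr_cos ?in_itv/= ?pi_ge0 ?lexx//; [lra|apply/andP; split; lra].
    by rewrite cospi cos0 => -> ->.
  have e0 : eta @[eta --> (0:R)^'+] --> (0 : R) by apply: cvg_at_right_filter; exact: cvg_id.
  rewrite -[X in _ --> X]subr0; apply: cvgB => //.
  have E : acos (cos 0 * cos (2 * alpha)) = 2 * alpha.
    by rewrite cos0 mul1r cosK// in_itv/=; apply/andP; split; lra.
  rewrite -[X in _ --> X]E.
  have h : cos eta * cos (2 * alpha) @[eta --> (0:R)^'+] --> cos 0 * cos (2 * alpha).
    apply: cvgM; last exact: cvg_cst.
    exact: (cvg_comp _ _ e0 (@continuous_cos _ _)).
  exact: (cvg_comp _ _ h (continuous_acos i2)).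
rewrite -(@ler_pM2l _ 2)//; apply: (cvgr_to_le lim); near=> eta.
by apply: key2; apply/andP; split; near: eta; [exact: nbhs_right_gt|apply: nbhs_right_lt; lra].
Unshelve. all: by end_near. Qed.

End AngleBound.

(** * Fixed vectors of the exponential of a small skew operator *)

Section SmallSkew.
Context {R : realType} {V : innerSpaceType R}.
Context (cV : hcomplete V).
Implicit Types (B : bop V V) (w : V).

Lemma skew_ip B w : skew B -> complex.Re (ip (B w) w) = 0.
Proof.
move=> Bs; have := congr1 (@complex.Re R) (Bs w w).
by rewrite bopNE ipNr ReN [in RHS]Re_ipC => h; lra.
Qed.

(* If exp(tau B) w = - w, the curve exp(t B) w covers an angle pi at speed at
   most |B|. *)
Lemma expop_skew_neq_opp B (tau : R) w : skew B -> 0 < tau -> tau * `|B| < pi ->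
  expop (tau *: B) w = - w -> w = 0.
Proof.
move=> Bs t0 tB Ew; apply/eqP; apply/negP => /negP/hnorm_gt0 w0.
pose c t := complex.Re (ip (expop (t *: B) w) w) / hnorm w ^+ 2.
pose dc t := complex.Re (ip ((B * expop (t *: B)) w) w) / hnorm w ^+ 2.
have cw (f : R -> R) (F : R -> bop V V) : continuous F ->
    (forall t, f t = complex.Re (ip (F t w) w) / hnorm w ^+ 2) ->
    {within `[0, tau], continuous f}.
  move=> cF fE; apply: continuous_subspaceT => t.
  rewrite (_ : f = fun t => complex.Re (ip (F t w) w) / hnorm w ^+ 2); last exact/funext.
  by apply: cvgM; [apply: cvg_Re_ip; exact: cF|exact: cvg_cst].
have cE : continuous (fun t : R => expop (t *: B)).
  move=> t; apply: differentiable_continuous; apply/derivable1_diffP.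
  exact: (@ex_derive _ _ _ _ _ _ _ (is_derive_expop cV B t)).
have cBE : continuous (fun t : R => B * expop (t *: B)).
  by move=> t; apply: cvg_bopM; [exact: cvg_cst|exact: cE].
have sw : 0 < hnorm w ^+ 2 by rewrite exprn_gt0.
have c1 t : `|c t| <= 1.
  rewrite /c normrM normfV (gtr0_norm sw) ler_pdivrMr// mul1r expr2.
  by rewrite (le_trans (normr_Re_ip _ _))// hnorm_expop.
have bnd (k : R) : 0 < k < 1 -> acos (k * c tau) - acos (k * c 0) <= tau * `|B|.
  move=> k01; rewrite -lee_fin.
  have -> : (tau * `|B|)%:E = (\int[lebesgue_measure]_(t in `[0%R, tau]) (cst `|B| t)%:E)%E.
    transitivity (\int[lebesgue_measure]_(t in `[0%R, tau]) cst `|B|%:E t)%E => //.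
    rewrite integral_cst//= lebesgue_measure_itv/= lte_fin t0.
    by rewrite -EFinB subr0 -EFinM mulrC.
  apply: (@acos_increment _ 0 tau k c dc) => //.
  - exact: cw cE _.
  - exact: cw cBE _.
  - by apply: continuous_subspaceT => t; exact: cvg_cst.
  - move=> t _; have d := is_derive_Re_ip w w (is_derive_expop cV B t).
    have := is_deriveM d (is_derive_cst ((hnorm w ^+ 2)^-1) t 1).
    by rewrite scaler0 add0r => h; rewrite /dc mulrC; exact: h.
  move=> t _; set x := expop (t *: B) w.
  have xw : hnorm x = hnorm w by rewrite hnorm_expop.
  (* For skew [B] the real part of the product of [B x] and [x] is 0, so only the component of [w]
     orthogonal to [x] counts; its relative length is the sine of the angle between them. *)
  have -> : Num.sqrt (1 - c t ^+ 2) = hnorm (w - (c t)%:C%C *: x) / hnorm w.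
    have -> : 1 - c t ^+ 2 = (hnorm (w - (c t)%:C%C *: x) / hnorm w) ^+ 2.
      have E : complex.Re (ip x w) = c t * hnorm w ^+ 2 by rewrite /c divfK ?gt_eqF.
      move: (c t) E => y E; rewrite exprMn (hnorm_sqr (w - _)) ipBl !ipBr !ReB.
      rewrite -!hnorm_sqr hnormZR ipZl ipZr conjc_real !ReZ (Re_ipC w) E xw exprMn.
      rewrite real_normK ?num_real//; field.
      by rewrite gt_eqF.
    by rewrite sqrtr_sqr ger0_norm// divr_ge0// hnorm_ge0.
  rewrite /dc normrM normfV (gtr0_norm sw) ler_pdivrMr// expr2 [leRHS]mulrA.
  have -> : `|B| * (hnorm (w - (c t)%:C%C *: x) / hnorm w) * hnorm w * hnorm w =
     `|B| * hnorm w * hnorm (w - (c t)%:C%C *: x) by field; rewrite gt_eqF.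
  have -> : complex.Re (ip ((B * expop (t *: B)) w) w) =
      complex.Re (ip (B x) (w - (c t)%:C%C *: x)).
    by rewrite bopME -/x ipBr ipZr conjc_real ReB ReZ skew_ip// mulr0 subr0.
  rewrite (le_trans (normr_Re_ip _ _))// ler_wpM2r ?hnorm_ge0//.
  by rewrite -xw hnorm_le_norm.
have c0 : c 0 = 1.
  by rewrite /c scale0r expop0// -hnorm_sqr divff// gt_eqF.
have ct : c tau = -1.
  by rewrite /c Ew ipNl ReN mulNr -hnorm_sqr divff// gt_eqF.
have pi0 := pi_gt0 R.
(* With k = cos eta the estimate reads pi - 2 eta <= tau |B|; for this [eta] the left-hand side is
   the mean of pi and tau |B|, a contradiction. *)
pose eta := (pi - tau * `|B|) / 4.
have tB0 : 0 <= tau * `|B| by rewrite mulr_ge0// ltW.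
have e0 : 0 < eta by rewrite divr_gt0// subr_gt0.
have e1 : eta <= pi / 4 by rewrite ler_pM2r// lerBlDr lerDl.
have k01 : 0 < cos eta < 1.
  rewrite cos_gt0_pihalf/=; last by apply/andP; split; lra.
  rewrite -cos0 ltr_cos ?in_itv/= ?lexx ?pi_ge0//; lra.
have := bnd _ k01; rewrite c0 ct mulr1 mulrN1 acosN ?cosK ?in_itv/=.
- by rewrite /eta; lra.
- by apply/andP; split; lra.
- by case/andP: k01 => h1 h2; apply/andP; split; lra.
Qed.

(** exp(tau B) sends w - exp(tau B) w to its negative, so that vector vanishes. *)
Lemma expop_skew_half B (tau : R) w : skew B -> 0 < tau -> tau * `|B| < pi ->
  expop ((tau + tau) *: B) w = w -> expop (tau *: B) w = w.
Proof.
move=> Bs t0 tB Ew; apply/esym/eqP; rewrite -subr_eq0; apply/eqP.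
apply: (expop_skew_neq_opp Bs t0 tB).
by rewrite bop_subv -bopME -expopD// Ew opprB.
Qed.

(** Halving passes the fixed-vector property to h = tau / 2^n for every n. There the second-order
    bound for the exponential gives h |B w| <= K h^2 |w|, and h tends to 0. *)
Lemma expop_skew_fix B (tau : R) w : skew B -> 0 < tau -> tau * `|B| < pi ->
  expop ((tau + tau) *: B) w = w -> B w = 0.
Proof.
move=> Bs t0 tB Ew.
have E n : expop ((tau / 2 ^+ n) *: B) w = w.
  elim: n => [|n IH].
    by rewrite expr0 divr1; exact: expop_skew_half.
  apply: expop_skew_half => //; first by rewrite divr_gt0// exprn_gt0.
    rewrite (le_lt_trans _ tB)// ler_wpM2r// ler_pdivrMr ?exprn_gt0//.
    by rewrite ler_peMr ?(ltW t0)// exprn_ege1// ler1n.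
  have -> : tau / 2 ^+ n.+1 + tau / 2 ^+ n.+1 = tau / 2 ^+ n.
    have : (2 ^+ n : R) != 0 by rewrite expf_neq0.
    by rewrite exprS; move: (2 ^+ n : R) => x x0; field.
  exact: IH.
apply: hnorm_eq0; apply/eqP; rewrite eq_le hnorm_ge0 andbT.
pose M := tau + 1; pose K := expR (4 * M * `|B|).
have M1 : 1 <= M by rewrite lerDr ltW.
have bnd n : hnorm (B w) <= tau / 2 ^+ n * (K * hnorm w).
  set h := tau / 2 ^+ n.
  have h0 : 0 < h by rewrite divr_gt0// exprn_gt0.
  have hM : `|h| <= M.
    rewrite gtr0_norm// /h ler_pdivrMr ?exprn_gt0//.
    apply: (@le_trans _ _ (M * 1)); first by rewrite mulr1 lerDl.
    by rewrite ler_wpM2l ?(le_trans _ M1)// exprn_ege1// ler1n.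
  have := @expop_bound _ _ cV B M 0 h M1 _ hM.
  rewrite normr0 subr0 scale0r expop0// mulr1 (le_trans _ M1)// => /(_ isT) b.
  have := le_trans (hnorm_le_norm (expop (h *: B) - 1 - h *: B) w)
    (ler_wpM2r (hnorm_ge0 w) b).
  rewrite !bopBE E subrr sub0r bopZE Defs.hnormN hnormZR gtr0_norm//.
  rewrite -/K => H; rewrite -(ler_pM2l h0) (le_trans H)// le_eqVlt.
  by apply/orP; left; apply/eqP; ring.
have lim : tau / 2 ^+ n * (K * hnorm w) @[n --> \oo] --> (0 : R).
  rewrite -[X in _ --> X](mul0r (K * hnorm w)); apply: cvgM; last exact: cvg_cst.
  rewrite -[X in _ --> X](mulr0 tau); apply: cvgM; first exact: cvg_cst.
  under eq_fun do rewrite -exprVn.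
  by apply: cvg_expr; rewrite gtr0_norm ?invf_lt1// ltr1n.
by apply: (cvgr_to_ge lim); near=> n; exact: bnd.
Unshelve. all: by end_near. Qed.

End SmallSkew.
(** * The geodesic of a diagonal operator *)

Section ProductSpace.
Context {R : realType} {V : innerSpaceType R}.
Notation VV := (V * V)%type.
Implicit Types (x y : VV) (A B C D : bop V V).

Lemma ip_pair x y : ip x y = ip x.1 y.1 + ip x.2 y.2. Proof. by []. Qed.

Lemma sqr_hnorm_pair x : hnorm x ^+ 2 = hnorm x.1 ^+ 2 + hnorm x.2 ^+ 2.
Proof. by rewrite !hnorm_sqr ip_pair ReD. Qed.

Lemma hnorm_pair_le x : hnorm x <= hnorm x.1 + hnorm x.2.
Proof.
rewrite -(@ler_pXn2r _ 2)// ?nnegrE ?addr_ge0 ?hnorm_ge0// sqr_hnorm_pair.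
by rewrite sqrrD lerD2r lerDl mulrn_wge0// mulr_ge0// hnorm_ge0.
Qed.

Lemma hnorm_pair0 (v : V) : hnorm ((v, 0) : VV) = hnorm v.
Proof.
apply/eqP; rewrite -(@eqrXn2 _ 2)// ?hnorm_ge0// sqr_hnorm_pair/= hnorm0.
by rewrite expr0n addr0.
Qed.

Lemma hcomplete_pair : hcomplete V -> hcomplete VV.
Proof.
move=> cV u uC.
have [l1 h1] : exists l, hcvg (fun n => (u n).1) l.
  apply: cV => e /uC[N NP]; exists N => m n Nm Nn.
  exact: le_lt_trans (hnorm_fst (u m - u n)) (NP _ _ Nm Nn).
have [l2 h2] : exists l, hcvg (fun n => (u n).2) l.
  apply: cV => e /uC[N NP]; exists N => m n Nm Nn.
  exact: le_lt_trans (hnorm_snd (u m - u n)) (NP _ _ Nm Nn).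
exists (l1, l2).
have h : hnorm ((u n).1 - l1) + hnorm ((u n).2 - l2) @[n --> \oo] --> (0 : R).
  by rewrite -[X in _ --> X]addr0; exact: cvgD.
apply: (squeeze_cvgr _ (cvg_cst 0) h); near=> n.
by rewrite hnorm_ge0/= (le_trans (hnorm_pair_le _)).
Unshelve. all: by end_near. Qed.

Definition bblock_fun A B C D x : VV := (A x.1 + B x.2, C x.1 + D x.2).

Lemma bblock_linear A B C D : linear (bblock_fun A B C D).
Proof.
move=> a [x1 x2] [y1 y2]; congr pair => /=;
  by rewrite !bop_addv !bop_scale scalerDr addrACA.
Qed.

Lemma bblock_bounded A B C D : exists M : R, forall x,
  hnorm (bblock_fun A B C D x) <= M * hnorm x.
Proof.
exists ((`|A| + `|B|) + (`|C| + `|D|)) => x.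
rewrite (le_trans (hnorm_pair_le _))// mulrDl lerD//=.
  rewrite (le_trans (ler_hnormD _ _))// mulrDl lerD//.
    by rewrite (le_trans (hnorm_le_norm _ _))// ler_wpM2l// hnorm_fst.
  by rewrite (le_trans (hnorm_le_norm _ _))// ler_wpM2l// hnorm_snd.
rewrite (le_trans (ler_hnormD _ _))// mulrDl lerD//.
  by rewrite (le_trans (hnorm_le_norm _ _))// ler_wpM2l// hnorm_fst.
by rewrite (le_trans (hnorm_le_norm _ _))// ler_wpM2l// hnorm_snd.
Qed.

Definition bblock A B C D : bop VV VV :=
  Bop (bblock_linear A B C D) (bblock_bounded A B C D).

Lemma bblockE A B C D (v w : V) : bblock A B C D (v, w) = (A v + B w, C v + D w).
Proof. by []. Qed.

Lemma bblockM A B C D A' B' C' D' : bblock A B C D * bblock A' B' C' D' =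
  bblock (A * A' + B * C') (A * B' + B * D') (C * A' + D * C') (C * B' + D * D').
Proof.
apply: bopP => -[x1 x2]; rewrite bopME !bblockE !bopDE !bopME !bop_addv.
by congr pair; rewrite addrACA.
Qed.

Lemma bblockB A B C D A' B' C' D' : bblock A B C D - bblock A' B' C' D' =
  bblock (A - A') (B - B') (C - C') (D - D').
Proof.
apply: bopP => -[x1 x2]; rewrite bopBE !bblockE !bopBE.
by congr pair; rewrite /= opprD addrACA.
Qed.

Lemma bblock1 : bblock 1 0 0 1 = 1.
Proof. by apply: bopP => -[x1 x2]; rewrite bblockE addr0 add0r. Qed.

Lemma std_projE : std_proj V = bblock 1 0 0 0.
Proof. by apply: bopP => -[x1 x2]; rewrite bblockE !addr0. Qed.

Lemma bop_pair_basis (W : innerSpaceType R) (e : int -> V) (A B : bop VV W) :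
  orthonormal_basis e ->
  (forall n, A (e n, 0) = B (e n, 0)) -> (forall n, A (0, e n) = B (0, e n)) -> A = B.
Proof.
move=> eB h1 h2.
pose inr : bop V VV := bcomp (bblock 0 1 1 0) (binl V V).
have inrE v : inr v = (0, v) by rewrite /= /bblock_fun/= !addr0.
have E1 : bcomp A (binl V V) = bcomp B (binl V V).
  by apply: (bop_basis_eq eB) => n; exact: h1.
have E2 : bcomp A inr = bcomp B inr.
  by apply: (bop_basis_eq eB) => n; have := h2 n; rewrite -inrE.
apply: bopP => -[x1 x2].
have -> : (x1, x2) = (x1, 0) + inr x2 :> VV.
  by rewrite inrE; congr pair => /=; rewrite ?addr0 ?add0r.
rewrite !bop_addv; congr (_ + _).
  exact: (congr1 (fun F : bop V W => F x1) E1).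
exact: (congr1 (fun F : bop V W => F x2) E2).
Qed.

End ProductSpace.

Section ProjectionFacts.
Context {R : realType}.
Implicit Types V W : innerSpaceType R.

Lemma is_adjoint_unique V W (A : bop V W) (B C : bop W V) :
  is_adjoint A B -> is_adjoint A C -> B = C.
Proof.
move=> AB AC; apply: bopP => w; apply: Re_ip_inj => v.
by rewrite !(Re_ipC _ v) -AB -AC.
Qed.

Lemma adjE V W (A : bop V W) (B : bop W V) : is_adjoint A B -> adj A = B.
Proof.
move=> AB; rewrite /adj; apply: (is_adjoint_unique _ AB).
exact: (@xgetPex _ 0 [set B | is_adjoint A B]) (ex_intro _ B AB).
Qed.

Lemma is_proj_range_inj V (p q : bop V V) : is_proj p -> is_proj q ->
  range p = range q -> p = q.
Proof.
move=> pP qP pq.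
have E1 v : q (p v) = p v.
  have : range p (p v) by exists v.
  by rewrite pq => -[w _ <-]; rewrite proj_idem.
have E2 v : p (q v) = q v.
  have : range q (q v) by exists v.
  by rewrite -pq => -[w _ <-]; rewrite proj_idem.
apply: bopP => v; apply: Re_ip_inj => w.
by rewrite -E1 qP.1 pP.1 E2 -qP.1.
Qed.

Lemma proj_onto_eq V (p : bop V V) (S : set V) : is_proj p -> range p = S ->
  proj_onto S = p.
Proof.
move=> pP pS; rewrite /proj_onto.
have [h1 h2] := @xgetPex _ (0 : bop V V) [set p | is_proj p /\ range p = S]
  (ex_intro _ p (conj pP pS)).
by apply: is_proj_range_inj => //; rewrite pS.
Qed.

Lemma is_proj_std V : is_proj (std_proj V).
Proof.
split; last exact: bopP.
by move=> x y; rewrite !ip_pair/= ip0l ip0r.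
Qed.

End ProjectionFacts.

Section TangentVectors.
Context {R : realType} {V : innerSpaceType R}.
Implicit Types (p X : bop V V).

Lemma tangent_pXp p X : is_proj p -> tangent p X -> p * X * p = 0.
Proof.
move=> [_ pp] [_ Xt]; have := congr1 (fun Y => p * Y * p) Xt.
rewrite /= mulrDr mulrDl !mulrA -[p * X * p * p]mulrA pp => /eqP.
by rewrite -subr_eq0 addrK => /eqP.
Qed.

Lemma tangent_skew p X : is_proj p -> tangent p X -> skew (X * p - p * X).
Proof.
move=> [ps _] [Xs _] v w; rewrite bopNE !bopBE !bopME ipBl opprB ipBr.
by rewrite Xs ps ps Xs.
Qed.

(** This makes [X] the initial velocity of its geodesic, hence |X| the constant speed. *)
Lemma tangent_comm p X : is_proj p -> tangent p X ->
  (X * p - p * X) * p - p * (X * p - p * X) = X.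
Proof.
move=> pP Xt; have pXp := tangent_pXp pP Xt; have [_ pp] := pP.
rewrite mulrBl mulrBr pXp mulrA pXp -mulrA pp mulrA pp subr0 sub0r opprK.
exact: Xt.2.
Qed.

(** A tangent vector exchanges the range and the kernel of [p], and so does its generator, which
    therefore changes sign under conjugation by the reflection 2 p - 1. *)
Lemma tangent_anticomm p X : is_proj p -> tangent p X ->
  (X * p - p * X) * (p + p - 1) = - ((p + p - 1) * (X * p - p * X)).
Proof.
move=> pP Xt; have pXp := tangent_pXp pP Xt; have [_ pp] := pP.
have E1 : (X * p - p * X) * p = X * p by rewrite mulrBl -mulrA pp pXp subr0.
have E2 : p * (X * p - p * X) = - (p * X) by rewrite mulrBr !mulrA pp pXp sub0r.
rewrite mulrBr mulr1 mulrDr E1 mulrBl mul1r mulrDl E2.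
by rewrite !opprB addrACA subrr addr0 addrACA addNr add0r opprB opprK.
Qed.

(** X p v and p X v are orthogonal in the real sense because p X p = 0, so their difference has the
    norm of their sum, which is X v. *)
Lemma norm_tangent_gen p X : is_proj p -> tangent p X -> `|X * p - p * X| <= `|X|.
Proof.
move=> pP Xt; have pXp := tangent_pXp pP Xt; have [Xs Xt'] := Xt.
apply: norm_bop_le => // v.
suff -> : hnorm ((X * p - p * X) v) = hnorm (X v) by exact: hnorm_le_norm.
apply/eqP; rewrite -(@eqrXn2 _ 2)// ?hnorm_ge0//; apply/eqP.
have O : complex.Re (ip (X (p v)) (p (X v))) = 0.
  by rewrite -pP.1 -!bopME pXp ip0l.
have -> : hnorm (X v) ^+ 2 = hnorm ((X * p + p * X) v) ^+ 2 by rewrite Xt'.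
rewrite !hnorm_sqr bopBE bopDE !bopME ipBl !ipBr ipDl !ipDr !ReB !ReD.
by rewrite [complex.Re (ip (p (X v)) (X (p v)))]Re_ipC O; ring.
Qed.

End TangentVectors.

Lemma is_derive_scale (R : realType) (f : R -> R) (W : normedModType R) (A : W) (t df : R) :
  is_derive t 1 f df -> is_derive t 1 (fun s => f s *: A) (df *: A).
Proof.
move=> /is_deriveP h; apply/is_deriveP.
apply: cvg_trans (cvgZr_tmp h); apply: near_eq_cvg; near=> s.
by rewrite -scalerBl scalerA.
Unshelve. all: by end_near. Qed.

Lemma bop0E (R : realType) (V W : innerSpaceType R) (v : V) : (0 : bop V W) v = 0.
Proof. by []. Qed.

Lemma bop1E (R : realType) (V : innerSpaceType R) (v : V) : (1 : bop V V) v = v.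
Proof. by []. Qed.

Section ScalarOperators.
Context {R : realType} {V : innerSpaceType R}.

Lemma mulop_linear (a : R[i]) : linear (fun v : V => a *: v).
Proof. by move=> b u v; rewrite scalerDr !scalerA mulrC. Qed.

Lemma mulop_bounded (a : R[i]) : exists M : R, forall v : V, hnorm (a *: v) <= M * hnorm v.
Proof. by exists (complex.Re `|a|) => v; rewrite hnormZ. Qed.

(** Operators form a module over [R] only; complex scalars enter as these central operators. *)
Definition mulop (a : R[i]) : bop V V := Bop (mulop_linear a) (mulop_bounded a).

Lemma mulopC a (A : bop V V) : A * mulop a = mulop a * A.
Proof. by apply: bopP => v; rewrite !bopME /= bop_scale. Qed.

Lemma skew_mulop_i (b : R) : skew (b *: mulop 'i%C).
Proof.
move=> u v; rewrite bopNE !bopZE /= ipZl ipZl ipNr ipZr ipZr conjc_real.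
have -> : ('i%C : R[i])^*%C = - 'i%C.
  by apply/eqP; rewrite eq_complex/= oppr0 !eqxx.
by rewrite mulNr mulrN opprK.
Qed.

Lemma norm_mulop_i_le (b : R) : `|b *: mulop 'i%C| <= `|b|.
Proof.
rewrite normrZ ler_piMr//; apply: norm_bop_le => // v.
by rewrite (_ : mulop _ v = 'i%C *: v)// hnormZ normc_def/= expr0n add0r expr1n sqrtr1 mul1r.
Qed.

Lemma skewB (A B : bop V V) : skew A -> skew B -> skew (A - B).
Proof. by move=> As Bs u v; rewrite bopNE !bopBE ipBl opprB ipBr As Bs !bopNE !ipNr; ring. Qed.

(** [J] commutes with every operator, so exp(2 (A - J)) w = exp(-2 J) exp(2 K) w = w. The two norm
    hypotheses give |A - J| < pi, the strict one providing the room, and the fixed-vector lemma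
    yields A w = J w = K w. *)
Lemma expop_skew_eigen (A K : bop V V) (b : R) w : hcomplete V ->
  skew A -> `|A| <= pi / 2 -> `|b| < pi / 2 ->
  expop (2 *: A) = expop (2 *: K) -> K w = (b *: mulop 'i%C) w -> A w = K w.
Proof.
move=> cV As A2 b2 AK Kw; set J := b *: mulop 'i%C in Kw *.
have comm (B : bop V V) : B * J = J * B.
  by rewrite /J bop_scalerAr bop_scalerAl mulopC.
have Js : skew J by exact: skew_mulop_i.
suff : (A - J) w = 0 by rewrite bopBE Kw => /eqP; rewrite subr_eq0 => /eqP.
apply: (@expop_skew_fix _ _ cV (A - J) 1).
- exact: skewB.
- by [].
- rewrite mul1r (le_lt_trans (ler_normB _ _))//.
  by have := norm_mulop_i_le b; rewrite -/J; lra.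
rewrite (_ : 1 + 1 = 2)// addrC expop_add//; last by rewrite mulNr mulrN comm.
have -> : expop (2 *: - J) = expop (- 2 *: J) by rewrite scalerN scaleNr.
rewrite bopME AK.
have -> : expop (2 *: K) w = expop (2 *: J) w.
  exact: (@expop_apply _ _ cV K J w 2 (comm K) Kw).
exact: (congr1 (fun F : bop V V => F w) (expopNK cV J 2)).
Qed.

End ScalarOperators.

(** * The rotation group and its geodesic for angles with unattained supremum pi/2 *)

Section Rotations.
Context {R : realType} {V : innerSpaceType R} (e : int -> V) (theta : int -> R).
Context (cV : hcomplete V).
Context (eB : orthonormal_basis e).
Context (thetaP : forall n, `|theta n| < pi / 2).
Context (theta_sup : forall d : R, 0 < d -> exists n, pi / 2 - d < theta n).
Notation VV := (V * V)%type.
Let cVV : hcomplete VV := hcomplete_pair cV.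
Let eP := eB.1.

Lemma theta_bounded : bounded_by theta (pi / 2).
Proof. by move=> n; rewrite ltW. Qed.

Lemma cos_bounded (f : int -> R) : bounded_by (fun n => cos (f n)) 1.
Proof. by move=> n; exact: cos_max. Qed.

Lemma sin_bounded (f : int -> R) : bounded_by (fun n => sin (f n)) 1.
Proof. by move=> n; exact: sin_max. Qed.

Local Notation D := (diag e).

Definition rot_gen : bop VV VV := bblock 0 (- D theta) (D theta) 0.
Definition rot_tangent : bop VV VV := bblock 0 (D theta) (D theta) 0.
Definition rot_cos t := D (fun n => cos (t * theta n)).
Definition rot_sin t := D (fun n => sin (t * theta n)).
Definition rot t : bop VV VV := bblock (rot_cos t) (- rot_sin t) (rot_sin t) (rot_cos t).

Local Notation p0 := (std_proj V).

Lemma rot_tangentP : tangent p0 rot_tangent.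
Proof.
split.
  move=> [x1 x2] [y1 y2]; rewrite /rot_tangent !bblockE !ip_pair/= !add0r !addr0.
  have sa := selfadjoint_diag cV eB theta_bounded.
  by rewrite addrC sa sa.
rewrite /rot_tangent std_projE !bblockM !(mul0r, mulr0, mul1r, mulr1, addr0, add0r).
by apply: bopP => -[x1 x2]; rewrite bopDE !bblockE; congr pair; rewrite /= ?addr0 ?add0r.
Qed.

Lemma rot_genE : rot_tangent * p0 - p0 * rot_tangent = rot_gen.
Proof.
rewrite /rot_tangent std_projE !bblockM !(mul0r, mulr0, mul1r, mulr1, addr0, add0r).
by rewrite bblockB !subr0 !sub0r.
Qed.

Lemma rot_gen_skew : skew rot_gen.
Proof. by rewrite -rot_genE; apply: tangent_skew; [exact: is_proj_std|exact: rot_tangentP]. Qed.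

Lemma norm_rot_tangent : `|rot_tangent| = pi / 2.
Proof.
have pi0 := pi_gt0 R.
apply/eqP; rewrite eq_le; apply/andP; split.
  apply: norm_bop_le => [|[x1 x2]]; first lra.
  rewrite -(@ler_pXn2r _ 2)// ?nnegrE ?mulr_ge0 ?hnorm_ge0//; last lra.
  rewrite exprMn !sqr_hnorm_pair /rot_tangent bblockE/= add0r addr0.
  rewrite mulrDr addrC -!exprMn lerD// lerXn2r// ?nnegrE ?mulr_ge0 ?hnorm_ge0//; do ?lra;
    exact: (hnorm_diag cV eB theta_bounded).
apply: le_eps => d d0; have [n nd] := theta_sup d0.
apply: (@le_trans _ _ (theta n + d)); first lra.
rewrite lerD2r (le_trans (ler_norm _))//.
have := hnorm_le_norm rot_tangent (e n, 0).
rewrite hnorm_pair0 hnorm_onb// mulr1; apply: le_trans.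
rewrite /rot_tangent bblockE bop_0v addr0 (diag_basis cV eB theta_bounded).
rewrite (le_trans _ (hnorm_snd _))//=.
by rewrite addr0 hnormZR hnorm_onb// mulr1.
Qed.

(** Quarter turn: its square is -1, so it acts as the imaginary unit in Euler's formula below. *)
Definition quarter : bop VV VV := bblock 0 (- 1) 1 0.

Lemma expop_quarter (s t : R) :
  expop (t *: (s *: quarter)) = cos (t * s) *: (1 : bop VV VV) + sin (t * s) *: quarter.
Proof.
have d (u : R) : is_derive u 1 (fun t => cos (t * s) *: (1 : bop VV VV) + sin (t * s) *: quarter)
    (s *: quarter * (cos (u * s) *: (1 : bop VV VV) + sin (u * s) *: quarter)).
  have dl : is_derive u 1 (fun t : R => t * s) s.
    have := is_deriveM (is_derive_id u 1) (is_derive_cst s u 1).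
    by rewrite scaler0 add0r /GRing.scale/= mulr1.
  have d1 : is_derive u 1 (fun t => cos (t * s)) (- sin (u * s) * s).
    exact: (@is_derive1_comp _ (@cos R) ( *%R^~ s)).
  have d2 : is_derive u 1 (fun t => sin (t * s)) (cos (u * s) * s).
    exact: (@is_derive1_comp _ (@sin R) ( *%R^~ s)).
  have := is_deriveD (is_derive_scale (1 : bop VV VV) d1) (is_derive_scale quarter d2).
  have -> // : s *: quarter * (cos (u * s) *: (1 : bop VV VV) + sin (u * s) *: quarter) =
    (- sin (u * s) * s) *: (1 : bop VV VV) + (cos (u * s) * s) *: quarter.
  rewrite mulrDr !bop_scalerAl !bop_scalerAr mulr1 !scalerA.
  have -> : quarter * quarter = - 1.
    rewrite /quarter bblockM !mulr0 !mul0r !addr0 !add0r mulr1 mul1r.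
    rewrite -bblock1; apply: bopP => -[x1 x2]; rewrite bopNE !bblockE.
    by congr pair; rewrite /= ?addr0 ?add0r.
  by rewrite scalerN -scaleNr addrC mulrC -mulNr [s * cos _]mulrC.
rewrite -[LHS]mulr1 [RHS](expop_unique cVV d); congr (_ * _).
by rewrite mul0r cos0 sin0 scale1r scale0r addr0.
Qed.

Lemma rot_gen_basis n :
  rot_gen (e n, 0) = (theta n *: quarter) (e n, 0) /\
  rot_gen (0, e n) = (theta n *: quarter) (0, e n).
Proof.
rewrite /rot_gen /quarter !bopZE !bblockE !bop_0v !bopNE !(diag_basis cV eB theta_bounded).
by split; congr pair; rewrite /= ?add0r ?addr0 ?oppr0 ?scaler0// scalerN.
Qed.

(** On (e_n, 0) and (0, e_n) the generator agrees with theta_n times the quarter turn, with which it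
    commutes, so Euler's formula applies on each such plane. *)
Lemma expop_rot t : expop (t *: rot_gen) = rot t.
Proof.
have comm s : rot_gen * (s *: quarter) = s *: quarter * rot_gen.
  rewrite bop_scalerAr bop_scalerAl; congr (_ *: _).
  rewrite /rot_gen /quarter !bblockM !mulr0 !mul0r !addr0 !add0r.
  by rewrite !mulr1 !mul1r mulrN mulNr mulr1 mul1r.
apply: (bop_pair_basis eB) => n; have [h1 h2] := rot_gen_basis n.
  rewrite (expop_apply cVV _ (comm _) h1) expop_quarter bopDE !bopZE /rot /quarter !bblockE.
  rewrite !bop_0v !(diag_basis cV eB (cos_bounded _)) !(diag_basis cV eB (sin_bounded _)).
  by rewrite !(bop0E, bop1E, addr0, add0r); congr pair; rewrite /= ?scaler0 ?addr0 ?add0r.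
rewrite (expop_apply cVV _ (comm _) h2) expop_quarter bopDE !bopZE /rot /quarter !bblockE.
rewrite !bop_0v !bopNE !(diag_basis cV eB (cos_bounded _)) !(diag_basis cV eB (sin_bounded _)).
by rewrite !(bop0E, bop1E, addr0, add0r); congr pair; rewrite /= ?scaler0 ?addr0 ?add0r ?scalerN.
Qed.

Definition gam t := orbit rot_gen p0 t.
Definition tandiag t := D (fun n => tan (t * theta n)).
(** Graph of the operator with eigenvalues tan theta_n. Coefficients are used because these
    eigenvalues are unbounded and [diag] would return its default; the domain is implicit in the
    existence of the second component. *)
Definition tangraph : set VV :=
  [set y | forall n, coef e y.2 n = (tan (theta n))%:C%C * coef e y.1 n].

Lemma scaled_theta_lt t n : 0 <= t <= 1 -> `|t * theta n| < pi / 2.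
Proof.
move=> /andP[t0 t1]; rewrite normrM ger0_norm//.
by rewrite (le_lt_trans _ (thetaP n))// ler_piMl.
Qed.

Lemma scaled_theta_le t n : 0 <= t -> `|t * theta n| <= t * (pi / 2).
Proof. by move=> t0; rewrite normrM ger0_norm// ler_wpM2l// theta_bounded. Qed.

Lemma cos_scaled_gt0 t n : 0 <= t <= 1 -> 0 < cos (t * theta n).
Proof. by move=> t01; rewrite cos_gt0_pihalf// -ltr_norml scaled_theta_lt. Qed.

Lemma cos_abs_le (a b : R) : `|a| <= b -> b <= pi -> cos b <= cos a.
Proof.
move=> ab bp; have -> : cos a = cos `|a| by case: (ger0P a) => // _; rewrite cosN.
have b0 : 0 <= b by rewrite (le_trans _ ab).
move: ab; rewrite le_eqVlt => /predU1P[->//|ab]; apply/ltW.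
by rewrite ltr_cos ?in_itv/= ?normr_ge0 ?b0//= (le_trans (ltW ab)).
Qed.

Lemma pihalf_lt (t : R) : t < 1 -> t * (pi / 2) < pi / 2.
Proof. by move=> t1; rewrite gtr_pMl// divr_gt0 ?pi_gt0. Qed.

Lemma cos_pihalf_gt0 (t : R) : 0 <= t < 1 -> 0 < cos (t * (pi / 2)).
Proof.
move=> /andP[t0 t1]; have pi0 := pi_gt0 R; rewrite cos_gt0_pihalf// pihalf_lt// andbT.
by rewrite (@lt_le_trans _ _ 0)// ?mulr_ge0// ?divr_ge0// ?ltW// oppr_lt0 divr_gt0.
Qed.

Lemma cos_scaled_ge t n : 0 <= t < 1 -> cos (t * (pi / 2)) <= cos (t * theta n).
Proof.
move=> /andP[t0 t1]; rewrite cos_abs_le// ?scaled_theta_le//.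
have := pihalf_lt t1; have := pi_gt0 R; lra.
Qed.

Lemma tan_abs_le (a b : R) : `|a| <= b -> b < pi / 2 -> `|tan a| <= tan b.
Proof.
move=> ab bp; have -> : `|tan a| = tan `|a|.
  have key (x : R) : 0 <= x < pi / 2 -> 0 <= tan x.
    move=> /andP[x0 x1]; have pi0 := pi_gt0 R; rewrite /tan divr_ge0 ?sin_ge0_pi//.
      by rewrite x0/=; lra.
    by rewrite cos_ge0_pihalf//; apply/andP; split; lra.
  have := le_lt_trans ab bp; case: (ger0P a) => a0 a1; first by rewrite ger0_norm// key// a0.
  by rewrite -normrN -tanN ger0_norm// key// a1 oppr_ge0 ltW.
move: ab; rewrite le_eqVlt => /predU1P[->//|ab]; apply/ltW.
have b0 : 0 <= b by rewrite (le_trans _ (ltW ab)).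
have pi0 := pi_gt0 R; have a0 := normr_ge0 a.
by rewrite ltr_tan// in_itv/=; apply/andP; split; lra.
Qed.

Lemma tan_bounded t : 0 <= t < 1 -> bounded_by (fun n => tan (t * theta n)) (tan (t * (pi / 2))).
Proof.
by move=> /andP[t0 t1] n; rewrite tan_abs_le ?scaled_theta_le// pihalf_lt.
Qed.

Lemma secant_bounded t : 0 <= t < 1 ->
  bounded_by (fun n => (cos (t * theta n))^-1) (cos (t * (pi / 2)))^-1.
Proof.
move=> t01 n; have c0 := cos_pihalf_gt0 t01; have c1 := cos_scaled_ge n t01.
by rewrite normfV gtr0_norm ?lef_pV2 ?posrE// (lt_le_trans c0).
Qed.

Lemma gam_proj t : is_proj (gam t).
Proof. by apply: is_proj_orbit => //; [exact: rot_gen_skew|exact: is_proj_std]. Qed.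

Lemma gam0 : gam 0 = p0.
Proof. exact: orbit0. Qed.

Lemma range_gam t : range (gam t) = [set (rot_cos t u, rot_sin t u) | u in setT].
Proof.
apply/seteqP; split => [_ [x _ <-]|_ [u _ <-]].
  rewrite /gam /orbit !bopME expop_rot; set y := expop _ _.
  exists (y.1) => //; rewrite /rot [y]surjective_pairing bblockE.
  by rewrite !bop_0v !addr0.
exists (rot t (u, 0)) => //.
rewrite /gam /orbit !bopME !expop_rot -[rot (- t) _]bopME -!expop_rot expopNK// bop1E.
rewrite expop_rot /rot.
by rewrite (_ : p0 (u, 0) = (u, 0))// bblockE !bop_0v !addr0.
Qed.

Lemma rot_cosK t : 0 <= t < 1 -> rot_cos t * D (fun n => (cos (t * theta n))^-1) = 1.
Proof.
move=> t01; have t01' : 0 <= t <= 1 by case/andP: t01 => -> /ltW.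
rewrite /rot_cos (diagM cV eB (cos_bounded _) (secant_bounded t01)) -(diag1 cV eB).
by congr diag; apply/funext => n; rewrite divff// gt_eqF// cos_scaled_gt0.
Qed.

Lemma rot_secK t : 0 <= t < 1 -> D (fun n => (cos (t * theta n))^-1) * rot_cos t = 1.
Proof.
move=> t01; rewrite -(rot_cosK t01) /rot_cos.
rewrite (diagM cV eB (cos_bounded _) (secant_bounded t01)).
rewrite (diagM cV eB (secant_bounded t01) (cos_bounded _)).
by congr diag; apply/funext => n; rewrite mulrC.
Qed.

Lemma tandiag_cos t : 0 <= t < 1 -> tandiag t * rot_cos t = rot_sin t.
Proof.
move=> t01; have t01' : 0 <= t <= 1 by case/andP: t01 => -> /ltW.
rewrite /tandiag /rot_cos (diagM cV eB (tan_bounded t01) (cos_bounded _)).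
by congr diag; apply/funext => n; rewrite /tan divfK// gt_eqF// cos_scaled_gt0.
Qed.

Lemma range_gam_graph t : 0 <= t < 1 -> range (gam t) = graph (tandiag t).
Proof.
move=> t01; rewrite range_gam; apply/seteqP; split => [_ [u _ <-]|_ [v _ <-]].
  by exists (rot_cos t u) => //; rewrite -bopME tandiag_cos.
exists (D (fun n => (cos (t * theta n))^-1) v) => //.
by rewrite -(tandiag_cos t01) bopME -!(bopME (rot_cos t)) rot_cosK.
Qed.

Lemma proj_onto_graph t : 0 <= t < 1 -> proj_onto (graph (tandiag t)) = gam t.
Proof. by move=> t01; apply: proj_onto_eq; [exact: gam_proj|exact: range_gam_graph]. Qed.

Lemma tandiag0 : tandiag 0 = 0.
Proof.
rewrite -(diag0 cV eB); congr diag; apply/funext => n.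
by rewrite mul0r tan0.
Qed.

Lemma coef_rot_cos t u n : coef e (rot_cos t u) n = (cos (t * theta n))%:C%C * coef e u n.
Proof. exact: (diag_coef cV eB (cos_bounded _)). Qed.

Lemma coef_rot_sin t u n : coef e (rot_sin t u) n = (sin (t * theta n))%:C%C * coef e u n.
Proof. exact: (diag_coef cV eB (sin_bounded _)). Qed.

(** The cosines now have infimum 0, so no bounded secant is available as for t < 1. A point of the
    graph is pulled back by the inverse rotation, whose first component is the witness. *)
Lemma range_gam1 : range (gam 1) = tangraph.
Proof.
have one : 0 <= (1 : R) <= 1 by rewrite ler01 lexx.
rewrite range_gam; apply/seteqP; split => [_ [u _ <-] n|[y1 y2] /= yP].
  rewrite /= coef_rot_cos coef_rot_sin !mul1r mulrA -rmorphM /tan divfK//.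
  by have := cos_scaled_gt0 n one; rewrite mul1r => /gt_eqF ->.
exists (rot_cos 1 y1 + rot_sin 1 y2) => //.
have E n : (cos (theta n))%:C%C != 0 :> R[i].
  by rewrite eq_complex/= eqxx andbT; have := cos_scaled_gt0 n one; rewrite mul1r => /gt_eqF ->.
have F n : (sin (theta n))%:C%C ^+ 2 = 1 - (cos (theta n))%:C%C ^+ 2 :> R[i].
  by rewrite -!rmorphXn/= sin2cos2 rmorphB rmorph1.
have T n : (tan (theta n))%:C%C = (sin (theta n))%:C%C / (cos (theta n))%:C%C :> R[i].
  by rewrite -fmorphV -rmorphM.
have {}yP n : coef e y2 n = (tan (theta n))%:C%C * coef e y1 n := yP n.
congr pair; apply: (coef_inj eB) => n; rewrite !(coef_rot_cos, coef_rot_sin, coefD) yP T !mul1r.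
  have := F n; have := E n.
  move: ((cos (theta n))%:C%C : R[i]) ((sin (theta n))%:C%C : R[i]) (coef _ _ _) => c s y c0 sE.
  have -> : c * (c * y + s * (s / c * y)) = (c ^+ 2 + s ^+ 2) * y by field.
  by rewrite sE addrC subrK mul1r.
have := F n; have := E n.
move: ((cos (theta n))%:C%C : R[i]) ((sin (theta n))%:C%C : R[i]) (coef _ _ _) => c s y c0 sE.
have -> : s * (c * y + s * (s / c * y)) = (c ^+ 2 + s ^+ 2) * (s / c * y) by field.
by rewrite sE addrC subrK mul1r.
Qed.

Lemma proj_onto_tangraph : proj_onto tangraph = gam 1.
Proof. by apply: proj_onto_eq; [exact: gam_proj|exact: range_gam1]. Qed.

Lemma proj_onto_graph0 : proj_onto (graph (0 : bop V V)) = p0.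
Proof. by rewrite -gam0 -proj_onto_graph ?tandiag0// lexx ltr01. Qed.

Lemma orbit_bracket (A X : bop VV VV) t :
  A * orbit A X t - orbit A X t * A = orbit A (A * X - X * A) t.
Proof.
have c1 : A * expop (t *: A) = expop (t *: A) * A.
  by rewrite (@expop_comm _ _ cVV (t *: A) A)// bop_scalerAl bop_scalerAr.
have c2 : A * expop (- t *: A) = expop (- t *: A) * A.
  by rewrite (@expop_comm _ _ cVV (- t *: A) A)// bop_scalerAl bop_scalerAr.
by rewrite /orbit mulrBr mulrBl !mulrA c1 -!mulrA c2.
Qed.

Lemma norm_gam_velocity t : `|rot_gen * gam t - gam t * rot_gen| = pi / 2.
Proof.
rewrite /gam orbit_bracket norm_orbit//; last exact: rot_gen_skew.
rewrite -{1 2}rot_genE (tangent_comm (is_proj_std V) rot_tangentP).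
exact: norm_rot_tangent.
Qed.

Lemma orbit_scale (A X : bop VV VV) (a t : R) : orbit (a *: A) X t = orbit A X (t * a).
Proof. by rewrite /orbit !scalerA mulNr. Qed.

Lemma gam_velocity (t : R) : is_derive t 1 gam (rot_gen * gam t - gam t * rot_gen).
Proof. by rewrite /gam orbit_bracket; exact: is_derive_orbit. Qed.

Lemma curve_length_gam (a b : R) : a <= b -> curve_length a b gam = ((b - a) * (pi / 2))%:E.
Proof.
move=> ab; apply: curve_length_cst => // t _.
by rewrite (derive_val1 (gam_velocity t)) norm_gam_velocity.
Qed.

Lemma hnorm_rot t x : hnorm (rot t x) = hnorm x.
Proof. by rewrite -expop_rot hnorm_expop//; exact: rot_gen_skew. Qed.

(** [rot t (e n, 0)] lies in the range of [gam t], in the plane of (e_n, 0) and (0, e_n), where the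
    flow is a rotation of speed theta_n; its angle to the range of [gam s] is thus (s - t) theta_n,
    up to sign. *)
Lemma Re_ip_gam s t n : complex.Re (ip (gam s (rot t (e n, 0))) (rot t (e n, 0))) =
  cos ((s - t) * theta n) ^+ 2.
Proof.
rewrite -sqr_hnorm_proj; last exact: gam_proj.
have -> : gam s (rot t (e n, 0)) = rot s (p0 (rot (t - s) (e n, 0))).
  by rewrite /gam /orbit -!expop_rot !bopME -[expop (- s *: _) _]bopME -expopD// [- s + t]addrC.
rewrite hnorm_rot {1}/rot bblockE !bop_0v !addr0.
rewrite (_ : p0 (_, _) = (rot_cos (t - s) (e n), 0))// hnorm_pair0.
rewrite /rot_cos (diag_basis cV eB (cos_bounded _)) hnormZR hnorm_onb// mulr1.
rewrite real_normK ?num_real//.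
by rewrite -[s - t]opprB mulNr cosN.
Qed.

(** The remaining arc, rescaled to unit time, gives the upper bound. From below, the vectors
    [rot t0 (e n, 0)] give (1 - t0) theta_n; the supremum is not attained, hence the passage through
    all smaller [r]. *)
Lemma dist_gam (t0 : R) : 0 <= t0 < 1 -> dist (gam t0) (gam 1) = ((1 - t0) * (pi / 2))%:E.
Proof.
move=> /andP[t00 t01]; have pi0 := pi_gt0 R; apply/eqP; rewrite eq_le; apply/andP; split.
  apply: ereal_inf_lbound.
  have Ks : skew ((1 - t0) *: rot_gen).
    move=> x y; rewrite -scalerN !bopZE ipZl ipZr conjc_real; congr (_ * _).
    exact: rot_gen_skew.
  exists (orbit ((1 - t0) *: rot_gen) (gam t0)).
    split.
    - by apply: piecewise_C1_on; [exact: ltr01|exact: C1_on_orbit].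
    - exact: orbit0.
    - by rewrite orbit_scale mul1r /gam orbit_orbit// subrK.
    - by move=> t _; apply: is_proj_orbit => //; exact: gam_proj.
  have /curve_length_cst -> // : forall t, t \in `]0, 1[ ->
      `|derive1 (orbit ((1 - t0) *: rot_gen) (gam t0)) t| = (1 - t0) * (pi / 2).
    move=> t _; rewrite (derive_val1 (is_derive_orbit _ _ _ _))// norm_orbit//.
    rewrite bop_scalerAl bop_scalerAr -scalerBr normrZ norm_gam_velocity ger0_norm//.
    by rewrite subr_ge0 ltW.
  by rewrite subr0 mul1r.
have key n : 0 < theta n -> (((1 - t0) * theta n)%:E <= dist (gam t0) (gam 1))%E.
  move=> tn; have := thetaP n; rewrite gtr0_norm// => tn2.
  apply: (@dist_ge_angle _ _ _ _ (rot t0 (e n, 0))).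
  - apply/andP; split; first by rewrite mulr_gt0// subr_gt0.
    by rewrite (le_lt_trans _ tn2)// ler_piMl ?(ltW tn)//; lra.
  - by rewrite hnorm_rot hnorm_pair0 hnorm_onb.
  - by rewrite /gam /orbit -!expop_rot !bopME -[expop (- t0 *: _) _]bopME expopNK// bop1E.
  - exact: Re_ip_gam.
have fin (r : R) : 0 < r -> r < (1 - t0) * (pi / 2) -> (r%:E <= dist (gam t0) (gam 1))%E.
  move=> r0 rp; have c0 : 0 < 1 - t0 by rewrite subr_gt0.
  have [|n nr] := @theta_sup (pi / 2 - r / (1 - t0)).
    by rewrite subr_gt0 ltr_pdivrMr// mulrC.
  move: nr; rewrite subKr => nr.
  have tn : 0 < theta n by rewrite (lt_trans _ nr)// divr_gt0.
  apply: le_trans (key _ tn); rewrite lee_fin mulrC -ler_pdivrMr//.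
  exact: ltW.
have c0 : 0 < (1 - t0) * (pi / 2) by rewrite mulr_gt0 ?subr_gt0// divr_gt0.
case: (dist _ _) fin => [d| |] fin.
- rewrite lee_fin leNgt; apply/negP => dl.
  (* The maximum exceeds [d], and its second entry keeps it positive, as [fin] demands, even if [d]
     is negative. *)
  have := fin (Order.max ((d + (1 - t0) * (pi / 2)) / 2) ((1 - t0) * (pi / 2) / 2)).
  rewrite lee_fin; rewrite lt_max gt_max ge_max => /(_ _ _)/andP[].
  + by apply/orP; right; lra.
  + by apply/andP; split; lra.
  + by lra.
- by rewrite leey.
- have : (((1 - t0) * (pi / 2) / 2)%:E <= -oo :> \bar R)%E by apply: fin; lra.
  by rewrite leeNy_eq.
Qed.

Lemma gam_minimal : minimal_geodesic p0 (gam 1) gam.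
Proof.
split; [|exact: gam0|by []|].
  split; first exact: is_proj_std.
  by exists rot_tangent; [exact: rot_tangentP|move=> t _; rewrite rot_genE].
have h0 : 0 <= (0:R) < 1 by rewrite lexx ltr01.
have := dist_gam h0; rewrite gam0 => ->.
by rewrite curve_length_gam// ler01.
Qed.

Lemma tan_theta_unbounded (M : R) : exists n, M < tan (theta n).
Proof.
have h := atan_ltpi2 M; have h' := atan_gtNpi2 M.
have [|n] := @theta_sup (pi / 2 - atan M); first by rewrite subr_gt0.
rewrite subKr => nM; exists n; rewrite -[X in X < _](atanK M) ltr_tan ?in_itv/= ?h ?h'//.
by have := thetaP n; rewrite ltr_norml.
Qed.

Lemma tangraph_basis n : tangraph (e n, (tan (theta n))%:C%C *: e n).
Proof. by move=> m /=; rewrite coefZ coef_basis//; case: eqVneq => [->//|]; rewrite !mulr0. Qed.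

Lemma tangraph_unbounded : unbounded tangraph.
Proof.
move=> [M h]; have [n nM] := tan_theta_unbounded M.
have := h _ (tangraph_basis n); rewrite /= hnormZR hnorm_onb// !mulr1 => h1.
by have := lt_le_trans nM (le_trans (ler_norm _) h1); rewrite ltxx.
Qed.

Lemma tangraph_operator : operator_graph tangraph.
Proof.
split.
- by move=> n /=; rewrite /coef !ip0l mulr0.
- move=> a x y xG yG n; rewrite /= !coefD !coefZ xG yG mulrDr; congr (_ + _).
  by rewrite mulrCA.
- move=> v vG; apply: (coef_total eB) => n; rewrite (vG n)/=.
  by rewrite /coef ip0l mulr0.
Qed.

Lemma tangraph_rot u : tangraph (rot_cos 1 u, rot_sin 1 u).
Proof. by rewrite -range_gam1 range_gam; exists u. Qed.

Lemma tangraph_rotP y : tangraph y -> exists u, y = (rot_cos 1 u, rot_sin 1 u).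
Proof. by rewrite -range_gam1 range_gam => -[u _ <-]; exists u. Qed.

(** A finite combination of the basis can be divided coefficientwise by cos theta_n, which exhibits
    it in the image of [rot_cos 1], the domain of the graph. *)
Lemma tangraph_dense : densely_defined tangraph.
Proof.
apply/seteqP; split => // v _ d d0.
have : [set: V] v by []; rewrite -eB.2 => /(_ _ d0)[_ [s _ [c _ <-]] h].
exists (\sum_(n <- s) c n *: e n) => //.
pose u := \sum_(n <- s) ((cos (theta n))^-1%:C%C * c n) *: e n.
exists (rot_cos 1 u, rot_sin 1 u); first exact: tangraph_rot.
have one : 0 <= (1 : R) <= 1 by rewrite ler01 lexx.
rewrite /u bop_sum; apply: eq_bigr => n _.
rewrite bop_scale /rot_cos (diag_basis cV eB (cos_bounded _)) scalerA mul1r.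
rewrite mulrAC -rmorphM mulVf ?mul1r//.
by have := cos_scaled_gt0 n one; rewrite mul1r => /gt_eqF ->.
Qed.

(** The graph is the range of [gam 1]. For [s] in it, y - gam 1 y is the complementary projection of
    y - s, hence no longer than y - s. *)
Lemma tangraph_closed : hclosure tangraph `<=` tangraph.
Proof.
move=> y yc; have pP := gam_proj 1.
suff -> : y = gam 1 y by rewrite -range_gam1; exists y.
apply/eqP; rewrite -subr_eq0; apply/eqP/hnorm_eq0/eqP.
rewrite eq_le hnorm_ge0 andbT; apply: le_eps => d d0; rewrite add0r.
have [s + sd] := yc _ d0; rewrite -range_gam1 => -[z _ zs].
have ps : gam 1 s = s by rewrite -zs proj_idem.
have -> : y - gam 1 y = (y - s) - gam 1 (y - s).
  by rewrite bop_subv ps opprB addrA subrK.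
apply: le_trans (ltW sd).
rewrite -(@ler_pXn2r _ 2)// ?nnegrE ?hnorm_ge0// sqr_hnorm_subproj//.
by rewrite gerBl -sqr_hnorm_proj// sqr_ge0.
Qed.

(** Testing an adjoint pair against (e_n, tan theta_n e_n) yields its coefficients. Conversely,
    points of the graph are pairs (cos Theta u, sin Theta u), and these diagonal operators are
    self-adjoint and commute. *)
Lemma tangraph_adjoint : adjoint_graph tangraph = tangraph.
Proof.
have Cs : selfadjoint (rot_cos 1) by exact: selfadjoint_diag (cos_bounded _).
have Ss : selfadjoint (rot_sin 1) by exact: selfadjoint_diag (sin_bounded _).
apply/seteqP; split => [y yG n|y yG x xG].
  have := yG _ (tangraph_basis n); rewrite /= ipZl => h.
  rewrite /coef ipC -h rmorphM/= -ipC; congr (_ * _).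
  by rewrite oppr0.
have [u ->] := tangraph_rotP xG; have [w ->] := tangraph_rotP yG.
rewrite /= -Cs -Ss -!bopME /rot_cos /rot_sin.
rewrite (diagM cV eB (cos_bounded _) (sin_bounded _)).
rewrite (diagM cV eB (sin_bounded _) (cos_bounded _)).
by congr (ip (diag _ _ _) _); apply/funext => n; rewrite mulrC.
Qed.

(** The supremum of the eigenvalues is only approached: an angle above [x] gives the lower bound tan
    (x t), and [x] tends to pi/2 from the left. *)
Lemma norm_tandiag t : 0 <= t < 1 -> `|tandiag t| = tan (t * (pi / 2)).
Proof.
move=> t01; have /andP[t0 t1] := t01; have pi0 := pi_gt0 R.
apply/eqP; rewrite eq_le (norm_diag cV eB (tan_bounded t01))/=.
have tp := pihalf_lt t1.
have tp0 : 0 <= t * (pi / 2) by rewrite mulr_ge0// divr_ge0// ltW.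
have c0 : cos (t * (pi / 2)) != 0 by rewrite gt_eqF// cos_pihalf_gt0.
have tanc : tan (x * t) @[x --> (pi / 2)^'-] --> tan (t * (pi / 2)).
  apply: (@cvg_at_left_filter _ _ (fun x => tan (x * t))).
  have h : x * t @[x --> pi / 2] --> t * (pi / 2).
    by rewrite [X in _ --> X]mulrC; apply: cvgM; [exact: cvg_id|exact: cvg_cst].
  exact: (cvg_comp _ _ h (continuous_tan c0)).
apply: (cvgr_to_le tanc); near=> x.
have xp : x < pi / 2 by near: x; exact: nbhs_left_lt.
have x0 : 0 < x by near: x; apply: nbhs_left_gt; rewrite divr_gt0.
have [|n] := @theta_sup (pi / 2 - x); first by rewrite subr_gt0.
rewrite subKr => nx.
apply: le_trans (norm_diag_ge cV eB n (tan_bounded t01)).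
apply: le_trans (ler_norm _).
have := scaled_theta_lt n (_ : 0 <= t <= 1); rewrite t0 ltW// => /(_ isT).
rewrite ltr_norml => h.
move: t0; rewrite le_eqVlt => /predU1P[<-|t0]; first by rewrite mulr0 mul0r.
rewrite ltW// ltr_tan ?in_itv//=.
  by rewrite mulrC ltr_pM2l.
apply/andP; split.
  by rewrite (@lt_le_trans _ _ 0)// ?mulr_ge0 ?ltW//; lra.
by rewrite (lt_trans _ xp)// gtr_pMr.
Unshelve. all: by end_near. Qed.

Lemma sin_abs_le (x : R) : `|sin x| <= `|x|.
Proof.
wlog x0 : x / 0 <= x.
  move=> h; case: (leP 0 x) => [|x0]; first exact: h.
  by have := h (- x); rewrite sinN !normrN; apply; rewrite oppr_ge0 ltW.
move: x0; rewrite le_eqVlt => /predU1P[<-|x0]; first by rewrite sin0.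
have [//|c _] := @MVT _ (@sin R) (@cos R) 0 x x0 (fun y _ => is_derive_sin y).
  by apply: continuous_subspaceT => y; exact: continuous_sin.
rewrite sin0 !subr0 => ->; rewrite normrM ler_piMl//; exact: cos_max.
Qed.

Lemma tanB_le (a b c : R) : 0 < c -> c <= cos a -> c <= cos b ->
  `|tan a - tan b| <= `|a - b| / c ^+ 2.
Proof.
move=> c0 ca cb; have a0 := lt_le_trans c0 ca; have b0 := lt_le_trans c0 cb.
have -> : tan a - tan b = sin (a - b) / (cos a * cos b).
  by rewrite /tan sinB; field; rewrite !gt_eqF.
rewrite normrM normfV (gtr0_norm (mulr_gt0 a0 b0)).
rewrite ler_pM ?invr_ge0 ?mulr_ge0 ?(ltW a0) ?(ltW b0) ?sin_abs_le//.
by rewrite lef_pV2 ?posrE ?mulr_gt0 ?exprn_gt0// expr2 ler_pM// ltW.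
Qed.

Lemma tandiagB_le s t r : 0 <= s <= r -> 0 <= t <= r -> r < 1 ->
  `|tandiag t - tandiag s| <= `|t - s| * (pi / 2) / cos (r * (pi / 2)) ^+ 2.
Proof.
move=> /andP[s0 sr] /andP[t0 tr] r1.
have s01 : 0 <= s < 1 by rewrite s0 (le_lt_trans sr).
have t01 : 0 <= t < 1 by rewrite t0 (le_lt_trans tr).
have r01 : 0 <= r < 1 by rewrite r1 (le_trans s0).
have r0 := cos_pihalf_gt0 r01; have pi0 := pi_gt0 R.
have cle x n : 0 <= x <= r -> cos (r * (pi / 2)) <= cos (x * theta n).
  move=> /andP[x0 xr]; rewrite cos_abs_le ?(le_trans (scaled_theta_le _ x0))//.
    by rewrite ler_wpM2r// divr_ge0// ltW.
  by have := pihalf_lt r1; lra.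
have -> : tandiag t - tandiag s = diag e (fun n => tan (t * theta n) - tan (s * theta n)).
  have bN : bounded_by (fun n => -1 * tan (s * theta n)) (tan (s * (pi / 2))).
    by move=> n; rewrite mulN1r normrN; exact: tan_bounded.
  rewrite -scaleN1r /tandiag (diagZ cV eB _ (tan_bounded s01)).
  rewrite (diagD cV eB (tan_bounded t01) bN).
  by congr diag; apply/funext => n; rewrite mulN1r.
apply: (norm_diag cV eB) => n.
rewrite (le_trans (tanB_le r0 (cle _ n _) (cle _ n _)))// ?t0 ?s0//.
rewrite ler_wpM2r ?invr_ge0 ?sqr_ge0// -mulrBl normrM ler_wpM2l//.
exact: theta_bounded.
Qed.

Lemma tandiag_continuous : {within `[0, 1[, continuous tandiag}.
Proof.
apply/continuous_withinP => t /=; rewrite in_itv/= => /andP[t0 t1].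
(* On [0, r] every cosine is at least cos (r pi/2) > 0, which makes the family Lipschitz there;
   halfway to 1 leaves room on the right of [t]. *)
pose r := (t + 1) / 2; pose K := (pi / 2) / cos (r * (pi / 2)) ^+ 2.
have tr : t < r by rewrite /r; lra.
apply/subr_cvg0/norm_cvg0P.
have h : `|s - t| * K @[s --> within `[0, 1[%classic (nbhs t)] --> (0 : R).
  rewrite -[X in _ --> X](mul0r K); apply: cvgM; last exact: cvg_cst.
  by apply/norm_cvg0P/subr_cvg0; apply: cvg_within_filter; exact: cvg_id.
apply: (squeeze_cvgr _ (cvg_cst 0) h); rewrite near_withinE; near=> s => /=.
rewrite in_itv/= => /andP[s0 s1]; rewrite normr_ge0/= mulrA.
apply: tandiagB_le; rewrite ?t0 ?s0 ?ltW//=; last by rewrite /r; lra.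
by near: s; exact: lt_nbhsl.
Unshelve. all: by end_near. Qed.

Lemma tan_pihalf_cvg0 : tan (t * (pi / 2)) @[t --> (0:R)^'+] --> (0 : R).
Proof.
rewrite -[X in _ --> X]tan0 -[X in tan X](mul0r (pi / 2)).
apply: (@cvg_at_right_filter _ _ (fun t => tan (t * (pi / 2)))).
have h : t * (pi / 2) @[t --> (0 : R)] --> 0 * (pi / 2).
  by apply: cvgM; [exact: cvg_id|exact: cvg_cst].
have c0 : cos (0 * (pi / 2) : R) != 0 by rewrite mul0r cos0 oner_neq0.
exact: (cvg_comp _ _ h (continuous_tan c0)).
Qed.

Lemma tan_pihalf_cvgy : tan (t * (pi / 2)) @[t --> (1:R)^'-] --> +oo.
Proof.
apply/cvgryPge => A; have pi0 := pi_gt0 R; near=> t.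
have t1 : t < 1 by near: t; exact: nbhs_left_lt.
have t0 : 0 < t by near: t; apply: nbhs_left_gt; exact: ltr01.
have At : atan A / (pi / 2) < t.
  by near: t; apply: nbhs_left_gt; rewrite ltr_pdivrMr ?divr_gt0// mul1r atan_ltpi2.
rewrite -[leLHS](atanK A) ltW// ltr_tan ?in_itv/= ?atan_gtNpi2 ?atan_ltpi2//.
  by rewrite -ltr_pdivrMr// divr_gt0.
by rewrite pihalf_lt// andbT (@lt_le_trans _ _ 0) ?mulr_ge0// ?ltW//; lra.
Unshelve. all: by end_near. Qed.

Lemma expop_rot_unique (A : bop VV VV) : skew A -> `|A| <= pi / 2 ->
  expop (2 *: A) = expop (2 *: rot_gen) -> A = rot_gen.
Proof.
move=> As A2 AK.
have E1 n : A (e n, - 'i%C *: e n) = rot_gen (e n, - 'i%C *: e n).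
  apply: (expop_skew_eigen cVV As A2 (thetaP n) AK).
  rewrite /rot_gen bblockE bopZE bopNE !(bop_scale, bop0E) (diag_basis cV eB theta_bounded).
  rewrite add0r addr0 /=; congr pair; rewrite /= !scalerA -?scaleNr; congr (_ *: _).
    by rewrite mulNr opprK mulrC.
  by rewrite mulrN -mulrA -expr2 sqr_i mulrN1 opprK.
have E2 n : A (e n, 'i%C *: e n) = rot_gen (e n, 'i%C *: e n).
  apply: (@expop_skew_eigen _ _ A rot_gen (- theta n) _ cVV As A2 _ AK).
    by rewrite normrN.
  rewrite /rot_gen bblockE bopZE bopNE !(bop_scale, bop0E) (diag_basis cV eB theta_bounded).
  rewrite add0r addr0 /= rmorphN; congr pair; rewrite /= !scalerA -?scaleNr; congr (_ *: _).
    by rewrite mulrC mulNr.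
  by rewrite -mulrA -expr2 sqr_i mulrN1 opprK.
have two : (2%:R : R[i]) != 0 by rewrite pnatr_eq0.
have twoi : (2%:R * 'i%C : R[i]) != 0.
  by rewrite mulf_neq0// eq_complex/= oner_eq0 andbF.
apply: (bop_pair_basis eB) => n.
  have -> : (e n, 0) = 2%:R^-1 *: ((e n, - 'i%C *: e n) + (e n, 'i%C *: e n)) :> VV.
    congr pair; rewrite /=.
      by rewrite -[X in _ *: (X + X)]scale1r -scalerDl scalerA -mulr2n mulVf// scale1r.
    by rewrite scaleNr addNr scaler0.
  by rewrite !bop_scale !bop_addv E1 E2.
have -> : (0, e n) = (2%:R * 'i%C)^-1 *: ((e n, 'i%C *: e n) - (e n, - 'i%C *: e n)) :> VV.
  congr pair; rewrite /=; first by rewrite subrr scaler0.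
  have -> : 'i%C *: e n - - 'i%C *: e n = (2%:R * 'i%C) *: e n.
    by rewrite scaleNr opprK -scalerDl -mulr2n mulr_natl.
  by rewrite scalerA mulVf// scale1r.
by rewrite !bop_scale !bop_subv E1 E2.
Qed.

(** With s = 2 p - 1 one has A s = - s A, so exp(A) s exp(-A) s = exp(A) s s exp(A) = exp(2 A),
    since s s = 1. The right-hand side involves only the two endpoints of the geodesic. *)
Lemma geodesic_reflection (p X : bop VV VV) : is_proj p -> tangent p X ->
  let A := X * p - p * X in
  expop (2 *: A) = (orbit A p 1 + orbit A p 1 - 1) * (p + p - 1).
Proof.
move=> pP Xt A; have As : skew A by exact: tangent_skew.
have ss : (p + p - 1) * (p + p - 1) = 1.
  have pp := pP.2; rewrite mulrBr mulr1 mulrDr mulrBl mul1r mulrDl pp.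
  by rewrite !addrK opprB addrC subrK.
have -> : orbit A p 1 + orbit A p 1 - 1 = orbit A (p + p - 1) 1.
  by rewrite /orbit mulrBr mulr1 mulrDr mulrBl mulrDl expopKN.
rewrite /orbit -mulrA.
have -> : expop (- 1 *: A) * (p + p - 1) = (p + p - 1) * expop (1 *: A).
  apply: expop_intertwine => //; rewrite scaleN1r scale1r mulNr.
  by rewrite (tangent_anticomm pP Xt) opprK.
by rewrite mulrA -(mulrA _ (p + p - 1) (p + p - 1)) ss mulr1 -(expopD cVV).
Qed.

Lemma gam_unique gamma : minimal_geodesic p0 (gam 1) gamma ->
  forall t, t \in `[0, 1] -> gamma t = gam t.
Proof.
move=> [[pP [X Xt gE]] g0 g1 gL] t t01.
have [_ _ _ gamL] := gam_minimal.
pose A := X * p0 - p0 * X.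
have As : skew A by exact: tangent_skew.
have gO s : s \in `[0, 1] -> gamma s = orbit A p0 s by exact: gE.
(* A geodesic has constant speed |X|, so minimality determines |X| through the length. *)
have XN : `|X| = pi / 2.
  move: gL; rewrite -gamL curve_length_gam ?ler01//.
  rewrite (@curve_length_cst _ _ 0 1 `|X|) ?ler01//.
    by rewrite subr0 !mul1r => -[].
  move=> s s01.
  rewrite (derive_val1 (is_derive_eq_itv gO s01 (is_derive_orbit cVV A p0 s))).
  by rewrite norm_orbit// /A (tangent_comm pP Xt).
suff AK : A = rot_gen by rewrite gO// AK.
apply: expop_rot_unique => //; first by rewrite -XN; exact: norm_tangent_gen.
rewrite (geodesic_reflection pP Xt) -/A -gO ?g1 ?in_itv/= ?ler01 ?lexx//.
by rewrite -[in RHS]rot_genE (geodesic_reflection pP rot_tangentP) rot_genE.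
Qed.

Lemma rot_unitary t : unitary (rot t) /\ adj (rot t) = rot (- t).
Proof.
have a : adj (rot t) = rot (- t).
  by apply: adjE; rewrite -!expop_rot; apply: expop_skew_adj => //; exact: rot_gen_skew.
split => //; split; rewrite a -(expop_rot t) -(expop_rot (- t)).
  exact: (expopNK cVV).
exact: (expopKN cVV).
Qed.

Lemma gamE t : gam t = rot t * p0 * rot (- t).
Proof. by rewrite -!expop_rot. Qed.

Lemma gam_sphere t : riemann_sphere V (gam t).
Proof.
have [u a] := rot_unitary t; exists (rot t); first exact: u.
by rewrite a gamE.
Qed.

(** The column is u |-> (cos (t Theta) u, sin (t Theta) u); its first entry is inverted by the
    secant, bounded because t < 1. *)
Lemma gam_principal t : 0 <= t < 1 -> principal_domain V (gam t).
Proof.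
move=> t01; have [u a] := rot_unitary t.
exists (bcomp (rot t) (binl V V)).
  exists (rot t); split => //.
  exists (D (fun n => (cos (t * theta n))^-1)).
  have E : bcomp (bfst V V) (bcomp (rot t) (binl V V)) = rot_cos t.
    apply: bopP => v.
    have -> : bcomp (bfst V V) (bcomp (rot t) (binl V V)) v = (rot t (v, 0)).1 by [].
    by rewrite /rot bblockE bop_0v addr0.
  by rewrite E rot_cosK// rot_secK.
have -> : adj (bcomp (rot t) (binl V V)) = bcomp (bfst V V) (rot (- t)).
  apply: adjE => v y; rewrite -a.
  have -> : ip (bcomp (rot t) (binl V V) v) y = ip ((v, 0) : VV) (adj (rot t) y).
    have := @expop_skew_adj _ _ cVV rot_gen t rot_gen_skew (v, 0) y.
    by rewrite a !expop_rot.
  by rewrite ip_pair /= ip0l addr0.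
by rewrite gamE; exact: bopP.
Qed.

(** If x_1 had an inverse [B], each point x w of the graph would satisfy w = B (x w).1, so its
    second component would be at most |x| |B| times the first, against unboundedness. *)
Lemma gam1_nprincipal : ~ principal_domain V (gam 1).
Proof.
move=> [x [U [[Ul Ur] xE [B [Bl Br]]]] xx].
have inr1 y : tangraph y -> exists w, y = x w.
  rewrite -range_gam1 => -[z _ <-]; exists (adj x z).
  by rewrite -xx.
apply: tangraph_unbounded; exists (`|x| * `|B|) => y /inr1[w ->].
have -> : w = B (x w).1.
  by have := congr1 (fun F : bop V V => F w) Bl.
rewrite (le_trans (hnorm_snd _))// (le_trans (hnorm_le_norm _ _))//.
rewrite -mulrA ler_wpM2l// (le_trans (hnorm_le_norm _ _))//.
by have -> : B (x w).1 = w by have := congr1 (fun F : bop V V => F w) Bl.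
Qed.

Lemma gam1_boundary : boundary_in (riemann_sphere V) (principal_domain V) (gam 1).
Proof.
split; last first.
  apply: subset_closure; split; first exact: gam_sphere.
  exact: gam1_nprincipal.
split; first exact: gam_sphere.
have h : gam t @[t --> (1 : R)^'-] --> gam 1.
  by apply: cvg_at_left_filter; exact: continuous_orbit.
move=> B /h hB.
have {}hB : \forall t \near (1 : R)^'-, B (gam t) := hB.
have : \forall t \near (1:R)^'-, B (gam t) /\ principal_domain V (gam t).
  near=> t; split.
    by near: t; exact: hB.
  apply: gam_principal; apply/andP; split.
    by apply/ltW; near: t; apply: nbhs_left_gt; exact: ltr01.
  by near: t; exact: nbhs_left_lt.
move=> BP; have [t [Bt Pt]] := @filter_ex _ _ (at_left_proper_filter (1 : R)) _ BP.
by exists (gam t).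
Unshelve. all: by end_near. Qed.

Lemma gam_optimal : optimal_bounded_deformation tangraph 1 tandiag.
Proof.
have cE t : t \in `[0, 1] -> deformation_curve tangraph 1 tandiag t = gam t.
  rewrite in_itv/= => /andP[t0]; rewrite /deformation_curve le_eqVlt => /predU1P[->|t1].
    by rewrite ltxx proj_onto_tangraph.
  by rewrite t1 proj_onto_graph// t0.
split; [split|].
- by split; [exact: tangraph_operator|exact: tangraph_closed].
- exact: tangraph_unbounded.
- exact: ltr01.
- exact: tandiag_continuous.
- have h : ((1 - t) * (pi / 2))%:E @[t --> (1:R)^'-] --> (0 : \bar R).
    apply: cvg_EFin; first by near=> t.
    rewrite [X in _ --> X](_ : 0 = (1 - 1) * (pi / 2)); last by rewrite subrr mul0r.
    apply: cvgM; last exact: cvg_cst.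
    by apply: cvgB; [exact: cvg_cst|apply: cvg_at_left_filter; exact: cvg_id].
  apply: cvg_trans h; apply: near_eq_cvg; near=> t.
  have t01 : 0 <= t < 1.
    apply/andP; split; first by apply/ltW; near: t; apply: nbhs_left_gt; exact: ltr01.
    by near: t; exact: nbhs_left_lt.
  by rewrite proj_onto_graph// proj_onto_tangraph dist_gam.
move=> t0 /andP[t00 t01] c.
have cE' s : s \in `[t0, 1] -> c s = gam s.
  rewrite in_itv/= => /andP[s0 s1]; apply: cE.
  by rewrite in_itv/= s1 (le_trans t00).
split.
  apply: piecewise_C1_on => //; apply: (C1_on_eq cE').
  exact: C1_on_orbit.
rewrite !cE' ?in_itv/= ?lexx ?(ltW t01)// dist_gam ?t00//.
rewrite (@curve_length_cst _ _ t0 1 (pi / 2)) ?(ltW t01)// => s s01.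
by rewrite (derive_val1 (is_derive_eq_itv cE' s01 (gam_velocity s))) norm_gam_velocity.
Unshelve. all: by end_near. Qed.

End Rotations.

(** * Completeness of L2 *)

Section SquareIntegrableFunctions.
Context {R : realType}.
Local Notation mu := (mu01 R).
Implicit Types (f g : R -> R[i]) (u v : L2 R).

Lemma ImD (x y : R[i]) : complex.Im (x + y) = complex.Im x + complex.Im y.
Proof. by case: x y => a b [c d]. Qed.

Lemma ImB (x y : R[i]) : complex.Im (x - y) = complex.Im x - complex.Im y.
Proof. by case: x y => a b [c d]. Qed.

Lemma mu01E (A : set (measurableTypeR R)) :
  mu A = lebesgue_measure (A `&` `[(0 : R), 1]).
Proof. by []. Qed.

Lemma mu01_setT : mu setT = 1%E.
Proof. by rewrite mu01E setTI lebesgue_measure_itv/= lte_fin ltr01 -EFinB subr0. Qed.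

Lemma measurable_Re_Im f : f \in @sqint R ->
  measurable_fun setT (@complex.Re R \o f) /\ measurable_fun setT (@complex.Im R \o f).
Proof.
move=> /andP[/sub_Lfun_mfun f1 /sub_Lfun_mfun f2].
by move: f1 f2; rewrite !inE.
Qed.

Lemma measurable_sqmod f : measurable_fun setT (@complex.Re R \o f) ->
  measurable_fun setT (@complex.Im R \o f) ->
  measurable_fun setT (fun x => (sqmod (f x))%:E).
Proof.
move=> f1 f2; apply/measurable_EFinP; rewrite /sqmod.
by apply: measurable_funD; apply: measurable_funX.
Qed.

Lemma sqint_sqmod f : f \in @sqint R <->
  [/\ measurable_fun setT (@complex.Re R \o f),
      measurable_fun setT (@complex.Im R \o f) &
      (\int[mu]_x (sqmod (f x))%:E < +oo)%E].
Proof.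
split=> [fL|[f1 f2 fI]].
  have [f1 f2] := measurable_Re_Im fL; split=> //.
  have /andP[/Lfun2_integrable_sqr i1 /Lfun2_integrable_sqr i2] := fL.
  have := integrableD measurableT i1 i2 => /integrableP[_].
  apply: le_lt_trans; rewrite le_eqVlt; apply/orP; left; apply/eqP.
  apply: eq_integral => x _ /=.
  by rewrite ger0_norm ?addr_ge0 ?sqr_ge0// EFinD.
have key (h : R -> R) : measurable_fun setT h ->
    (forall x, `|h x| ^+ 2 <= sqmod (f x)) -> h \in Lfun mu 2%:E.
  move=> mh hf; rewrite inE; apply/andP; split; rewrite inE//=.
  rewrite /finite_norm unlock; apply: poweR_lty.
  apply: le_lt_trans fI; apply: ge0_le_integral => //.
  - by move=> x _; exact: poweR_ge0.
  - rewrite (_ : (fun x => _) = EFin \o (fun x : R => `|h x| ^+ 2)).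
      by apply/measurable_EFinP/measurable_funX/measurableT_comp.
    by apply/funext => x /=; rewrite powR_mulrn.
  - exact: measurable_sqmod.
  - by move=> x _; rewrite /= lee_fin powR_mulrn.
by apply/andP; split; apply: key => // x /=; rewrite real_normK ?num_real//
  /sqmod ?lerDl ?lerDr sqr_ge0.
Qed.

Lemma hnorm_class (f : sqfun R) :
  ((hnorm (class_of f) ^+ 2)%:E = \int[mu]_x (sqmod (f x))%:E)%E.
Proof.
have [i1 i2] := integrableC_mul f f.
rewrite hnorm_sqr [ip _ _]L2ipE /integralC/= /Rintegral fineK; last first.
  exact: (integrable_fin_num measurableT i1).
apply: eq_integral => x _; congr (_%:E).
by rewrite /sqmod; case: (f x) => p q /=; ring.
Qed.

Lemma hnorm_L2B u v :
  ((hnorm (u - v) ^+ 2)%:E = \int[mu]_x (sqmod (repr u x - repr v x))%:E)%E.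
Proof.
by rewrite -{1}(class_repr u) -{1}(class_repr v) -scaleN1r -class_ofZ -class_ofD
  scaleN1r hnorm_class.
Qed.

End SquareIntegrableFunctions.

Section Completeness.
Context {R : realType}.
Local Notation mu := (mu01 R).

Let eps k : R := 1 / (2 ^ k.+1)%:R.

Let eps_gt0 k : 0 < eps k.
Proof. by rewrite divr_gt0// ltr0n expn_gt0. Qed.

Let eps_lt (e : R) : 0 < e -> exists k, eps k < e.
Proof.
move=> e0; exists (Num.bound e^-1); rewrite /eps div1r invf_plt ?posrE ?ltr0n ?expn_gt0//.
apply: (lt_trans (archi_boundP _)); first by rewrite invr_ge0 ltW.
by rewrite ltr_nat -[X in (X < _)%N]/((Num.bound e^-1).+1.-1) (leq_trans (ltn_expl _ (ltnSn 1)))// leq_exp2l.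
Qed.

Let sum_eps n : \sum_(k < n) eps k <= 1.
Proof.
have := @epsilon_trick0 R 1 xpredT ler01.
have h : (\sum_(0 <= i < n) (eps i)%:E <= \sum_(i <oo) (1 / (2 ^ i.+1)%:R)%:E)%E.
  by apply: nneseries_lim_ge => i _ _; rewrite lee_fin ltW.
by move=> /(le_trans h); rewrite sumEFin lee_fin big_mkord.
Qed.

Lemma cvgn_summable_increments (a s : nat -> R) (M : R) :
  (forall n, \sum_(k < n) s k <= M) ->
  (forall k, `|a k.+1 - a k| <= s k) -> cvgn a.
Proof.
move=> sM as_.
have c : cvgn (series (telescope a)).
  apply: normed_cvg; apply: nondecreasing_is_cvgn.
    apply/nondecreasing_seqP => n; rewrite -[leRHS]/(series (Num.norm \o telescope a) n.+1).
  by rewrite seriesSr lerDl/=.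
  exists M => _ [n _ <-]; rewrite -[leLHS]/(series (Num.norm \o telescope a) n) /series/= big_mkord.
  by apply: le_trans (sM n); apply: ler_sum => i _; exact: as_.
have -> : a = (fun n => a 0 + series (telescope a) n).
  by apply/funext => n; rewrite -eq_sum_telescope.
by apply: is_cvgD => //; exact: is_cvg_cst.
Qed.

Lemma limn_einf_le_bound (h : nat -> \bar R) (C : \bar R) m :
  (forall k, (m <= k)%N -> (h k <= C)%E) -> (limn_einf h <= C)%E.
Proof.
move=> hC; rewrite limn_einf_lim; apply: lime_le; first exact: is_cvg_einfs.
apply: nearW => n; apply: (@le_trans _ _ (h (maxn m n))).
  by apply: ereal_inf_lbound; exists (maxn m n) => //=; exact: leq_maxr.
by apply: hC; exact: leq_maxl.
Qed.

(* Riesz-Fischer: a subsequence with summable increments converges almost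
   everywhere, and Fatou's lemma identifies the limit in the mean. *)
Lemma hcomplete_L2 : hcomplete (L2 R).
Proof.
move=> u uC.
have /choice[N NP] : forall k, exists N, forall m n, (N <= m)%N -> (N <= n)%N ->
    hnorm (u m - u n) < eps k by move=> k; exact: uC.
(* The running maximum gives N k <= phi j for all j >= k, without requiring [phi] to be strictly
   increasing. *)
pose phi k := (\max_(i < k.+1) N i)%N.
have phiN k j : (k <= j)%N -> (N k <= phi j)%N.
  by rewrite -ltnS => kj; exact: (leq_bigmax (Ordinal kj)).
pose f k := repr (u (phi k)).
have fR k : measurable_fun setT (@complex.Re R \o f k) by have [] := measurable_Re_Im (sqfunP (f k)).
have fI k : measurable_fun setT (@complex.Im R \o f k) by have [] := measurable_Re_Im (sqfunP (f k)).
have msq (g h : R -> R[i]) : measurable_fun setT (@complex.Re R \o g) ->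
    measurable_fun setT (@complex.Im R \o g) ->
    measurable_fun setT (@complex.Re R \o h) ->
    measurable_fun setT (@complex.Im R \o h) ->
    measurable_fun setT (fun x => (sqmod (g x - h x))%:E).
  move=> g1 g2 h1 h2; apply/measurable_EFinP.
  rewrite (_ : (fun x => _) = (fun x => (((@complex.Re R \o g) x - (@complex.Re R \o h) x) ^+ 2
     + ((@complex.Im R \o g) x - (@complex.Im R \o h) x) ^+ 2))); last first.
    by apply/funext => x; rewrite /sqmod/=; case: (g x) (h x) => a b [c d].
  by apply: measurable_funD; apply: measurable_funX; apply: measurable_funB.
have fnear k m : (m <= k)%N ->
    (\int[mu]_x (sqmod (f k x - f m x))%:E <= (eps m ^+ 2)%:E)%E.
  move=> mk; rewrite -hnorm_L2B lee_fin ler_pXn2r ?nnegrE ?hnorm_ge0 ?(ltW (eps_gt0 _))//.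
  by apply/ltW/NP; exact: phiN.
(* The weight 1 / eps k leaves integrals of at most [eps k], hence summable, while |a| <= |a|^2 /
   eps k + eps k turns the squares back into a bound on the increments. *)
pose s k x := (eps k)^-1 * sqmod (f k.+1 x - f k x).
have s0 k x : 0 <= s k x by rewrite mulr_ge0 ?invr_ge0 ?(ltW (eps_gt0 _)) ?sqmod_ge0.
have ms k : measurable_fun setT (fun x => (s k x)%:E).
  apply/measurable_EFinP; rewrite /s; apply: measurable_funM; first exact: measurable_cst.
  by apply/measurable_EFinP; exact: msq.
have sI k : (\int[mu]_x (s k x)%:E <= (eps k)%:E)%E.
  have -> : (\int[mu]_x (s k x)%:E =
      \int[mu]_x (((eps k)^-1)%:E * (sqmod (f k.+1 x - f k x))%:E))%E by [].
  rewrite ge0_integralZl//; last 3 first.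
  - exact: msq.
  - by move=> x _; rewrite lee_fin sqmod_ge0.
  - by rewrite lee_fin invr_ge0 ltW.
  apply: (@le_trans _ _ (((eps k)^-1)%:E * (eps k ^+ 2)%:E)%E).
    by apply: lee_wpmul2l; [rewrite lee_fin invr_ge0 ltW|exact: fnear].
  by rewrite -EFinM lee_fin expr2 mulKf// gt_eqF.
have sumI : (\int[mu]_x (\sum_(k <oo) (s k x)%:E) <= 1)%E.
  rewrite integral_nneseries//; last by move=> k x _; rewrite lee_fin.
  apply: le_trans (@epsilon_trick0 R 1 xpredT ler01).
  apply: lee_nneseries => [k _ _|k _]; last exact: sI.
  by apply: integral_ge0 => x _; rewrite lee_fin.
have fin : {ae mu, forall x, (\sum_(k <oo) (s k x)%:E)%E \is a fin_num}.
  have : mu.-integrable setT (fun x => \sum_(k <oo) (s k x)%:E)%E.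
    apply/integrableP; split.
      apply: ge0_emeasurable_sum => [k x _ _|k _]; last exact: ms.
      by rewrite lee_fin.
    apply: le_lt_trans (le_lt_trans sumI (ltry 1)); rewrite le_eqVlt; apply/orP; left.
    apply/eqP; apply: eq_integral => x _; rewrite gee0_abs//.
    by apply: nneseries_ge0 => k _ _; rewrite lee_fin.
  move/integrable_ae => /(_ measurableT).
  by apply: filterS => x; exact.
(* The upper limit gives a measurable function defined everywhere; almost everywhere it is the
   actual limit. *)
pose g x : R[i] := Complex (fine (limn_esup (fun k => (complex.Re (f k x))%:E)))
  (fine (limn_esup (fun k => (complex.Im (f k x))%:E))).
have gR : measurable_fun setT (@complex.Re R \o g).
  apply: (measurableT_comp (f := fine)) => //.
  by apply: measurable_fun_limn_esup => k; apply/measurable_EFinP; exact: fR.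
have gI : measurable_fun setT (@complex.Im R \o g).
  apply: (measurableT_comp (f := fine)) => //.
  by apply: measurable_fun_limn_esup => k; apply/measurable_EFinP; exact: fI.
have fg : {ae mu, forall x, complex.Re (f k x) @[k --> \oo] --> complex.Re (g x) /\
    complex.Im (f k x) @[k --> \oo] --> complex.Im (g x)}.
  apply: filterS fin => x xfin.
  have sM n : \sum_(k < n) (s k x + eps k) <= fine (\sum_(k <oo) (s k x)%:E)%E + 1.
    rewrite big_split/=; apply: lerD; last exact: sum_eps.
    rewrite -lee_fin fineK// -sumEFin -(big_mkord xpredT (fun k => (s k x)%:E)).
    by apply: nneseries_lim_ge => i _ _; rewrite lee_fin.
  have amgm (t : R) k : t ^+ 2 <= sqmod (f k.+1 x - f k x) -> `|t| <= s k x + eps k.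
    move=> tq; have t2 : (eps k)^-1 * t ^+ 2 <= s k x.
      by rewrite ler_pM2l ?invr_gt0.
    apply: le_trans (lerD t2 (lexx _)).
    have := sqr_ge0 (`|t| - eps k / 2) => h.
    rewrite -(ler_pM2l (eps_gt0 k)) mulrDr mulrA mulfV ?gt_eqF// mul1r.
    rewrite -real_normK ?num_real//; have := sqr_ge0 (eps k).
    by move: h; rewrite !expr2; set e := eps k; set a := `|t|; lra.
  have key (a : nat -> R) : (forall k, (a k.+1 - a k) ^+ 2 <= sqmod (f k.+1 x - f k x)) ->
      a k @[k --> \oo] --> fine (limn_esup (fun k => (a k)%:E)).
    move=> ha; have /cvg_ex[l al] : cvgn a.
      by apply: (cvgn_summable_increments sM) => k; exact: amgm.
    have /cvg_limn_einf_sup[_ ->] : (a k)%:E @[k --> \oo] --> l%:E.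
      by apply: cvg_EFin => //; exact: nearW.
    exact: al.
  split; apply: key => k; rewrite /sqmod; case: (f k.+1 x) (f k x) => [a b] [c d]/=.
    by rewrite lerDl sqr_ge0.
  by rewrite lerDr sqr_ge0.
have gnear m : (\int[mu]_x (sqmod (g x - f m x))%:E <= (eps m ^+ 2)%:E)%E.
  pose h k x := (sqmod (f k x - f m x))%:E.
  have -> : (\int[mu]_x (sqmod (g x - f m x))%:E = \int[mu]_x limn_einf (h^~ x))%E.
    apply: ge0_ae_eq_integral => //.
    - exact: msq.
    - rewrite (_ : (fun x => _) = (fun x => - limn_esup (fun k => - h k x))%E); last first.
        by apply/funext => x; rewrite limn_esupN oppeK.
      apply: measurableT_comp => //; apply: measurable_fun_limn_esup => k.
      by apply: measurableT_comp => //; exact: msq.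
    - by move=> x _; rewrite lee_fin sqmod_ge0.
    - move=> x _; rewrite limn_einf_lim; apply: lime_ge; first exact: is_cvg_einfs.
      apply: nearW => n; apply: le_ereal_inf_tmp => _ [k _ <-].
      by rewrite lee_fin sqmod_ge0.
    apply: filterS fg => x [fgR fgI] _.
    have /cvg_limn_einf_sup[-> _] : h k x @[k --> \oo] --> (sqmod (g x - f m x))%:E.
      apply: cvg_EFin; first exact: nearW.
      have -> : fine \o (h ^~ x) = (fun k => (complex.Re (f k x) - complex.Re (f m x)) ^+ 2 +
         (complex.Im (f k x) - complex.Im (f m x)) ^+ 2).
        by apply/funext => k; rewrite /h/= /sqmod; case: (f k x) (f m x) => [a b] [c d].
      have -> : sqmod (g x - f m x) = (complex.Re (g x) - complex.Re (f m x)) ^+ 2 +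
         (complex.Im (g x) - complex.Im (f m x)) ^+ 2.
        by rewrite /sqmod; case: (g x) (f m x) => [a b] [c d].
      by apply: cvgD; rewrite !expr2; apply: cvgM; apply: cvgB => //; exact: cvg_cst.
    by [].
  apply: le_trans (fatou _ _ _ _) _ => //.
  - by move=> k; exact: msq.
  - by move=> k x _; rewrite lee_fin sqmod_ge0.
  by apply: (@limn_einf_le_bound _ _ m) => k; exact: fnear.
have dL m : (fun x => g x - f m x) \in @sqint R.
  apply/sqint_sqmod; split.
  - rewrite (_ : _ \o _ = (fun x => (@complex.Re R \o g) x - (@complex.Re R \o f m) x)).
      exact: measurable_funB.
    by apply/funext => x; exact: ReB.
  - rewrite (_ : _ \o _ = (fun x => (@complex.Im R \o g) x - (@complex.Im R \o f m) x)).
      exact: measurable_funB.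
    by apply/funext => x; exact: ImB.
  - by apply: le_lt_trans (gnear m) _; rewrite ltry.
pose d m := class_of (SqFun (dL m)).
(* Only the differences g - f m are known to be square integrable, so the limit is assembled as the
   class of g - f 0 plus the term it was compared with. *)
pose l := d 0%N + u (phi 0%N).
have ld m : l - u (phi m) = d m.
  rewrite /l -(class_repr (u (phi m))) -{1}(class_repr (u (phi 0%N))) -scaleN1r -class_ofZ.
  rewrite /d -!class_ofD; congr class_of; apply/val_inj; apply/funext => x.
  rewrite /= -/(f m) -/(f 0%N).
  change (g x - f 0%N x + f 0%N x + (-1) * f m x = g x - f m x).
  by rewrite subrK mulN1r.
have lm m : hnorm (l - u (phi m)) <= eps m.
  rewrite ld -(@ler_pXn2r _ 2)// ?nnegrE ?hnorm_ge0 ?(ltW (eps_gt0 _))//.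
  by rewrite -lee_fin hnorm_class; exact: gnear.
exists l; apply/cvgrPdist_le => e e0.
have [k ke] : exists k, eps k < e / 2 by apply: eps_lt; rewrite divr_gt0.
near=> n; rewrite sub0r normrN ger0_norm ?hnorm_ge0//.
have -> : u n - l = (u n - u (phi k)) - (l - u (phi k)) by rewrite opprB addrA subrK.
rewrite (le_trans (ler_hnormD _ _))// Defs.hnormN.
rewrite [leRHS]splitr lerD//; last by rewrite (le_trans (lm k))// ltW.
apply/ltW/(lt_trans _ ke)/NP; last exact: phiN.
by near: n; exists (N k).
Unshelve. all: by end_near. Qed.

End Completeness.

(** * Absolutely continuous functions *)

Section AbsoluteContinuity.
Context {R : realType}.
Local Notation mu := (mu01 R).
Implicit Types (F G : R -> R) (U : set R) (s : seq (R * R)) (t : R).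

Lemma ae_mu01P (P : R -> Prop) :
  {ae mu, forall x, P x} <->
  {ae (@lebesgue_measure R), forall x, x \in `[0, 1] -> P x}.
Proof.
split=> -[N [mN N0 NP]].
  exists (N `&` `[0, 1]); split; [exact: measurableI|exact: N0|].
  by move=> x /= /not_implyP[x01 Px]; split => //; exact: NP.
exists (N `|` ~` `[0, 1]%classic); split.
- by apply: measurableU => //; exact: measurableC.
- rewrite mu01E setIUl setICl setU0; apply: (@subset_measure0 _ _ _ _ _ N) => //.
  exact: measurableI.
- move=> x /= Px; have [x01|x01] := pselect (x \in `[0, 1]); [left|by right].
  by apply: NP => /= /(_ x01).
Qed.

Lemma ae_mu01_itv : {ae mu, forall x, x \in `[0, 1]}.
Proof. by apply/ae_mu01P; exact: aeW. Qed.

Lemma ae_mu01_neq (a : R) : {ae mu, forall x, x <> a}.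
Proof.
exists [set a]; split; [exact: measurable_set1| |by move=> x /= /contrapT].
apply/eqP; rewrite eq_le measure_ge0 andbT mu01E -(lebesgue_measure_set1 a).
by apply: le_measure; rewrite ?inE//; apply: measurableI => //; exact: measurable_set1.
Qed.

Lemma ae_mu01_oo : {ae mu, forall x, x \in `]0, 1[}.
Proof.
have h0 := ae_mu01_neq 0; have h1 := ae_mu01_neq 1; have h := ae_mu01_itv.
near=> x.
have : x \in `[0, 1] by near: x.
have : x <> 1 by near: x.
have : x <> 0 by near: x.
rewrite !in_itv/= => /eqP x0 /eqP x1 /andP[x0' x1'].
by rewrite !lt_neqAle x1 x1' x0' eq_sym x0.
Unshelve. all: by end_near. Qed.

(* Disjoint intervals of U to the left of t, listed from right to left. *)
Fixpoint chain U t s : Prop :=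
  if s is p :: s' then [/\ p.1 <= p.2, p.2 <= t, `]p.1, p.2[ `<=` U & chain U p.1 s']
  else 0 <= t.

Lemma chain_ge0 U t s : chain U t s -> 0 <= t.
Proof.
elim: s t => [//|p s IH] t /= [pp pt _ /IH]; by move=> h; rewrite (le_trans h)// (le_trans pp).
Qed.

Lemma chain_widen U t t' s : t <= t' -> chain U t s -> chain U t' s.
Proof.
case: s => [|p s] /= tt'; first by move=> t0; exact: le_trans tt'.
by case=> p1 p2 p3 p4; split => //; exact: le_trans tt'.
Qed.

Lemma chain_mem U t s p : chain U t s -> p \in s -> [/\ 0 <= p.1, p.1 <= p.2 & p.2 <= t].
Proof.
elim: s t => [//|q s IH] t /= [qq qt _ c]; rewrite inE => /predU1P[->|ps].
  by split => //; exact: chain_ge0 c.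
by have [? ? ?] := IH _ c ps; split => //; rewrite (le_trans _ qt)// (le_trans _ qq).
Qed.

Lemma chain_disjoint U t s i j : chain U t s -> (i < j < size s)%N ->
  (nth (0, 0) s j).2 <= (nth (0, 0) s i).1.
Proof.
elim: s t i j => [|q s IH] t i j /=; first by rewrite ltn0 andbF.
case=> _ _ _ c; case: j => [|j]; first by rewrite ltn0.
case: i => [|i]; rewrite !ltnS => /andP[ij js] /=; last by apply: (IH q.1) => //; rewrite ij.
by have [] := chain_mem c (mem_nth (0, 0) js).
Qed.

Lemma chain_length U t s : measurable (U : set (measurableTypeR R)) -> chain U t s ->
  ((\sum_(p <- s) (p.2 - p.1))%:E <= lebesgue_measure (U `&` `]-oo, t[))%E.
Proof.
move=> mU; elim: s t => [|p s IH] t /=; first by rewrite big_nil measure_ge0.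
case=> pp pt pU /IH c; rewrite big_cons addrC EFinD.
have -> : ((p.2 - p.1)%:E = lebesgue_measure (`]p.1, p.2[%classic : set R))%E.
  rewrite lebesgue_measure_itv/= lte_fin; move: pp; rewrite le_eqVlt => /predU1P[->|->//].
  by rewrite ltxx subrr.
apply: (@le_trans _ _ (lebesgue_measure ((U `&` `]-oo, p.1[) `|` `]p.1, p.2[%classic))).
  rewrite measureU//; first exact: leeD.
    exact: measurableI.
  rewrite -subset0 => x [[_ /=]]; rewrite !in_itv/= => xp /andP[px _].
  by have := lt_trans xp px; rewrite ltxx.
apply: le_measure; rewrite ?inE//; [by apply: measurableU => //; exact: measurableI|exact: measurableI|].
move=> x [[Ux]|xp]; rewrite /= ?in_itv/=.
  move=> xp; split=> //.
  by rewrite (lt_le_trans xp)// (le_trans pp).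
split; first exact: pU.
by move: xp; rewrite /= !in_itv/= => /andP[_ xp]; exact: lt_le_trans pt.
Qed.

Lemma abs_continuous_chain F (e : R) : abs_continuous 0 1 F -> 0 < e ->
  exists2 d : R, 0 < d & forall U s, chain U 1 s -> \sum_(p <- s) (p.2 - p.1) < d ->
    \sum_(p <- s) `|F p.2 - F p.1| < e.
Proof.
move=> aF e0; have [d d0 dF] := aF e e0; exists d => // U s c sd.
have := dF (size s) (fun i => (tnth (in_tuple s) i).1) (fun i => (tnth (in_tuple s) i).2).
rewrite -(big_tnth _ _ s xpredT (fun p => `|F p.2 - F p.1|))
  -(big_tnth _ _ s xpredT (fun p => p.2 - p.1)); apply => //.
  by move=> i; have [h1 h2 h3] := chain_mem c (mem_tnth i (in_tuple s)); split => //; apply/andP.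
apply/trivIsetP => i j _ _ ij; rewrite -subset0 => x [/=].
wlog : i j ij / (i < j)%N.
  move=> wl xi xj; have := ij; rewrite neq_ltn => /orP[h|h]; first exact: wl h xi xj.
  by apply: wl h xj xi; rewrite eq_sym.
move=> {}ij; rewrite !in_itv/= => /andP[ix _] /andP[_ xj].
have := chain_disjoint c (_ : (i < j < size s)%N); rewrite ij ltn_ord => /(_ isT).
rewrite -!(tnth_nth _ (in_tuple s)) => h.
by have := lt_le_trans (lt_trans ix xj) h; rewrite ltxx.
Qed.

(* A set of full measure where F is flat contributes at most e to the variation,
   its complement at most e by absolute continuity; the two are glued along
   [0, 1] by a supremum argument. *)
Lemma abs_continuous_derive0 F : abs_continuous 0 1 F ->
  {ae mu, forall x, is_derive x (1 : R) F (0 : R)} -> F 1 = F 0.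
Proof.
move=> aF /ae_mu01P[N [mN N0 NF]].
have {}N0 : lebesgue_measure (N : set (measurableTypeR R)) = 0%E := N0.
suff : `|F 1 - F 0| <= 0 by rewrite normr_le0 subr_eq0 => /eqP.
apply/ler_addgt0Pr => e' e'0; rewrite add0r; pose e := e' / 2.
have e0 : 0 < e by rewrite divr_gt0.
have [d d0 dF] := abs_continuous_chain aF e0.
(* [U] covers the exceptional null set, and its measure stays below the threshold of absolute
   continuity for [e]. *)
have [U [oU NU Ud]] : exists U : set R, [/\ open U, N `<=` U &
    (lebesgue_measure (U `\` N) < d%:E)%E].
  apply: (@lebesgue_regularity_outer R N d mN _ d0).
  by rewrite [X in (X < _)%E]N0 ltry.
have mU : measurable (U : set (measurableTypeR R)) by exact: open_measurable.
have {}Ud : (lebesgue_measure U < d%:E)%E.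
  rewrite -(setDUK NU) (le_lt_trans (measureU2 _ _ _))//; first exact: measurableD.
  by rewrite [X in (X + _)%E]N0 add0e.
(* Invariant of the gluing: steps outside the chain cost at most [e] times their length by flatness,
   while those in the chain lie in [U] and are charged to absolute continuity. *)
pose S t := exists2 s, chain U t s &
  `|F t - F 0| <= e * t + \sum_(p <- s) `|F p.2 - F p.1|.
have S0 : S 0.
  by exists [::] => //=; rewrite big_nil subrr normr0 mulr0 addr0.
have stepE a b : a <= b -> `|F b - F a| <= e * (b - a) -> S a -> S b.
  move=> ab Fab [s cs Fs]; exists s; first exact: chain_widen cs.
  rewrite -(subrK (F a) (F b)) -addrA (le_trans (ler_normD _ _))//.
  by rewrite (le_trans (lerD Fab Fs))// addrA -mulrDr subrK.
have stepU a b : a <= b -> `]a, b[ `<=` U -> S a -> S b.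
  move=> ab abU [s cs Fs]; exists ((a, b) :: s); first by split.
  have -> : F b - F 0 = (F b - F a) + (F a - F 0) by rewrite addrA subrK.
  rewrite big_cons/= (le_trans (ler_normD _ _))// addrCA lerD//.
  by rewrite (le_trans Fs)// lerD2r ler_pM2l.
(* Near any [x] the invariant can be carried across [x]: by extending the chain if [x] is in [U], by
   the vanishing derivative otherwise. *)
have gauge x : 0 <= x <= 1 -> exists2 h : R, 0 < h &
    forall a b, x - h < a <= x -> x <= b < x + h -> S a -> S b.
  move=> x01; have [Ux|Ux] := pselect (U x).
    have /nbhs_ballP[h /= h0 hU] : nbhs x U by exact: open_nbhs_nbhs.
    exists h => // a b /andP[xa ax] /andP[xb bx]; apply: stepU; first exact: le_trans xb.
    move=> y /=; rewrite in_itv/= => /andP[ay yb]; apply: hU.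
    by rewrite /ball/= ltr_distlC (lt_trans xa ay) (lt_trans yb bx).
  have /is_deriveP dFx : is_derive x (1 : R) F (0 : R).
    by apply: contrapT => h; apply/Ux/NU/NF => /=; rewrite in_itv/= => /(_ x01).
  have /cvgrPdist_le/(_ _ e0) := dFx.
  move=> [h /= h0 hF].
  have near_x y : `|y - x| < h -> `|F y - F x| <= e * `|y - x|.
    move=> yx; have [->|yx0] := eqVneq y x; first by rewrite !subrr normr0 mulr0.
    have := hF (y - x); rewrite /ball_/= sub0r normrN subr_eq0 => /(_ yx yx0).
    rewrite sub0r normrN normrM normfV subrK ler_pdivrMl ?normr_gt0 ?subr_eq0//.
    by rewrite mulrC.
  exists h => // a b /andP[xa ax] /andP[xb bx]; apply: stepE; first exact: le_trans xb.
  have ha : `|F a - F x| <= e * (x - a).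
    by have := near_x a; rewrite distrC ger0_norm ?subr_ge0//; apply; rewrite ltrBlDl -ltrBlDr.
  have hb : `|F b - F x| <= e * (b - x).
    by have := near_x b; rewrite ger0_norm ?subr_ge0//; apply; rewrite ltrBlDl.
  have -> : F b - F a = (F b - F x) - (F a - F x) by rewrite opprB addrA subrK.
  rewrite (le_trans (ler_normB _ _))// (le_trans (lerD hb ha))// -mulrDr.
  by rewrite addrA subrK.
pose A : set R := [set t : R | 0 <= t <= 1 /\ S t].
have supA : has_sup A.
  split; first by exists 0; split; rewrite ?lexx ?ler01.
  by exists 1 => t [/andP[]].
have A0 : A 0 by split; rewrite ?lexx ?ler01.
have Asup x : A x -> x <= sup A by move=> Ax; apply: ub_le_sup => //; exact: supA.2.
have c01 : 0 <= sup A <= 1.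
  apply/andP; split; first exact: Asup.
  by apply: ge_sup; [exists 0|move=> t [/andP[]]].
have [h h0 hS] := gauge _ c01.
have [t At ht] := sup_adherent h0 supA.
(* [b] belongs to [A], so it cannot exceed the supremum; this forces the minimum to be 1. *)
pose b := Num.min 1 (sup A + h / 2).
have Sb : S b.
  apply: (hS t) At.2.
    by rewrite ht/=; exact: Asup.
  rewrite /b le_min (andP c01).2 lerDl divr_ge0 ?ltW//= gt_min.
  by rewrite ltrD2l ltr_pdivrMr// ltr_pMr// ltr1n orbT.
have bA : b <= sup A.
  apply: Asup; split => //; rewrite ge_min lexx/= andbT le_min ler01/=.
  by apply: addr_ge0; [case/andP: c01|rewrite divr_ge0 ?ltW].
have [s cs Fs] : S 1.
  suff -> : 1 = b by [].
  apply/esym/min_l; rewrite leNgt; apply/negP => /ltW h1.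
  by move: bA; rewrite /b (min_r h1) gerDl leNgt divr_gt0.
apply: (le_trans Fs); rewrite mulr1 [leRHS]splitr lerD2l ltW//.
apply: (dF U s) => //; rewrite -lte_fin (le_lt_trans (chain_length mU cs))//.
apply: le_lt_trans Ud; apply: le_measure; rewrite ?inE//; exact: measurableI.
Qed.

End AbsoluteContinuity.

(** * Primitives of functions on the unit interval *)

Section Primitives.
Context {R : realType}.
Local Notation mu := (mu01 R).
Local Notation leb := (@lebesgue_measure R).
Local Notation itv01 := [set` `[0%R : R, 1%R]].
Implicit Types (w F G : R -> R).

Lemma mu01_out : mu (~` itv01) = 0%E.
Proof. by rewrite mu01E setICl measure0. Qed.

Lemma integral_mu01 (f : R -> \bar R) : mu.-integrable setT f ->
  (\int[mu]_x f x = \int[leb]_(x in itv01) f x)%E.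
Proof.
move=> fi; rewrite (negligible_integral _ _ fi mu01_out)//; last exact: measurableC.
rewrite setTD setCK; apply: eq_measure_integral => A mA /setIidl AI.
by rewrite mu01E AI.
Qed.

Lemma ge0_integral_mu01 (f : R -> \bar R) : measurable_fun setT f ->
  (forall x, 0 <= f x)%E -> (\int[mu]_x f x = \int[leb]_(x in itv01) f x)%E.
Proof.
move=> mf f0.
rewrite (@ge0_negligible_integral _ (measurableTypeR R) R mu setT (~` itv01) f)//; last 2 first.
- exact: measurableC.
- exact: mu01_out.
rewrite setTD setCK; apply: eq_measure_integral => A mA /setIidl AI.
by rewrite mu01E AI.
Qed.

Lemma integrable_mu01 (f : R -> R) : mu.-integrable setT (EFin \o f) ->
  leb.-integrable setT (EFin \o (f \_ itv01)).
Proof.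
move=> /integrableP[mf fi]; rewrite -restrict_EFin; apply: (integrable_mkcond _ _).1 => //.
apply/integrableP; split; first exact: measurable_funS mf.
rewrite -ge0_integral_mu01//; exact: measurableT_comp.
Qed.

(** [w] is cut off outside [0, 1], where nothing is known of it, so that the integrand becomes
    integrable on the whole line. *)
Definition primitive w x : R := \int[leb]_(t in `[0, x]) (w \_ itv01) t.

Lemma primitive0 w : primitive w 0 = 0.
Proof. by rewrite /primitive set_itv1 Rintegral_set1. Qed.

Lemma primitive1 w : mu.-integrable setT (EFin \o w) -> primitive w 1 = \int[mu]_x w x.
Proof.
move=> wi; rewrite /primitive -Rintegral_mkcondr setIid /Rintegral.
by rewrite integral_mu01.
Qed.

(** Lebesgue differentiation for the cut-off integrand, at almost every interior point; the two
    endpoints form a null set. *)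
Lemma primitive_derive w : mu.-integrable setT (EFin \o w) ->
  {ae mu, forall x, is_derive x (1 : R) (primitive w) (w x)}.
Proof.
move=> /integrable_mu01 wi.
have wy y : leb.-integrable [set` Interval (BLeft (0 : R)) (BRight y)] (EFin \o (w \_ itv01)).
  by apply: integrableS wi.
have wl : locally_integrable [set: R] (w \_ itv01).
  by apply: open_integrable_locally => //; exact: openT.
suff h : {ae mu, forall x : R, x \in `]0, 1[ -> is_derive x (1 : R) (primitive w) (w x)}.
  by apply: filterS2 (@ae_mu01_oo R) h => x x01; exact.
apply/ae_mu01P; move: (FTC1 wy wl).
apply: filterS; first exact: (ae_filter_ringOfSetsType leb).
move=> x /= hx _; rewrite in_itv/= => /andP[x0 x1].
have [|dx] := hx; first by rewrite lte_fin.
rewrite patchE mem_set; last by rewrite /= in_itv/= !ltW.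
by rewrite derive1E => <-; exact: (DeriveDef dx).
Qed.

Lemma primitiveB w l r : mu.-integrable setT (EFin \o w) -> 0 <= l <= r ->
  primitive w r - primitive w l = \int[leb]_(t in `]l, r[) (w \_ itv01) t.
Proof.
move=> /integrable_mu01 wi /andP[l0 lr]; rewrite /primitive Rintegral_itvB ?bnd_simp//.
  by rewrite Rintegral_itv_bndo_bndc//; exact: integrableS wi.
by apply: integrableS wi.
Qed.

Lemma Rintegral_disjoint_le (f : R -> R) n (l r : 'I_n -> R) :
  leb.-integrable setT (EFin \o f) -> (forall x, 0 <= f x) ->
  trivIset setT (fun i => `]l i, r i[%classic) ->
  \sum_i \int[leb]_(t in `]l i, r i[) f t <= \int[leb]_t f t.
Proof.
move=> fi f0 tri.
have ifin (A : set (measurableTypeR R)) : measurable A -> (\int[leb]_(t in A) (f t)%:E)%E \is a fin_num.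
  by move=> mA; apply: integrable_fin_num => //; exact: integrableS fi.
rewrite -lee_fin -sumEFin /Rintegral fineK; last exact: ifin.
under eq_bigr do rewrite fineK ?ifin//.
rewrite -(@ge0_integral_bigsetU _ (measurableTypeR R) R leb _ (fun i => `]l i, r i[%classic) (fun x => (f x)%:E))//.
- apply: ge0_subset_integral => //; [exact: bigsetU_measurable|by have /integrableP[] := fi|].
  by move=> x _; rewrite lee_fin.
- exact: index_enum_uniq.
- by apply: sub_trivIset tri.
- have /integrableP[mf _] := fi; exact: measurable_funS mf.
- by move=> x _; rewrite lee_fin.
Qed.

(* |w| <= c w^2 + 1/c: on short unions of intervals w is dominated by a small
   multiple of the integrable function w^2. *)
Lemma abs_continuous_primitive w : w \in Lfun mu 2%:E -> abs_continuous 0 1 (primitive w).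
Proof.
move=> w2; have wi := Lfun2_integrable_sqr w2.
have w1 : mu.-integrable setT (EFin \o w).
  by apply/Lfun1_integrable; apply: Lfun_subset12 w2; rewrite mu01_setT.
set W := w \_ itv01.
have Wi : leb.-integrable setT (EFin \o W) by exact: integrable_mu01.
have W2i : leb.-integrable setT (EFin \o (fun x => W x ^+ 2)).
  have := integrable_mu01 wi; apply: eq_integrable => // x _ /=.
  by congr EFin; rewrite /W !patchE; case: ifP => // _; rewrite expr0n.
set K := \int[leb]_t W t ^+ 2.
have K0 : 0 <= K by apply: Rintegral_ge0 => x _; exact: sqr_ge0.
(* This [c] makes the quadratic part at most e / 2, and the threshold c (e / 2) chosen next does the
   same for the length part; the added 1 prevents division by zero. *)
move=> e e0; pose c := e / (2 * (K + 1)).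
have K1 : 0 < K + 1 by rewrite ltr_wpDl.
have c0 : 0 < c by rewrite divr_gt0// mulr_gt0.
exists (c * (e / 2)); first by rewrite mulr_gt0// divr_gt0.
move=> n l r lr tri small.
have bound i : `|primitive w (r i) - primitive w (l i)| <=
    c * \int[leb]_(t in `]l i, r i[) W t ^+ 2 + c^-1 * (r i - l i).
  have [/andP[l0 lri] _] := lr i.
  rewrite primitiveB ?l0// (le_trans (le_normr_Rintegral _ _))//; first exact: integrableS Wi.
  have cI : leb.-integrable `]l i, r i[ (EFin \o (fun=> c^-1)).
    apply/integrableP; split; first exact: measurable_cst.
    rewrite integral_cst//= lebesgue_measure_itv/=.
    by case: ifP => _; rewrite ?mule0// -EFinB -EFinM ltry.
  rewrite -RintegralZl//; last exact: integrableS W2i.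
  have -> : c^-1 * (r i - l i) = \int[leb]_(t in `]l i, r i[) c^-1.
    rewrite Rintegral_cst//; congr (_ * _).
    rewrite [X in fine X](_ : _ = (r i - l i)%:E)//.
    apply: etrans (lebesgue_measure_itv _) _ => /=; rewrite lte_fin.
    by move: lri; rewrite le_eqVlt => /predU1P[->|->//]; rewrite ltxx subrr.
  have ZI : leb.-integrable `]l i, r i[ (EFin \o (fun x => c * W x ^+ 2)).
    have := @integrableZl _ _ _ leb `]l i, r i[%classic (measurable_itv _) c (EFin \o (fun x => W x ^+ 2)).
    by apply; exact: integrableS W2i.
  rewrite -RintegralD//; apply: le_Rintegral => //.
  - have := integrableS measurableT _ _ Wi => /(_ `]l i, r i[%classic)h.
    rewrite (_ : _ \o _ = abse \o (EFin \o W))//; apply: integrable_abse.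
    exact: h.
  - have := @integrableD _ (measurableTypeR R) R leb _ (measurable_itv _) _ _ ZI cI.
    by apply: eq_integrable => // x _ /=; rewrite -EFinD.
  - move=> x _; rewrite -[W x ^+ 2]real_normK ?num_real//.
    rewrite -(ler_pM2l c0) mulrDr mulfV ?gt_eqF//.
    have := sqr_ge0 (c * `|W x| - 1); have := sqr_ge0 (c * `|W x|).
    by rewrite !expr2; lra.
apply: (@le_lt_trans _ _ (\sum_i (c * \int[leb]_(t in `]l i, r i[) W t ^+ 2 + c^-1 * (r i - l i)))).
  by apply: ler_sum => i _; exact: bound.
rewrite big_split/= -!mulr_sumr.
have cK : c * \sum_i \int[leb]_(t in `]l i, r i[) W t ^+ 2 <= e / 2.
  apply: (@le_trans _ _ (c * (K + 1))).
    rewrite ler_pM2l// (@le_trans _ _ K)//; last by rewrite lerDl.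
    by apply: Rintegral_disjoint_le => // x; exact: sqr_ge0.
  by rewrite /c invfM mulrA mulfVK ?gt_eqF.
have cS : c^-1 * \sum_i (r i - l i) < e / 2 by rewrite ltr_pdivrMl.
by have := ler_ltD cK cS; rewrite -splitr.
Qed.

End Primitives.

Section AbsoluteContinuityAlgebra.
Context {R : realType}.
Local Notation mu := (mu01 R).
Implicit Types (F G : R -> R) (f g : R -> R[i]).

Lemma abs_continuous_lipschitz F (k : R) : 0 < k ->
  (forall x y, x <= y -> `|F y - F x| <= k * (y - x)) -> abs_continuous 0 1 F.
Proof.
move=> k0 kF e e0; exists (e / k); first exact: divr_gt0.
move=> n l r lr _; rewrite ltr_pdivlMr// mulrC mulr_sumr; apply: le_lt_trans.
by apply: ler_sum => i _; apply: kF; have [/andP[]] := lr i.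
Qed.

Lemma abs_continuous_continuous F : abs_continuous 0 1 F -> {within `[0, 1], continuous F}.
Proof.
move=> aF; apply/continuous_withinP => t; rewrite /= in_itv/= => /andP[t0 t1].
apply/cvgrPdist_lt => e e0; have [d d0 dF] := aF e e0.
have key (x y : R) : 0 <= x <= y -> y <= 1 -> y - x < d -> `|F y - F x| < e.
  move=> xy y1 xyd; have := dF 1%N (fun=> x) (fun=> y).
  rewrite !big_ord1; apply => //.
  by apply/trivIsetP => i j _ _; rewrite !ord1 eqxx.
rewrite near_withinE; near=> s => /=; rewrite in_itv/= => /andP[s0 s1].
have : `|t - s| < d by near: s; exact: cvgr_dist_lt.
have [ts|st] := leP t s.
  by rewrite distrC ger0_norm ?subr_ge0// => sd; rewrite distrC; apply: key; rewrite ?t0.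
by rewrite ger0_norm ?subr_ge0 1?ltW// => sd; apply: key; rewrite ?s0//= ltW.
Unshelve. all: by end_near. Qed.

Lemma continuous_itv_bounded F : {within `[0, 1], continuous F} ->
  exists2 M : R, 0 < M & forall x : R, x \in `[0, 1] -> `|F x| <= M.
Proof.
move=> cF; have [a _ Fa] := EVT_max ler01 cF; have [b _ Fb] := EVT_min ler01 cF.
exists (`|F a| + `|F b| + 1); first by rewrite ltr_wpDl// addr_ge0.
move=> x x01; have := Fa x x01; have := Fb x x01 => h1 h2.
have := ler_norm (F a); have := ler_norm (- F b); rewrite normrN; have := normr_ge0 (F a).
by have := normr_ge0 (F b); rewrite ler_norml; lra.
Qed.

Lemma abs_continuousD F G : abs_continuous 0 1 F -> abs_continuous 0 1 G ->
  abs_continuous 0 1 (fun x => F x + G x).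
Proof.
move=> aF aG e e0; have e2 : 0 < e / 2 by rewrite divr_gt0.
have [d d0 dF] := aF _ e2; have [c c0 cG] := aG _ e2.
exists (Num.min d c); first by rewrite lt_min d0.
move=> n l r lr tri; rewrite lt_min => /andP[/(dF _ _ _ lr tri) h1 /(cG _ _ _ lr tri) h2].
rewrite [ltRHS]splitr; apply: le_lt_trans (ltrD h1 h2); rewrite -big_split/=.
by apply: ler_sum => i _; rewrite opprD addrACA; exact: ler_normD.
Qed.

Lemma abs_continuousN F : abs_continuous 0 1 F -> abs_continuous 0 1 (fun x => - F x).
Proof.
move=> aF e e0; have [d d0 dF] := aF _ e0; exists d => // n l r lr tri /(dF _ _ _ lr tri).
by under [X in _ -> X < _]eq_bigr do rewrite -opprD normrN.
Qed.

Lemma abs_continuousM F G : abs_continuous 0 1 F -> abs_continuous 0 1 G ->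
  abs_continuous 0 1 (fun x => F x * G x).
Proof.
move=> aF aG e e0.
have [M M0 FM] := continuous_itv_bounded (abs_continuous_continuous aF).
have [N N0 GN] := continuous_itv_bounded (abs_continuous_continuous aG).
have [d d0 dF] := aF (e / 2 / N) ltac:(by rewrite !divr_gt0).
have [c c0 cG] := aG (e / 2 / M) ltac:(by rewrite !divr_gt0).
exists (Num.min d c); first by rewrite lt_min d0.
move=> n l r lr tri; rewrite lt_min => /andP[/(dF _ _ _ lr tri) h1 /(cG _ _ _ lr tri) h2].
move: h1 h2; rewrite (ltr_pdivlMr _ _ N0) (ltr_pdivlMr _ _ M0) => h1 h2.
rewrite [ltRHS]splitr; apply: le_lt_trans (ltrD h1 h2).
rewrite !mulr_suml -big_split/=; apply: ler_sum => i _.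
have [/andP[l0 lri] r1] := lr i.
have -> : F (r i) * G (r i) - F (l i) * G (l i) =
  (F (r i) - F (l i)) * G (r i) + (G (r i) - G (l i)) * F (l i) by ring.
rewrite (le_trans (ler_normD _ _))// !normrM lerD// ler_wpM2l//.
  by apply: GN; rewrite in_itv/= r1 (le_trans l0).
by apply: FM; rewrite in_itv/= l0 (le_trans lri).
Qed.

Lemma abs_continuousCM f g : abs_continuousC 0 1 f -> abs_continuousC 0 1 g ->
  abs_continuousC 0 1 (fun x => f x * g x).
Proof.
move=> [f1 f2] [g1 g2]; split.
  rewrite (_ : (fun x => _) = (fun x => complex.Re (f x) * complex.Re (g x) +
    - (complex.Im (f x) * complex.Im (g x)))).
    by apply: abs_continuousD; [|apply: abs_continuousN]; exact: abs_continuousM.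
  by apply/funext => x; case: (f x) (g x) => a b [c d].
rewrite (_ : (fun x => _) = (fun x => complex.Re (f x) * complex.Im (g x) +
    complex.Im (f x) * complex.Re (g x))).
  by apply: abs_continuousD; exact: abs_continuousM.
by apply/funext => x; case: (f x) (g x) => a b [c d].
Qed.

Lemma is_derive_val (F : R -> R) (x a b : R) : a = b -> is_derive x 1 F a -> is_derive x 1 F b.
Proof. by move=> ->. Qed.

Lemma is_deriveCM f g (x : R) (a b : R[i]) : is_deriveC x f a -> is_deriveC x g b ->
  is_deriveC x (fun x => f x * g x) (a * g x + f x * b).
Proof.
move=> [f1 f2] [g1 g2]; split.
  rewrite (_ : (fun x => _) = (fun x => complex.Re (f x)) * (fun x => complex.Re (g x)) -
    (fun x => complex.Im (f x)) * (fun x => complex.Im (g x))); last first.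
    by apply/funext => y; rewrite !fctE; case: (f y) (g y) => p q [r s].
  apply: is_derive_val (is_deriveB (is_deriveM f1 g1) (is_deriveM f2 g2)).
  by rewrite /GRing.scale/=; case: (f x) (g x) a b {f1 f2 g1 g2} => [p q] [r s] [u v] [z t]/=; ring.
rewrite (_ : (fun x => _) = (fun x => complex.Re (f x)) * (fun x => complex.Im (g x)) +
    (fun x => complex.Im (f x)) * (fun x => complex.Re (g x))); last first.
  by apply/funext => y; rewrite !fctE; case: (f y) (g y) => p q [r s].
apply: is_derive_val (is_deriveD (is_deriveM f1 g2) (is_deriveM f2 g1)).
by rewrite /GRing.scale/=; case: (f x) (g x) a b {f1 f2 g1 g2} => [p q] [r s] [u v] [z t]/=; ring.
Qed.

(** [F] minus the primitive of [w] is absolutely continuous with derivative zero almost everywhere,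
    hence takes the same value at 0 and 1. *)
Lemma abs_continuous_ftc F (w : R -> R) : abs_continuous 0 1 F -> w \in Lfun mu 2%:E ->
  {ae mu, forall x, is_derive x (1 : R) F (w x)} -> \int[mu]_x w x = F 1 - F 0.
Proof.
move=> aF w2 dF.
have wi : mu.-integrable setT (EFin \o w).
  by apply/Lfun1_integrable; apply: Lfun_subset12 w2; rewrite mu01_setT.
have d0 : {ae mu, forall x, is_derive x (1 : R) (fun x => F x + - primitive w x) (0 : R)}.
  apply: filterS2 dF (primitive_derive wi) => x h1 h2.
  by apply: is_derive_val (is_deriveB h1 h2); rewrite subrr.
have := abs_continuous_derive0 (abs_continuousD aF (abs_continuousN (abs_continuous_primitive w2))) d0.
rewrite primitive0 (primitive1 wi) oppr0 addr0 => <-.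
by rewrite opprD addNKr opprK.
Qed.

Lemma integralC_derive f (w : R -> R[i]) : abs_continuousC 0 1 f -> w \in @sqint R ->
  {ae mu, forall x, is_deriveC x f (w x)} -> integralC w = f 1 - f 0.
Proof.
move=> [f1 f2] /andP[w1 w2] dw; rewrite /integralC.
rewrite (abs_continuous_ftc f1 w1); last by apply: filterS dw => x [].
rewrite (abs_continuous_ftc f2 w2); last by apply: filterS dw => x [].
by case: (f 1) (f 0) => a b [c d].
Qed.

Lemma sqint_mul f g (M : R) : f \in @sqint R ->
  measurable_fun setT (@complex.Re R \o g) -> measurable_fun setT (@complex.Im R \o g) ->
  (forall x, sqmod (g x) <= M) -> (fun x => f x * g x) \in @sqint R.
Proof.
move=> /sqint_sqmod[f1 f2 fi] g1 g2 gM; apply/sqint_sqmod; split.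
- rewrite (_ : _ \o _ = (fun x => (@complex.Re R \o f) x * (@complex.Re R \o g) x -
     (@complex.Im R \o f) x * (@complex.Im R \o g) x)).
    by apply: measurable_funB; apply: measurable_funM.
  by apply/funext => x /=; case: (f x) (g x) => p q [r s].
- rewrite (_ : _ \o _ = (fun x => (@complex.Re R \o f) x * (@complex.Im R \o g) x +
     (@complex.Im R \o f) x * (@complex.Re R \o g) x)).
    by apply: measurable_funD; apply: measurable_funM.
  by apply/funext => x /=; case: (f x) (g x) => p q [r s].
have M0 : 0 <= M by apply: le_trans (gM 0); exact: sqmod_ge0.
apply: (@le_lt_trans _ _ (M%:E * \int[mu]_x (sqmod (f x))%:E)%E); last first.
  have [->|M1] := eqVneq M 0; first by rewrite mul0e ltry.
  by apply: lte_mul_pinfty => //; rewrite lee_fin.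
have msf := measurable_sqmod f1 f2.
rewrite -ge0_integralZl//; last first.
  by move=> x _; rewrite lee_fin sqmod_ge0.
apply: ge0_le_integral => //.
- by move=> x _; rewrite lee_fin sqmod_ge0.
- rewrite (_ : (fun x => _) = (fun x => (sqmod (f x) * sqmod (g x))%:E)).
    apply/measurable_EFinP; apply: measurable_funM; apply/measurable_EFinP => //.
    exact: measurable_sqmod.
  by apply/funext => x; rewrite sqmodM.
- by apply: emeasurable_funM => //; exact: measurable_cst.
- by move=> x _; rewrite -EFinM lee_fin sqmodM mulrC ler_wpM2r ?sqmod_ge0.
Qed.

End AbsoluteContinuityAlgebra.

(** * Fourier series *)

Section FourierBasis.
Context {R : realType}.
Local Notation mu := (mu01 R).
Local Notation e := (@fourier R).
Implicit Types (f g : R -> R[i]) (u v : L2 R) (n : int) (x : R).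

(** Eigenvalue 2 pi i n of d/dx on the n-th exponential; the factor -i of the operator is dealt with
    only in [derivation_graphE]. *)
Definition freq n : R[i] := Complex 0 (2 * pi * n%:~R).

Lemma freqN n : freq (- n) = - freq n.
Proof. by rewrite /freq rmorphN mulrN; apply/eqP; rewrite eq_complex/= oppr0 !eqxx. Qed.

Lemma freq_inj : injective freq.
Proof.
move=> m n [] /mulfI h; apply/eqP; rewrite -(eqr_int R); apply/eqP/h.
by rewrite mulf_neq0 ?pnatr_eq0// gt_eqF// pi_gt0.
Qed.

Lemma freq0 : freq 0 = 0.
Proof. by rewrite /freq mulr0. Qed.

Lemma fourier_funM m n x : fourier_fun m x * fourier_fun n x = fourier_fun (m + n) x.
Proof.
rewrite /fourier_fun intrD (mulrDr (2 * pi)) (mulrDl _ _ x) cosD sinD.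
by apply/eqP; rewrite eq_complex/= eqxx/= addrC.
Qed.

Lemma fourier_fun0 x : fourier_fun 0 x = 1.
Proof. by rewrite /fourier_fun mulr0 mul0r cos0 sin0. Qed.

Lemma conj_fourier_fun n x : (fourier_fun n x)^*%C = fourier_fun (- n) x.
Proof. by rewrite /fourier_fun rmorphN mulrN mulNr cosN sinN. Qed.

Lemma sqmod_fourier_fun n x : sqmod (fourier_fun n x) = 1.
Proof. by rewrite /sqmod/= cos2Dsin2. Qed.

Lemma fourier_fun_at0 n : fourier_fun n (0 : R) = 1.
Proof. by rewrite /fourier_fun mulr0 cos0 sin0. Qed.

Lemma fourier_fun_at1 n : fourier_fun n (1 : R) = 1.
Proof.
have nat_case (k : nat) : fourier_fun k (1 : R) = 1.
  elim: k => [|k IH]; first by rewrite fourier_fun0.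
  rewrite -addn1 PoszD -fourier_funM IH mul1r /fourier_fun !mulr1 mulr_natl.
  by rewrite cos2pi sin2pi.
case: n => k; first exact: nat_case.
by rewrite NegzE -conj_fourier_fun nat_case conjc1.
Qed.

Let is_derive_mulC (a x : R) : is_derive x (1 : R) (fun y => a * y) a.
Proof.
have := is_deriveZ a (is_derive_id x (1 : R)).
by apply: is_derive_val; rewrite /GRing.scale/= mulr1.
Qed.

Lemma is_deriveC_fourier n x : is_deriveC x (fourier_fun n) (freq n * fourier_fun n x).
Proof.
pose a : R := 2 * pi * n%:~R; split.
  have := is_derive1_comp (is_derive_cos (a * x)) (is_derive_mulC a x).
  by apply: is_derive_val => /=; rewrite -/a mul0r sub0r mulNr mulrC.
have := is_derive1_comp (is_derive_sin (a * x)) (is_derive_mulC a x).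
by apply: is_derive_val => /=; rewrite -/a mul0r add0r mulrC.
Qed.

Lemma abs_continuousC_fourier n : abs_continuousC 0 1 (@fourier_fun R n).
Proof.
have key (F dF : R -> R) : (forall x, is_derive x (1 : R) F (dF x)) ->
    (forall x, `|dF x| <= `|2 * pi * n%:~R|) -> abs_continuous 0 1 F.
  move=> FF dFb; apply: (@abs_continuous_lipschitz _ _ (`|2 * pi * n%:~R| + 1)).
    by rewrite ltr_wpDl.
  move=> x y xy; have [|c _ ->] := MVT_segment xy (fun z _ => FF z).
    apply: continuous_subspaceT => z; apply: differentiable_continuous.
    by apply/derivable1_diffP; have [] := FF z.
  rewrite normrM [`|y - x|]ger0_norm ?subr_ge0// ler_wpM2r ?subr_ge0//.
  by rewrite (le_trans (dFb c))// lerDl.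
have h x : `|complex.Re (freq n * fourier_fun n x)| <= `|2 * pi * n%:~R| /\
    `|complex.Im (freq n * fourier_fun n x)| <= `|2 * pi * n%:~R|.
  rewrite /= !mul0r sub0r add0r normrN !normrM; split;
    by rewrite ler_piMr ?mulr_ge0// ler_norml ?cos_geN1 ?cos_le1 ?sin_geN1 ?sin_le1.
split.
  by apply: key (fun x => (is_deriveC_fourier n x).1) (fun x => (h x).1).
by apply: key (fun x => (is_deriveC_fourier n x).2) (fun x => (h x).2).
Qed.

Lemma measurable_fourier n : measurable_fun setT (@complex.Re R \o fourier_fun n) /\
  measurable_fun setT (@complex.Im R \o fourier_fun n).
Proof. exact: measurable_Re_Im (fourier_sqint n). Qed.

Lemma sqint_fourierM f n : f \in @sqint R -> (fun x => f x * fourier_fun n x) \in @sqint R.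
Proof.
move=> fL; have [m1 m2] := measurable_fourier n.
by apply: (@sqint_mul _ _ _ 1) => // x; rewrite sqmod_fourier_fun.
Qed.

Lemma integrableC_fourier f n : f \in @sqint R -> integrableC (fun x => f x * fourier_fun n x).
Proof.
move=> fL; have := integrableC_mul (SqFun fL) (SqFun (fourier_sqint (- n))).
have -> // : (fun x => SqFun fL x * (SqFun (fourier_sqint (- n)) x)^*%C) =
  (fun x => f x * fourier_fun n x).
apply/funext => x; transitivity (f x * (fourier_fun (- n) x)^*%C) => //.
by rewrite conj_fourier_fun opprK.
Qed.

Lemma coef_class (f : sqfun R) n :
  coef e (class_of f) n = integralC (fun x => f x * fourier_fun (- n) x).
Proof.
rewrite /coef [LHS]L2ipE; congr integralC; apply/funext => x.
by rewrite -conj_fourier_fun.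
Qed.

Lemma coef_L2 u n : coef e u n = integralC (fun x => repr u x * fourier_fun (- n) x).
Proof. by rewrite -{1}(class_repr u) coef_class. Qed.

(* Integration by parts against the n-th exponential. *)
Lemma coef_derive f f' u v n : abs_continuousC 0 1 f -> f 0 = f 1 ->
  {ae mu, forall x, is_deriveC x f (f' x)} ->
  represents u f -> represents v f' -> coef e v n = freq n * coef e u n.
Proof.
move=> fA f01 df uf vf.
(* Almost everywhere the derivative of [f] times the conjugate exponential, but written with
   representatives: [f] and [f'] are controlled only almost everywhere on [0, 1] and need not be
   measurable. *)
pose w x := freq (- n) * (repr u x * fourier_fun (- n) x) + repr v x * fourier_fun (- n) x.
have wE : w = freq (- n) *: (fun x => repr u x * fourier_fun (- n) x)
      + (fun x => repr v x * fourier_fun (- n) x) by apply/funext.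
have wL : w \in @sqint R.
  have cl := @sqint_submod_closed R.
  by rewrite wE; apply: cl.2; exact: (sqint_fourierM _ (sqfunP _)).
have : integralC w = f 1 * fourier_fun (- n) 1 - f 0 * fourier_fun (- n) 0.
  apply: (integralC_derive (f := fun x => f x * fourier_fun (- n) x)) => //.
    by apply: abs_continuousCM => //; exact: abs_continuousC_fourier.
  near=> x.
  have dfx : is_deriveC x f (f' x) by near: x.
  have := is_deriveCM dfx (is_deriveC_fourier (- n) x).
  have -> : f' x * fourier_fun (- n) x + f x * (freq (- n) * fourier_fun (- n) x) = w x.
    rewrite /w addrC mulrCA; have -> : repr u x = f x by near: x.
    by have -> : repr v x = f' x by near: x.
  by [].
rewrite fourier_fun_at0 fourier_fun_at1 !mulr1 f01 subrr /w integralC_linear.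
- by rewrite -!coef_L2 freqN mulNr addrC => /eqP; rewrite subr_eq0 => /eqP.
- exact: integrableC_fourier (sqfunP _).
- exact: integrableC_fourier (sqfunP _).
Unshelve. all: by end_near. Qed.

Lemma represents_fourier n : represents (e n) (fourier_fun n).
Proof. exact: repr_class. Qed.

Lemma represents_scale (a : R[i]) u f : represents u f -> represents (a *: u) (fun x => a * f x).
Proof.
move=> uf; have h : represents (a *: u) (a *: repr u).
  by rewrite -{1}(class_repr u) -class_ofZ; exact: repr_class.
near=> x; have -> : repr (a *: u) x = (a *: repr u) x by near: x; exact: h.
by rewrite sqfunZ; congr (_ * _); near: x.
Unshelve. all: by end_near. Qed.

Lemma represents_add u v f g : represents u f -> represents v g ->
  represents (u + v) (fun x => f x + g x).
Proof.
move=> uf vg; have h : represents (u + v) (repr u + repr v).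
  by rewrite -{1}(class_repr u) -{1}(class_repr v) -class_ofD; exact: repr_class.
near=> x; have -> : repr (u + v) x = (repr u + repr v) x by near: x; exact: h.
by rewrite sqfunD; congr (_ + _); near: x.
Unshelve. all: by end_near. Qed.

Lemma represents_eq u v f : represents u f -> represents v f -> u = v.
Proof.
move=> uf vf; rewrite -(class_repr u) -(class_repr v); apply/class_ofP.
by near=> x; transitivity (f x); [|apply/esym]; near: x.
Unshelve. all: by end_near. Qed.

(** Off the diagonal, integration by parts applied to e_m itself gives freq m * c = freq n * c for
    the product c, and the two frequencies differ. *)
Lemma fourier_orthonormal m n : ip (e m) (e n) = (m == n)%:R.
Proof.
have [<-|mn] := eqVneq m n.
  rewrite -[LHS]/(coef e (e m) m) /fourier coef_class /=.
  under [X in integralC X]eq_fun do rewrite fourier_funM subrr fourier_fun0.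
  rewrite /integralC /= !Rintegral_cst// mul0r mul1r mu01_setT.
  by rewrite [RHS]/(1 : R[i]).
have dm : {ae mu, forall x : R, is_deriveC x (fourier_fun m) (freq m * fourier_fun m x)}.
  by apply: aeW => x; exact: is_deriveC_fourier.
have := coef_derive n (abs_continuousC_fourier m)
  (etrans (fourier_fun_at0 m) (esym (fourier_fun_at1 m))) dm
  (represents_fourier m)
  (represents_scale (freq m) (represents_fourier m)).
rewrite /coef ipZl => /eqP; rewrite -subr_eq0 -mulrBl mulf_eq0 subr_eq0.
by rewrite (inj_eq freq_inj) (negbTE mn) => /eqP.
Qed.

End FourierBasis.

(** * Tools for the completeness of the Fourier basis *)

Section Totality.
Context {R : realType}.
Local Notation mu := (mu01 R).
Local Notation e := (@fourier R).
Implicit Types (u v : L2 R) (n : int).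

Lemma continuous_sqint (q : R -> R[i]) :
  {within `[(0 : R), 1], continuous (fun x => complex.Re (q x))} ->
  {within `[(0 : R), 1], continuous (fun x => complex.Im (q x))} ->
  exists Q : sqfun R, forall x, x \in `[(0 : R), 1] -> Q x = q x.
Proof.
move=> c1 c2.
have [M M0 qM] := continuous_itv_bounded c1; have [N N0 qN] := continuous_itv_bounded c2.
pose Q x : R[i] := Complex (((fun x => complex.Re (q x)) \_ [set` `[0%R : R, 1%R]]) x)
  (((fun x => complex.Im (q x)) \_ [set` `[0%R : R, 1%R]]) x).
have mQ (F : R -> R) : {within `[(0 : R), 1], continuous F} ->
    measurable_fun setT (F \_ [set` `[0%R : R, 1%R]]).
  move=> cF; apply: (measurable_restrictT _ _).1 => //.
  exact: subspace_continuous_measurable_fun.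
have QL : Q \in @sqint R.
  rewrite (_ : Q = fun x => fourier_fun 0 x * Q x); last first.
    by apply/funext => x; rewrite fourier_fun0 mul1r.
  apply: (@sqint_mul _ _ _ (M ^+ 2 + N ^+ 2)); [exact: fourier_sqint|exact: mQ|exact: mQ|].
  move=> x; rewrite /sqmod/= !patchE.
  case: ifPn => [|_]; last by rewrite expr0n addr0 addr_ge0 ?sqr_ge0.
  rewrite inE/= => x01; apply: lerD.
    by rewrite -real_normK ?num_real// ler_pXn2r ?nnegrE ?qM// ltW.
  by rewrite -real_normK ?num_real// ler_pXn2r ?nnegrE ?qN// ltW.
exists (SqFun QL) => x x01; rewrite /Q/= !patchE mem_set//.
by case: (q x).
Qed.

Lemma abs_continuousC_sqint (f : R -> R[i]) : abs_continuousC 0 1 f ->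
  exists u : L2 R, represents u f.
Proof.
move=> [/abs_continuous_continuous c1 /abs_continuous_continuous c2].
have [Q Qf] := continuous_sqint c1 c2; exists (class_of Q).
have h := @ae_mu01_itv R; have QQ := repr_class Q; near=> x.
transitivity (Q x); first by near: x.
by apply: Qf; near: x.
Unshelve. all: by end_near. Qed.

(** A removable singularity: divided by the square of the increment, [N] and [D] have limits [A] and
    [B] at [x0], so A / B fills the gap. *)
Lemma continuous_quotient (N D : R -> R) (x0 A B : R) :
  {within `[0, 1], continuous N} -> {within `[0, 1], continuous D} ->
  N (h + x0) / h ^+ 2 @[h --> 0^'] --> A -> D (h + x0) / h ^+ 2 @[h --> 0^'] --> B ->
  B != 0 -> (forall x, x \in `[0, 1] -> x != x0 -> D x != 0) ->
  {within `[0, 1], continuous (fun x => if x == x0 then A / B else N x / D x)}.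
Proof.
move=> cN cD NA DB B0 D0; apply/continuous_withinP => t t01.
have [->|tx0] := eqVneq t x0.
  rewrite ?eqxx.
  have : N (h + x0) / h ^+ 2 / (D (h + x0) / h ^+ 2) @[h --> (0 : R)^'] --> A / B.
    exact: cvgM NA (cvgV B0 DB).
  move=> /cvgrPdist_lt q.
  apply/cvgrPdist_lt => r r0; have [d /= d0 dq] := q _ r0.
  rewrite near_withinE; near=> s => s01; case: eqVneq => [_|sx0]; first by rewrite subrr normr0.
  have := dq (s - x0); rewrite /ball_/= sub0r normrN subr_eq0 subrK.
  have -> : N s / (s - x0) ^+ 2 / (D s / (s - x0) ^+ 2) = N s / D s.
    have : (s - x0) ^+ 2 != 0 by rewrite expf_neq0// subr_eq0.
    by move: ((s - x0) ^+ 2) => c c0; rewrite invf_div mulrA mulfVK.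
  apply => //; rewrite distrC; near: s; exact: cvgr_dist_lt.
have Nt : N s @[s --> within `[0, 1] (nbhs t)] --> N t by move/continuous_withinP : cN; exact.
have Dt : D s @[s --> within `[0, 1] (nbhs t)] --> D t by move/continuous_withinP : cD; exact.
rewrite ?(negbTE tx0).
apply: cvg_trans (cvgM Nt (cvgV (D0 _ t01 tx0) Dt)); apply: near_eq_cvg.
rewrite near_withinE; near=> s => _; rewrite ifN//.
by near: s; apply: open_nbhs_nbhs; split => //; exact: open_neq.
Unshelve. all: by end_near. Qed.

Lemma sin_eq0_itv (y : R) : - pi < y < pi -> sin y = 0 -> y = 0.
Proof.
move=> /andP[y1 y2] s0; case: (ltgtP y 0) => // y0.
  have : 0 < sin (- y) by rewrite sin_gt0_pi// oppr_gt0 y0 ltrNl.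
  by rewrite sinN s0 oppr0 ltxx.
by have := sin_gt0_pi; move=> /(_ _ y); rewrite y0 y2 s0 ltxx => /(_ isT).
Qed.

(** Equality gives cos (2 pi (x - x0)) = 1, hence sin (pi (x - x0)) = 0; since [x0] is interior, |x
    - x0| < 1 excludes nonzero periods. *)
Lemma fourier_fun1_inj (x x0 : R) : x \in `[0, 1] -> x0 \in `]0, 1[ ->
  fourier_fun 1 x = fourier_fun 1 x0 -> x = x0.
Proof.
rewrite !in_itv/= => /andP[xg0 x1] /andP[y0 y1] E.
have : fourier_fun 1 x * fourier_fun (- 1) x0 = 1.
  by rewrite E fourier_funM subrr fourier_fun0.
rewrite -conj_fourier_fun /fourier_fun !mulr1 => -[+ _].
rewrite mulrN opprK -cosB -mulrBr mulrAC -mulrA mulrC -[2]/(1 + 1) mulrDr mulr1.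
rewrite cosD -!expr2 cos2sin2 => h.
have s0 : sin (pi * (x - x0)) = 0.
  by apply/eqP; rewrite -sqrf_eq0; apply/eqP; move: h; rewrite [(x - x0) * pi]mulrC; lra.
have := sin_eq0_itv _ s0; rewrite -{1}(mulrN1 pi) -[X in _ < _ < X](mulr1 pi) !ltr_pM2l ?pi_gt0//.
move=> /(_ _) H; apply/eqP; rewrite -subr_eq0; have /eqP : pi * (x - x0) = 0.
  by apply: H; lra.
by rewrite mulf_eq0 gt_eqF ?pi_gt0.
Qed.

(* Chernoff's quotient: F is differentiable at x0, so dividing F - F x0 by
   e_1 - e_1 x0 leaves a continuous function. *)
Lemma chernoff_quotient (F : R -> R[i]) (l : R[i]) (x0 : R) :
  {within `[(0 : R), 1], continuous (fun x => complex.Re (F x))} ->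
  {within `[(0 : R), 1], continuous (fun x => complex.Im (F x))} ->
  x0 \in `]0, 1[ -> is_deriveC x0 F l ->
  exists Q : sqfun R, forall x, x \in `[(0 : R), 1] ->
    Q x * (fourier_fun 1 x - fourier_fun 1 x0) = F x - F x0.
Proof.
move=> c1 c2 x01 [dF1 dF2].
have [dE1 dE2] := is_deriveC_fourier 1 x0.
have cE1 := abs_continuous_continuous (@abs_continuousC_fourier R 1).1.
have cE2 := abs_continuous_continuous (@abs_continuousC_fourier R 1).2.
set m := freq 1 * _ in dE1 dE2.
pose a x := complex.Re (F x) - complex.Re (F x0).
pose b x := complex.Im (F x) - complex.Im (F x0).
pose c (x : R) := complex.Re (fourier_fun 1 x) - complex.Re (fourier_fun 1 x0).
pose s (x : R) := complex.Im (fourier_fun 1 x) - complex.Im (fourier_fun 1 x0).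
have wB (f : R -> R) (k : R) : {within `[(0 : R), 1], continuous f} ->
    forall t, `[(0 : R), 1]%classic t -> f z - k @[z --> within `[0, 1] (nbhs t)] --> f t - k.
  by move=> /continuous_withinP cf t t01; apply: cvgB; [exact: cf|exact: cvg_cst].
have dq (f : R -> R) (k : R) : is_derive x0 (1 : R) f k ->
    (f (h + x0) - f x0) / h @[h --> (0 : R)^'] --> k.
  by move=> /is_deriveP; under eq_fun do rewrite /GRing.scale/= mulrC.
have sq (f g : R -> R) (k j : R) : f (h + x0) / h @[h --> (0 : R)^'] --> k ->
    g (h + x0) / h @[h --> (0 : R)^'] --> j ->
    f (h + x0) * g (h + x0) / h ^+ 2 @[h --> (0 : R)^'] --> k * j.
  move=> fk gj; apply: cvg_trans (cvgM fk gj); apply: near_eq_cvg.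
  by near=> h; rewrite expr2 invfM mulrACA.
have B0 : complex.Re m * complex.Re m + complex.Im m * complex.Im m != 0.
  have -> : complex.Re m * complex.Re m + complex.Im m * complex.Im m = sqmod m by [].
  rewrite /m sqmodM sqmod_fourier_fun mulr1 /sqmod/= expr0n add0r.
  by rewrite expf_neq0// mulr1 mulf_neq0 ?pnatr_eq0// gt_eqF ?pi_gt0.
pose D x := c x * c x + s x * s x.
have cD : {within `[(0 : R), 1], continuous D}.
  by apply/continuous_withinP => t t01; apply: cvgD; apply: cvgM; exact: wB.
have DB : D (h + x0) / h ^+ 2 @[h --> (0 : R)^'] -->
    complex.Re m * complex.Re m + complex.Im m * complex.Im m.
  apply: cvg_trans (cvgD (sq c c _ _ (dq _ _ dE1) (dq _ _ dE1)) (sq s s _ _ (dq _ _ dE2) (dq _ _ dE2))); apply: near_eq_cvg.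
  by near=> h; rewrite !fctE -mulrDl.
have D0 x : x \in `[0, 1] -> x != x0 -> D x != 0.
  move=> x01' xx0; apply/eqP => Dx; case/eqP: xx0; apply: (fourier_fun1_inj x01' x01).
  apply/eqP; rewrite -subr_eq0; apply/eqP/sqmod_eq0.
  by rewrite /sqmod ReB ImB; exact: Dx.
(* Real and imaginary numerators of (a + i b) / (c + i s) after multiplication by the conjugate; [D]
   is the squared modulus of the denominator. *)
pose N1 x := a x * c x + b x * s x.
pose N2 x := b x * c x - a x * s x.
have q1 := continuous_quotient (N := N1) (D := D) (x0 := x0) _ cD _ DB B0 D0.
have q2 := continuous_quotient (N := N2) (D := D) (x0 := x0) _ cD _ DB B0 D0.
have {}q1 := q1 (complex.Re l * complex.Re m + complex.Im l * complex.Im m).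
have {}q2 := q2 (complex.Im l * complex.Re m - complex.Re l * complex.Im m).
set A1 := _ + _ in q1; set A2 := _ - _ in q2; set B := _ + _ in q1 q2.
have [||Q QE] := @continuous_sqint (fun x => Complex
   (if x == x0 then A1 / B else N1 x / D x) (if x == x0 then A2 / B else N2 x / D x)).
- apply: q1; first by apply/continuous_withinP => t t01; apply: cvgD; apply: cvgM; exact: wB.
  apply: cvg_trans (cvgD (sq a c _ _ (dq _ _ dF1) (dq _ _ dE1)) (sq b s _ _ (dq _ _ dF2) (dq _ _ dE2))); apply: near_eq_cvg.
  by near=> h; rewrite !fctE -mulrDl.
- apply: q2; first by apply/continuous_withinP => t t01; apply: cvgB; apply: cvgM; exact: wB.
  apply: cvg_trans (cvgB (sq b c _ _ (dq _ _ dF2) (dq _ _ dE1)) (sq a s _ _ (dq _ _ dF1) (dq _ _ dE2))); apply: near_eq_cvg.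
  by near=> h; rewrite !fctE -mulrBl.
exists Q => x x01'; rewrite QE//; have [->|xx0] := eqVneq x x0.
  by rewrite !subrr mulr0.
have Dx := D0 _ x01' xx0.
have -> : fourier_fun 1 x - fourier_fun 1 x0 = Complex (c x) (s x).
  by apply/eqP; rewrite eq_complex ReB ImB !eqxx.
have -> : F x - F x0 = Complex (a x) (b x).
  by apply/eqP; rewrite eq_complex ReB ImB !eqxx.
apply/eqP; rewrite eq_complex/=; apply/andP; split; apply/eqP; rewrite /N1 /N2;
  move: Dx; rewrite /D; move: (a x) (b x) (c x) (s x) => a' b' c' s' Dx; by field.
Unshelve. all: by end_near. Qed.

Lemma unimodular_shift_eq0 (Q : L2 R) (z : R[i]) : sqmod z = 1 ->
  (forall n, n != 0 -> coef e Q (n - 1) = z * coef e Q n) -> forall n, coef e Q n = 0.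
Proof.
move=> z1 h; pose c n := sqmod (coef e Q n).
have cS n : n != 0 -> c (n - 1) = c n by move=> n0; rewrite /c h// sqmodM z1 mul1r.
have vanish (a : R) (f : nat -> int) : injective f -> (forall k, c (f k) = a) -> a = 0.
  move=> fI fa; apply/eqP; rewrite eq_le; apply/andP; split; last first.
    by rewrite -(fa 0%N) sqmod_ge0.
  have bound k : k%:R * a <= hnorm Q ^+ 2.
    have := @bessel _ _ _ (@fourier_orthonormal R) (map f (iota 0 k)) Q.
    rewrite map_inj_uniq// iota_uniq => /(_ isT); rewrite big_map.
    rewrite (eq_bigr (fun=> a)) => [|i _]; last exact: fa.
    by rewrite big_const_seq count_predT size_iota iter_addr addr0 mulr_natl.
  rewrite leNgt; apply/negP => a0.
  have := archi_boundP (_ : 0 <= hnorm Q ^+ 2 / a); rewrite divr_ge0 ?sqr_ge0 ?ltW// => /(_ isT).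
  by rewrite ltr_pdivrMr// ltNge bound.
(* The recurrence is missing only at n = 0, so nothing links -1 to 0: moduli are constant separately
   on nonnegative and on negative integers. *)
have pos k : c (Posz k) = c 0.
  elim: k => // k IH; rewrite -IH -(cS (Posz k.+1))//.
  by rewrite -addn1 PoszD addrK.
have neg k : c (Negz k) = c (Negz 0).
  elim: k => // k IH; rewrite -IH -(cS (Negz k))//.
  by congr c; rewrite !NegzE -opprD -[X in _ = - X]/(k.+1%:Z + 1%:Z) -PoszD addn1.
move=> [k|k]; apply: sqmod_eq0; rewrite -/(c _).
  by rewrite pos; apply: (vanish _ Posz) => // x y [].
by rewrite neg; apply: (vanish _ Negz) => // x y [].
Qed.

End Totality.

Section Derivation.
Context {R : realType}.
Local Notation mu := (mu01 R).
Local Notation e := (@fourier R).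
Implicit Types (u v : L2 R) (n : int).

Definition primitiveC (w : R -> R[i]) (x : R) : R[i] :=
  Complex (primitive (fun t => complex.Re (w t)) x) (primitive (fun t => complex.Im (w t)) x).

Lemma primitiveCP (w : R -> R[i]) : w \in @sqint R ->
  [/\ abs_continuousC 0 1 (primitiveC w),
      {ae mu, forall x, is_deriveC x (primitiveC w) (w x)},
      primitiveC w 0 = 0 & primitiveC w 1 = integralC w].
Proof.
move=> /andP[w1 w2].
have L1 (f : R -> R) : f \in Lfun mu 2%:E -> mu.-integrable setT (EFin \o f).
  by move=> f2; apply/Lfun1_integrable; apply: Lfun_subset12 f2; rewrite mu01_setT.
split.
- by split; exact: abs_continuous_primitive.
- by apply: filterS2 (primitive_derive (L1 _ w1)) (primitive_derive (L1 _ w2)) => x; split.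
- by rewrite /primitiveC !primitive0.
- by rewrite /primitiveC (primitive1 (L1 _ w1)) (primitive1 (L1 _ w2)).
Qed.

Lemma represents_repr u : represents u (repr u).
Proof. exact: aeW. Qed.

Lemma coef_repr0 u : coef e u 0 = integralC (repr u).
Proof.
by rewrite coef_L2; congr integralC; apply/funext => x; rewrite oppr0 fourier_fun0 mulr1.
Qed.

(** Were [f t] different from [k], so would be [f] on a whole ball around [t], and that ball would
    lie in a null set. *)
Lemma continuous_ae_eq (f : R -> R) (k t : R) : {within `[0, 1], continuous f} ->
  {ae mu, forall x, f x = k} -> t \in `]0, 1[ -> f t = k.
Proof.
move=> cf [N [mN N0 fN]] t01; apply: contrapT => /eqP ftk.
have t01' : t \in `[0, 1] by apply: subset_itv_oo_cc t01.
have ft : f s @[s --> nbhs t] --> f t.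
  have : f s @[s --> within `[0, 1] (nbhs t)] --> f t by move/continuous_withinP : cf; exact.
  move=> h B /h hB; apply: filterS2 (near_in_itvoo t01) hB => s s01; apply.
  exact: subset_itv_oo_cc s01.
have [r /= r0 rP] : nbhs t [set s | f s != k /\ s \in `]0, 1[].
  apply: filterI.
    apply: (ft [set y | y != k]); apply: open_nbhs_nbhs.
    by split; [exact: open_neq|exact: ftk].
  exact: near_in_itvoo.
have : (mu (ball t r) <= mu N)%E.
  apply: le_measure; rewrite ?inE//; first exact: measurable_ball.
  by move=> s /rP[/eqP fs _]; apply: fN.
rewrite N0 mu01E setIidl; last first.
  by move=> s /rP[_ s01]; apply: subset_itv_oo_cc s01.
by apply/negP; rewrite (lebesgue_measure_ball _ (ltW r0)) -ltNge lte_fin pmulrn_lgt0.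
Qed.

Lemma is_derive_near_cst (f : R -> R) (k l t : R) : (forall s, s \in `]0, 1[ -> f s = k) ->
  t \in `]0, 1[ -> is_derive t 1 f l -> l = 0.
Proof.
move=> fk t01 /is_deriveP df; apply: (cvg_unique _ df) => //.
have c0 : (fun=> 0) @ (0 : R)^' --> (0 : R) by exact: cvg_cst.
apply: cvg_trans c0; apply: near_eq_cvg.
have h0 : h + t @[h --> (0 : R)^'] --> t.
  rewrite -[X in _ --> X]add0r; apply: cvgD; last exact: cvg_cst.
  exact: nbhs_dnbhs.
have : \forall h \near (0 : R)^', h + t \in `]0, 1[.
  exact: h0 (near_in_itvoo t01).
by apply: filterS => h ht; rewrite !fk// subrr scaler0.
Qed.

Lemma freq_neq0 n : n != 0 -> freq n != 0 :> R[i].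
Proof. by rewrite -[X in _ -> _ != X]freq0 (inj_eq freq_inj). Qed.

Lemma fourier_total u : (forall n, coef e u n = 0) -> u = 0.
Proof.
move=> u0; pose F := primitiveC (repr u).
have [FA dF F0 F1] := primitiveCP (sqfunP (repr u)).
have [U UF] := abs_continuousC_sqint FA.
have Un n : n != 0 -> coef e U n = 0.
  (* The mean of [u] is its coefficient 0, which vanishes; the primitive is therefore periodic and
     integration by parts applies. *)
  move=> n0; have F01 : F 0 = F 1 by rewrite [F 0]F0 [F 1]F1 -coef_repr0 u0.
  have := coef_derive n FA F01 dF UF (represents_repr u).
  rewrite u0 => /esym/eqP; rewrite mulf_eq0 (negbTE (freq_neq0 n0)).
  by move=> /eqP.
have FK : {ae mu, forall x0, F x0 = coef e U 0}.
  apply: filterS2 dF (@ae_mu01_oo R) => x0 dFx x01.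
  have [Q QE] := chernoff_quotient (abs_continuous_continuous FA.1)
    (abs_continuous_continuous FA.2) x01 dFx.
  pose V := class_of Q.
  pose W := class_of (SqFun (sqint_fourierM 1 (sqfunP Q))).
  have Wn n : coef e W n = coef e V (n - 1).
    rewrite /W /V !coef_class; congr integralC; apply/funext => x /=.
    by rewrite -mulrA fourier_funM opprB.
  (* The identity Q (e_1 - e_1 x0) + F x0 = F read in L2. Multiplication by e_1 shifts coefficients,
     so for n != 0 the vanishing of those of [U] becomes a recurrence for those of [V]. *)
  have UE : U = W + (- fourier_fun 1 x0 *: V + F x0 *: e 0).
    apply: (represents_eq UF).
    have h := represents_add (repr_class _ : represents W _)
      (represents_add (represents_scale (- fourier_fun 1 x0) (repr_class _ : represents V _))
        (represents_scale (F x0) (represents_fourier 0))).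
    have oo := @ae_mu01_itv R; near=> x.
    transitivity (Q x * fourier_fun 1 x + (- fourier_fun 1 x0 * Q x + F x0 * fourier_fun 0 x)).
      by near: x; exact: h.
    rewrite fourier_fun0 mulr1 addrA mulNr [fourier_fun 1 x0 * _]mulrC -mulrBr QE ?subrK//.
    by near: x.
  have Uc n : coef e U n = coef e V (n - 1) - fourier_fun 1 x0 * coef e V n
      + F x0 * (n == 0)%:R.
    rewrite {1}UE -Wn /coef !ipDl !ipZl mulNr addrA; congr (_ + _ * _).
    by rewrite fourier_orthonormal eq_sym.
  have V0 n : coef e V n = 0.
    move: n; apply: (unimodular_shift_eq0 (sqmod_fourier_fun 1 x0)) => n n0.
    apply/eqP; rewrite -subr_eq0; apply/eqP; have := Uc n.
    by rewrite Un// (negbTE n0) mulr0 addr0 => /esym.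
  by rewrite Uc !V0 mulr0 subr0 add0r mulr1.
(* [F] is constant almost everywhere, hence by continuity on ]0, 1[; its derivative there, almost
   everywhere a value of [u], is thus zero. *)
have [k1 k2] : (forall t, t \in `]0, 1[ -> complex.Re (F t) = complex.Re (coef e U 0)) /\
    (forall t, t \in `]0, 1[ -> complex.Im (F t) = complex.Im (coef e U 0)).
  split=> t; apply: (@continuous_ae_eq (fun x => _ (F x))).
  - exact: abs_continuous_continuous FA.1.
  - by apply: filterS FK => x ->.
  - exact: abs_continuous_continuous FA.2.
  - by apply: filterS FK => x ->.
apply: (represents_eq (represents_repr u)).
have h0 : represents (0 : L2 R) (fun=> 0).
  by have := represents_scale 0 (represents_repr u); rewrite scale0r;
    under [X in represents _ X -> _]eq_fun do rewrite mul0r.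
have hu : {ae mu, forall x, repr u x = 0}.
  apply: filterS2 dF (@ae_mu01_oo R) => x [d1 d2] x01.
  have := is_derive_near_cst k1 x01 d1; have := is_derive_near_cst k2 x01 d2.
  by case: (repr u x) => p q /= -> ->.
near=> x; transitivity (0 : R[i]); first by near: x; exact: h0.
by apply/esym; near: x.
Unshelve. all: by end_near. Qed.

Lemma fourier_basis : orthonormal_basis e.
Proof.
exact: (total_orthonormal_basis (@fourier_orthonormal R) (@hcomplete_L2 R) fourier_total).
Qed.

(** One inclusion is integration by parts. For the other, i v has a primitive [F], periodic because
    the eigenvalue at n = 0 is zero; [F] has the coefficients of [u] for n != 0, and an additive
    constant adjusts the remaining one. *)
Lemma derivation_graphE : @derivation_graph R =
  [set y | forall n, coef e y.2 n = (2 * pi * n%:~R)%:C%C * coef e y.1 n].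
Proof.
have freqE n : freq n = 'i%C * (2 * pi * n%:~R)%:C%C :> R[i].
  by apply/eqP; rewrite eq_complex/=; apply/andP; split; apply/eqP; ring.
have ii : - 'i%C * 'i%C = 1 :> R[i].
  by apply/eqP; rewrite eq_complex/= !(mul0r, mulr0, mulN1r, oppr0, subr0, add0r, addr0, opprK) !eqxx.
apply/seteqP; split=> [[u v] [f [f' [fA f01 df uf vf]]] n|[u v] uv]/=.
  have vf' : represents ('i%C *: v) f'.
    have h := represents_scale 'i%C vf; near=> x.
    transitivity ('i%C * (- 'i%C * f' x)); first by near: x; exact: h.
    by rewrite mulrA mulrN -mulNr ii mul1r.
  have := coef_derive n fA f01 df uf vf'.
  rewrite freqE /coef ipZl -mulrA => /mulfI; apply.
  by rewrite eq_complex/= oner_eq0 andbF.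
pose w := 'i%C *: v; pose F := primitiveC (repr w).
have [FA dF F0 F1] := primitiveCP (sqfunP (repr w)).
have wn n : coef e w n = freq n * coef e u n by rewrite /coef ipZl [ip v _]uv freqE mulrA.
have F01 : F 0 = F 1 by rewrite [F 0]F0 [F 1]F1 -coef_repr0 wn freq0 mul0r.
have [U UF] := abs_continuousC_sqint FA.
pose c := coef e (u - U) 0.
have uE : u = U + c *: e 0.
  apply/eqP; rewrite -subr_eq0; apply/eqP/fourier_total => n.
  rewrite /coef opprD addrA ipBl -/(coef e (u - U) n) ipZl fourier_orthonormal.
  have [<-|n0] := eqVneq 0 n; first by rewrite mulr1 subrr.
  rewrite mulr0 subr0 /coef ipBl.
  have := coef_derive n FA F01 dF UF (represents_repr w).
  have fn : freq n != 0 :> R[i] by apply: freq_neq0; rewrite eq_sym.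
  by rewrite wn => /(mulfI fn); rewrite /coef => ->; rewrite subrr.
exists (fun x => F x + c), (repr w); split.
- split.
    have h : abs_continuous 0 1 (fun=> complex.Re c).
      by apply: (@abs_continuous_lipschitz _ _ 1) => // x y xy; rewrite subrr normr0 mul1r subr_ge0.
    have := abs_continuousD FA.1 h.
    by under eq_fun do rewrite -ReD.
  have h : abs_continuous 0 1 (fun=> complex.Im c).
    by apply: (@abs_continuous_lipschitz _ _ 1) => // x y xy; rewrite subrr normr0 mul1r subr_ge0.
  have := abs_continuousD FA.2 h.
  by under eq_fun do rewrite -ImD.
- by rewrite F01.
- apply: filterS dF => x [d1 d2]; split.
    have := is_deriveD d1 (is_derive_cst (complex.Re c) x (1 : R)); rewrite addr0.
    by congr is_derive; apply/funext => z; rewrite !fctE ReD.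
  have := is_deriveD d2 (is_derive_cst (complex.Im c) x (1 : R)); rewrite addr0.
  by congr is_derive; apply/funext => z; rewrite !fctE ImD.
- rewrite /= {1}uE.
  have := represents_add UF (represents_scale c (represents_fourier 0)).
  by under [X in represents _ X -> _]eq_fun do rewrite fourier_fun0 mulr1.
- have := represents_scale (- 'i%C) (represents_repr w).
  by rewrite /w scalerA ii scale1r.
Unshelve. all: by end_near. Qed.

End Derivation.

(** * The theorem *)

Section DerivationAngles.
Context {R : realType}.

Definition derivation_angle (n : int) : R := atan (2 * pi * n%:~R).

Lemma derivation_angle_lt n : `|derivation_angle n| < pi / 2.
Proof. by rewrite ltr_norml atan_gtNpi2 atan_ltpi2. Qed.

Lemma derivation_angle_sup (d : R) : 0 < d -> exists n, pi / 2 - d < derivation_angle n.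
Proof.
move=> d0; have pi0 := pi_gt0 R.
pose a := Num.max 0 (pi / 2 - d).
have a1 : a < pi / 2 by rewrite gt_max divr_gt0//= gtrDl oppr_lt0.
have a0 : 0 <= a by rewrite le_max lexx.
have aI : - (pi / 2) < a < pi / 2.
  by rewrite a1 andbT (lt_le_trans _ a0)// oppr_lt0 divr_gt0.
have ta : 0 <= tan a.
  have [->|an] := eqVneq a 0; first by rewrite tan0.
  apply: divr_ge0; apply/ltW; first by rewrite sin_gt0_pi// lt_def an a0/=; lra.
  by apply: cos_gt0_pihalf.
(* An integer n > tan a also has 2 pi n > tan a. Truncating at 0 made tan a nonnegative, as the
   archimedean bound requires. *)
exists (Posz (Num.bound (tan a))).
apply: (@le_lt_trans _ _ a); first by rewrite le_max lexx orbT.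
rewrite -[ltLHS](tanK (x := a)) ?in_itv//= /derivation_angle; apply: (lt_atan _).
apply: (lt_le_trans (archi_boundP ta)).
have := @pi_ge2 R; set p := pi; set m : R := (Num.bound _)%:R.
rewrite -[(Posz _)%:~R]/m => p2; have m0 : 0 <= m by rewrite /m.
by rewrite ler_peMl//; lra.
Qed.

Lemma tan_derivation_angle n : tan (derivation_angle n) = 2 * pi * n%:~R.
Proof. exact: atanK. Qed.

End DerivationAngles.

Theorem theorem5p15 (R : realType) :
  let H : innerSpaceType R := L2 R in
  let Gamma := @derivation_graph R in
  let P0 := proj_onto (graph (0 : bop H H)) in
  let PGamma := proj_onto Gamma in
  [/\ selfadjoint_operator Gamma, closed_operator Gamma & unbounded Gamma] /\
  exists gamma : R -> bop (H * H)%type (H * H)%type,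
    [/\ minimal_geodesic P0 PGamma gamma,
        (forall gamma', minimal_geodesic P0 PGamma gamma' ->
           forall t, t \in `[0, 1] -> gamma' t = gamma t) &
        exists T : R -> bop H H,
          T 0 = 0 /\
          (forall t, 0 < t < 1 ->
             [/\ selfadjoint (T t),
                 diagonal_in fourier
                   (fun n : int => if n == 0 then 0
                                   else tan (t * atan (2 * pi * n%:~R))) (T t) &
                 gamma t = proj_onto (graph (T t))]) /\
          [/\ (forall t, 0 < t < 1 -> `|T t| = tan (t * (pi / 2))),
              `|T t| @[t --> 0^'+] --> (0 : R) &
              `|T t| @[t --> 1^'-] --> +oo] /\
          (forall t, 0 < t < 1 -> principal_domain H (gamma t)) /\
          (~ principal_domain H (gamma 1) /\
           boundary_in (riemann_sphere H) (principal_domain H) PGamma) /\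
          optimal_bounded_deformation Gamma 1 T].
Proof.
move=> H Gamma P0 PGamma.
have cV : hcomplete H by exact: hcomplete_L2.
have eB : orthonormal_basis (@fourier R : int -> H) by exact: fourier_basis.
have thetaP := @derivation_angle_lt R.
have theta_sup := @derivation_angle_sup R.
(* From here on the derivation is seen only through its eigenvalues 2 pi n = tan theta_n. *)
have GE : Gamma = tangraph (@fourier R : int -> H) derivation_angle.
  by rewrite /Gamma derivation_graphE; apply/seteqP; split => y yG n;
    have := yG n; rewrite tan_derivation_angle.
have P0E : P0 = std_proj H.
  exact: (proj_onto_graph0 cV eB thetaP).
have PGE : PGamma = gam (@fourier R : int -> H) derivation_angle 1.
  by rewrite /PGamma GE proj_onto_tangraph.
have itv (t : R) : 0 < t < 1 -> 0 <= t < 1 by move=> /andP[/ltW -> ->].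
split.
  rewrite GE; split; [split|split|].
  - exact: tangraph_operator.
  - exact: tangraph_dense.
  - exact: tangraph_adjoint.
  - exact: tangraph_operator.
  - exact: tangraph_closed.
  - exact: tangraph_unbounded.
have gm := gam_minimal cV eB thetaP theta_sup.
exists (gam (@fourier R : int -> H) derivation_angle); split.
- by rewrite P0E PGE.
- move=> gamma'; rewrite P0E PGE => gm' t t01.
  exact: (gam_unique cV eB thetaP theta_sup gm').
exists (tandiag (@fourier R : int -> H) derivation_angle); split; first exact: tandiag0.
have normT t : 0 < t < 1 ->
    `|tandiag (@fourier R : int -> H) derivation_angle t| = tan (t * (pi / 2)).
  by move=> /itv; exact: norm_tandiag.
split.
  move=> t t01; have tb := tan_bounded thetaP (itv _ t01); split.
  - exact: selfadjoint_diag tb.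
  - split=> // n; rewrite (diag_basis cV eB tb).
    (* The separate value at n = 0 agrees with the general formula, as atan 0 = 0. *)
    by case: eqVneq => [->|//]; rewrite /derivation_angle mulr0 atan0 mulr0 tan0.
  - by rewrite proj_onto_graph// itv.
split; [split|split; [|split; [split|]]].
- exact: normT.
- apply: cvg_trans (@tan_pihalf_cvg0 R); apply: near_eq_cvg; near=> t.
  rewrite normT//; apply/andP; split; first by near: t; exact: nbhs_right_gt.
  by near: t; apply: nbhs_right_lt; exact: ltr01.
- apply: cvg_trans (@tan_pihalf_cvgy R); apply: near_eq_cvg; near=> t.
  rewrite normT//; apply/andP; split; last by near: t; exact: nbhs_left_lt.
  by near: t; apply: nbhs_left_gt; exact: ltr01.
- by move=> t /itv; exact: gam_principal.
- exact: gam1_nprincipal.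
- by rewrite PGE; exact: gam1_boundary.
- by rewrite GE; exact: gam_optimal.
Unshelve. all: by end_near. Qed.
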